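(* Let $n\ge4$ and let $\mathcal{T}=(V,E)$ be a 4-uniform hypergraph with $V=\{1,\ldots,n\}$ and $|E|=n-3$. For each $v\in V$, let $E_v=\{e\in E:v\in e\}$ and fix a general linear subvariety $Y_v\subseteq(\mathbb{P}^1)^E$ of type $E_v$, i.e. $Y_v=Y(E_v,P_v)$ for a general point $P_v\in(\mathbb{P}^1)^{E_v}$. Then there are exactly $d_{\mathcal{T}}$ curves $C\in\mathcal{M}_{\mathbb{P}^1,E}$ such that $C\cap Y_v\neq\emptyset$ for all $v\in V$. Equivalently, the corresponding incidence subvarieties $Z_v=Z(E_v,P_v)\subseteq\mathcal{M}_{\mathbb{P}^1,E}$ $(v\in V)$ intersect in exactly $d_{\mathcal{T}}$ points.
   Context: Everything is over $\mathbb{C}$. A 4-uniform hypergraph $\mathcal{T}=(V,E)$ consists of a finite vertex set $V$ and a finite family $E$ of hyperedges, each a 4-element subset of $V$; repeated hyperedges are allowed (i.e. $E$ is an indexed family). Cross-ratio degree: the cross-ratio of distinct points of $\mathbb{P}^1$ is $\mathrm{CR}(z_1,z_2,z_3,z_4)=\frac{(z_3-z_1)(z_4-z_2)}{(z_3-z_2)(z_4-z_1)}\in\mathbb{C}\setminus\{0,1\}$ (extended as usual if some $z_i=\infty$). $M_{0,n}$ is the $(n-3)$-dimensional variety of $n$-tuples of distinct points of $\mathbb{P}^1$ up to Möbius transformation. Listing the hyperedges as $e_1,\ldots,e_{n-3}$ and ordering each as $e_i=(v_{i,1},\ldots,v_{i,4})$, define $\mathrm{CR}_{\mathcal{T}}:M_{0,n}\to(\mathbb{C}\setminus\{0,1\})^{n-3}$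 by $(z_1,\ldots,z_n)\mapsto(\mathrm{CR}(z_{v_{i,1}},\ldots,z_{v_{i,4}}))_{i}$. Then $d_{\mathcal{T}}$ is the degree of $\mathrm{CR}_{\mathcal{T}}$: the number of points in the fiber over a general point ($0$ if the map is not dominant); it is independent of the orderings. For a finite nonempty set $S$, $\mathcal{M}_{\mathbb{P}^1,S}$ denotes the moduli space of smooth connected curves in $(\mathbb{P}^1)^S$ of multidegree $(1,\ldots,1)$ (curves whose projection to each factor $\mathbb{P}^1$ has degree 1, hence is an isomorphism); it is a smooth quasiprojective variety of dimension $3(|S|-1)$. For $S'\subseteq S$ and $P\in(\mathbb{P}^1)^{S'}$, let $\pi_{S'}:(\mathbb{P}^1)^S\to(\mathbb{P}^1)^{S'}$ be the projection; the linear subvariety of type $S'$ determined by $P$ is $Y(S',P)=\pi_{S'}^{-1}(P)$ (for $S'=\emptyset$, $(\mathbb{P}^1)^{\emptyset}$ is a point and $Y(\emptyset,P)=(\mathbb{P}^1)^S$). The incidence subvariety is $Z(S',P)=\{C\in\mathcal{M}_{\mathbb{P}^1,S}:C\cap Y(S',P)\neq\emptyset\}$. ''General'' means: for all $(P_v)_{v\in V}$ in some nonempty Zariski open subset of $\prod_{v\in V}(\mathbb{P}^1)^{E_v}$. *)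

(* Defs.v *)
From HB Require Import structures.
From mathcomp Require Import all_boot all_order all_algebra.
From mathcomp Require Import boolp classical_sets functions cardinality reals.
From mathcomp Require Import complex mpoly ring.

Set Implicit Arguments.
Unset Strict Implicit.
Unset Printing Implicit Defensive.

Import Order.TTheory GRing.Theory Num.Theory.

Local Open Scope classical_set_scope.
Local Open Scope card_scope.
Local Open Scope ring_scope.

(** * The complex projective line *)

(* The field of complex numbers is [R[i]] for [R : realType]; the projective
   line is [R[i]] with a point at infinity [None]. *)
Definition P1 (R : realType) := option R[i].

(* Representatives: [z : 1] for finite z, and [1 : 0] for infinity. *)
Definition hcoord (R : realType) (p : P1 R) : 'cV[R[i]]_2 :=
  \col_(k < 2) (if p is Some z then (if k == 0 then z else 1)
                else (if k == 0 then 1 else 0)).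

Definition of_hcoord (R : realType) (x : 'cV[R[i]]_2) : P1 R :=
  if x 1 0 == 0 then None else Some (x 0 0 / x 1 0).

Definition mobius (R : realType) (A : 'M[R[i]]_2) (p : P1 R) : P1 R :=
  of_hcoord (A *m hcoord p).

(* [bracket p q] is p - q when p and q are finite. *)
Definition bracket (R : realType) (p q : P1 R) : R[i] :=
  hcoord p 0 0 * hcoord q 1 0 - hcoord p 1 0 * hcoord q 0 0.

(* Homogeneous form of (z3 - z1)(z4 - z2) / ((z3 - z2)(z4 - z1)); meaningful
   for distinct points, one of which may be infinity. *)
Definition cross_ratio (R : realType) (z1 z2 z3 z4 : P1 R) : R[i] :=
  (bracket z3 z1 * bracket z4 z2) / (bracket z3 z2 * bracket z4 z1).

Lemma hcoord_mobius (R : realType) (A : 'M[R[i]]_2) (p : P1 R) :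
  A \in unitmx -> exists2 k, k != 0 & A *m hcoord p = k *: hcoord (mobius A p).
Proof.
move=> uA; rewrite /mobius; set x := A *m hcoord p.
have x0 : x != 0.
  apply/eqP => /(congr1 (mulmx (invmx A))); rewrite mulKmx // mulmx0.
  move/matrixP; case: (p) => [z|] h.
    by have := h 1 0; rewrite !mxE /= => /eqP; rewrite oner_eq0.
  by have := h 0 0; rewrite !mxE /= => /eqP; rewrite oner_eq0.
have ord2 (P : 'I_2 -> Prop) : P 0 -> P 1 -> forall i, P i.
  move=> P0 P1 [[|[]]] // lti; [move: P0 | move: P1].
    by congr P; apply: val_inj.
  by congr P; apply: val_inj.
clearbody x; rewrite /of_hcoord.
have [x1|x1] := eqVneq (x 1 0) 0.
  exists (x 0 0).
    apply: contra x0 => /eqP x00; apply/eqP/matrixP => i j.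
    by rewrite !ord1 mxE; elim/ord2: i.
  apply/matrixP => i j; rewrite !ord1 !mxE; elim/ord2: i => /=.
    by rewrite mulr1.
  by rewrite x1 mulr0.
exists (x 1 0) => //; apply/matrixP => i j; rewrite !ord1 !mxE.
by elim/ord2: i => /=; rewrite ?mulr1 // mulrC divfK.
Qed.

Lemma bracket_mobius (R : realType) (A : 'M[R[i]]_2) (p q : P1 R) k l :
  A *m hcoord p = k *: hcoord (mobius A p) ->
  A *m hcoord q = l *: hcoord (mobius A q) ->
  k * l * bracket (mobius A p) (mobius A q) = \det A * bracket p q.
Proof.
move=> hp hq; rewrite /bracket.
have e (B : 'cV[R[i]]_2) u i : (u *: B) i 0 = u * B i 0 by rewrite mxE.
transitivity ((A *m hcoord p) 0 0 * (A *m hcoord q) 1 0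
   - (A *m hcoord p) 1 0 * (A *m hcoord q) 0 0).
  by rewrite hp hq !e; ring.
have -> : \det A = A 0 0 * A 1 1 - A 0 1 * A 1 0.
  by rewrite (expand_det_row _ 0) !big_ord_recl big_ord0 /cofactor !det_mx11 !mxE /=
    expr0 expr1 addr0 mul1r mulN1r mulrN; congr (_ * A _ _ - A _ _ * A _ _); apply: val_inj.
rewrite ![(A *m _) _ _]mxE !big_ord_recl !big_ord0.
have -> : lift ord0 ord0 = 1 :> 'I_2 by apply: val_inj.
ring.
Qed.

Lemma cross_ratio_mobius (R : realType) (A : 'M[R[i]]_2) (z1 z2 z3 z4 : P1 R) :
  A \in unitmx ->
  cross_ratio (mobius A z1) (mobius A z2) (mobius A z3) (mobius A z4)
  = cross_ratio z1 z2 z3 z4.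
Proof.
move=> uA; have [k1 n1 e1] := hcoord_mobius z1 uA.
have [k2 n2 e2] := hcoord_mobius z2 uA.
have [k3 n3 e3] := hcoord_mobius z3 uA.
have [k4 n4 e4] := hcoord_mobius z4 uA.
have d0 : \det A != 0 by rewrite -unitfE -unitmxE.
have E p q k l : k != 0 -> l != 0 -> A *m hcoord p = k *: hcoord (mobius A p) ->
    A *m hcoord q = l *: hcoord (mobius A q) ->
    bracket (mobius A p) (mobius A q) = k^-1 * l^-1 * \det A * bracket p q.
  move=> k0 l0 ep eq; rewrite -mulrA -(bracket_mobius ep eq).
  by rewrite -invfM mulKf // mulf_neq0.
rewrite /cross_ratio (E _ _ _ _ n3 n1) // (E _ _ _ _ n4 n2) //.
rewrite (E _ _ _ _ n3 n2) // (E _ _ _ _ n4 n1) //.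
set K := k1^-1 * k2^-1 * k3^-1 * k4^-1 * \det A * \det A.
have K0 : K != 0 by rewrite !mulf_neq0 // invr_eq0.
have -> : forall a b, k3^-1 * k1^-1 * \det A * a * (k4^-1 * k2^-1 * \det A * b)
  = K * (a * b) by move=> a b; rewrite /K; ring.
have -> : forall a b, k3^-1 * k2^-1 * \det A * a * (k4^-1 * k1^-1 * \det A * b)
  = K * (a * b) by move=> a b; rewrite /K; ring.
by rewrite -mulf_div divff // mul1r.
Qed.

(** * Zariski topology *)

Definition affine_closed (R : realType) (J : finType) (A : set (J -> R[i])) :
    Prop :=
  exists s : seq {mpoly R[i][#|J|]},
    A = [set c | forall f, f \in s -> f.@[fun i => c (enum_val i)] = 0].

Definition affine_open (R : realType) (J : finType) (A : set (J -> R[i])) :=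
  affine_closed (~` A).

(* Polynomials on the product of the projective lines indexed by [J]: there are
   two homogeneous coordinates [hvar j 0], [hvar j 1] for each [j : J]. *)
Definition hpoly (R : realType) (J : finType) :=
  {mpoly R[i][#|{: J * 'I_2}|]}.

Definition hvar (J : finType) (j : J) (k : 'I_2) : 'I_#|{: J * 'I_2}| :=
  enum_rank (j, k).

Definition multihomogeneous (R : realType) (J : finType) (f : hpoly R J) :
    Prop :=
  exists d : J -> nat, forall m, m \in msupp f ->
    forall j, (m (hvar j 0%R) + m (hvar j 1%R) = d j)%N.

Definition heval (R : realType) (J : finType) (p : J -> P1 R) (f : hpoly R J) :
    R[i] :=
  f.@[fun i => hcoord (p (enum_val i).1) (enum_val i).2 0].

(* Finitely many equations suffice by Hilbert's basis theorem. *)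
Definition zclosed (R : realType) (J : finType) (A : set (J -> P1 R)) : Prop :=
  exists2 s : seq (hpoly R J),
    (forall f, f \in s -> multihomogeneous f) &
    A = [set p | forall f, f \in s -> heval p f = 0].

Definition zopen (R : realType) (J : finType) (A : set (J -> P1 R)) :=
  zclosed (~` A).

Definition for_general (R : realType) (J : finType)
    (Q : (J -> P1 R) -> Prop) : Prop :=
  exists U : set (J -> P1 R), [/\ zopen U, U !=set0 & forall p, U p -> Q p].

Definition zirreducible (R : realType) (J : finType) (A : set (J -> P1 R)) :
    Prop :=
  A !=set0 /\ forall B D, zclosed B -> zclosed D ->
    A `<=` B `|` D -> A `<=` B \/ A `<=` D.

(* Intended for Zariski closed [A], so that subsets of [A] that are closed in
   [A] are closed. *)
Definition zconnected (R : realType) (J : finType) (A : set (J -> P1 R)) :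
    Prop :=
  A !=set0 /\ forall B D, zclosed B -> zclosed D ->
    A = B `|` D -> B `&` D = set0 -> B = set0 \/ D = set0.

Definition chain_in (R : realType) (J : finType) (A : set (J -> P1 R))
    (k : nat) : Prop :=
  exists F : nat -> set (J -> P1 R),
    (forall i, (i <= k)%N ->
       [/\ zclosed (F i), zirreducible (F i) & F i `<=` A]) /\
    (forall i, (i < k)%N -> F i `<` F i.+1).

Definition krull_dim (R : realType) (J : finType) (A : set (J -> P1 R))
    (k : nat) : Prop :=
  chain_in A k /\ ~ chain_in A k.+1.

(** * Tangent spaces *)

Definition vanishing (R : realType) (J : finType) (A : set (J -> P1 R)) :
    set (hpoly R J) :=
  [set f | multihomogeneous f /\ forall p, A p -> heval p f = 0].

(* The homogeneous coordinate that serves as affine coordinate around [p], the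
   other one being set to 1: z around a finite point, 1/z around infinity. *)
Definition chart (R : realType) (p : P1 R) : 'I_2 :=
  if p is Some _ then 0 else 1.

(* Tangent vectors at [p] are expressed in the affine chart given by [chart],
   and are killed by the differentials of the dehomogenized equations. *)
Definition tangent_space (R : realType) (J : finType) (A : set (J -> P1 R))
    (p : J -> P1 R) : set {ffun J -> R[i]^o} :=
  [set v | forall f, vanishing A f ->
     \sum_(j : J) heval p (mderiv (hvar j (chart (p j))) f) * v j = 0].

Definition smooth_of_dim (R : realType) (J : finType) (A : set (J -> P1 R))
    (k : nat) : Prop :=
  forall p, A p -> exists2 V : {vspace {ffun J -> R[i]^o}},
    tangent_space A p = [set v | v \in V] & \dim V = k.

(** * Curves of multidegree (1, ..., 1) *)

Definition projection_degree (R : realType) (S : finType)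
    (C : set (S -> P1 R)) (s : S) (d : nat) : Prop :=
  for_general (fun a : unit -> P1 R =>
    [set p | C p /\ p s = a tt] #= `I_d).

Definition curves (R : realType) (S : finType) : set (set (S -> P1 R)) :=
  [set C | [/\ zclosed C, zconnected C, krull_dim C 1, smooth_of_dim C 1 &
               forall s, projection_degree C s 1]].

Definition linear_subvariety (R : realType) (S : finType) (S' : {set S})
    (P : {s : S | s \in S'} -> P1 R) : set (S -> P1 R) :=
  [set q | forall s : {s : S | s \in S'}, q (val s) = P s].

Definition incidence (R : realType) (S : finType) (S' : {set S})
    (P : {s : S | s \in S'} -> P1 R) : set (set (S -> P1 R)) :=
  [set C | curves C /\ C `&` linear_subvariety P !=set0].

(** * Hypergraphs and cross-ratio degrees *)

Record hypergraph4 (V E : finType) := Hypergraph4 {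
  hedge :> E -> {set V};
  card_hedge : forall e, #|hedge e| = 4%N }.

Definition edges_at (V E : finType) (T : hypergraph4 V E) (v : V) : {set E} :=
  [set e | v \in T e].

(* The index set of the factors of the product of the spaces in which the
   points P_v live. *)
Definition incidences (V E : finType) (T : hypergraph4 V E) :=
  {v : V & {e : E | e \in edges_at T v}}.

Definition edge_ordering (V E : finType) (T : hypergraph4 V E)
    (o : E -> 4.-tuple V) : Prop :=
  forall e, [set:: o e]%SET = T e.

Definition mobius_class (R : realType) (V : finType) (z : V -> P1 R) :
    set (V -> P1 R) :=
  [set w | exists2 A : 'M[R[i]]_2, A \in unitmx & w = mobius A \o z].

Definition M0 (R : realType) (V : finType) : set (set (V -> P1 R)) :=
  [set mobius_class z | z in [set z : V -> P1 R | injective z]].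

Definition CR_map (R : realType) (V E : finType) (o : E -> 4.-tuple V)
    (z : V -> P1 R) : E -> R[i] :=
  fun e => cross_ratio (z (tnth (o e) (inord 0))) (z (tnth (o e) (inord 1)))
                       (z (tnth (o e) (inord 2))) (z (tnth (o e) (inord 3))).

(* The fiber over [c] of the map induced on [M0] by [CR_map]; it does not matter
   which representative [z] of [x] is used, by [cross_ratio_mobius]. *)
Definition CR_fiber (R : realType) (V E : finType) (o : E -> 4.-tuple V)
    (c : E -> R[i]) : set (set (V -> P1 R)) :=
  [set x | M0 x /\ exists2 z, x z & CR_map o z = c].

(* The number of points of the fiber over a general point of the target; a
   map that is not dominant has empty general fiber, hence degree 0. The value
   does not depend on the choice made by [xget], since nonempty open subsets of
   the target meet. *)
Definition cr_degree (R : realType) (V E : finType) (o : E -> 4.-tuple V) :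
    nat :=
  xget 0%N [set d | exists U : set (E -> R[i]),
    [/\ affine_open U,
        U `<=` [set c | forall e, c e != 0 /\ c e != 1],
        U !=set0 &
        forall c, U c -> CR_fiber o c #= `I_d]].

(* Main.v *)
Require Import Defs.
From mathcomp Require Import all_boot all_order all_algebra closed_field.
From mathcomp Require Import boolp classical_sets functions cardinality reals.
From mathcomp Require Import complex mpoly ring.

(** Both sides count the same configurations of points, up to Moebius
transformations.  A smooth connected curve of multidegree (1, ..., 1) is the
image of a map t |-> (A_e t)_e with every A_e a Moebius transformation
([curvesP]).  It meets Y_v exactly when some parameter z_v satisfies
A_e z_v = P_(v, e) for all edges e at v.  Cross-ratios being invariant, the
cross-ratio of z along each edge e is then that of the four points P_(v, e),
v in e; conversely, a configuration z of distinct points with these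
cross-ratios determines each A_e, hence the curve.  So curves through all the
Y_v correspond to points of the fibre of the cross-ratio map over the
cross-ratios of P ([card_incident_curves], [card_CR_fiber]), and for general P
these cross-ratios are general ([pullback_neq0], [target_cr_realize]).

Three points need an argument.

The parameters z_v of a curve must be distinct for this correspondence, and
isolated vertices must be excluded.  A configuration in which two points
coincide has at most |E| - 1 moduli; its |E| cross-ratios, rational functions
of these moduli, are algebraically dependent ([dependence]), so that general
cross-ratios are never reached ([generic_no_degenerate]).  An isolated vertex
could be moved onto another one without changing any cross-ratio
([no_isolated]).

The degree of the cross-ratio map must exist.  Each coordinate of a normalized
configuration is algebraically dependent on the |E| cross-ratios, which bounds
the general fibre ([nfiber_bounded]).  For each k, having at least k points in
the fibre is a first-order condition on the base point; by quantifier
elimination it is generically true or generically false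
([definable_generic]), and the largest k for which it is generically true is
the degree ([generic_card_nfiber]).

Curves must be shown to be parametrized.  As a curve C has one point above a
general value of each coordinate, the other coordinates are definable functions
of any given one, hence rational functions ([definable_rational]); each of them
is constant or generically injective, and in the second case a Moebius
transformation ([coprime_injective_degree]).  So C is a union of finitely many
parametrized rational curves and finitely many points.  Two components moving
different coordinates cannot cross, as their tangent vectors at a common point
would be independent ([no_crossing]); by connectedness there is only one
component, and it moves every coordinate ([curve_is_mcurve]). *)

Set Implicit Arguments.
Unset Strict Implicit.
Unset Printing Implicit Defensive.

Import Order.TTheory GRing.Theory Num.Theory.
Local Open Scope ring_scope.

(** * Polynomials, substitution and specialization *)

(** Identities between ring morphisms out of a polynomial ring need only be
    checked on constants and variables. *)
Lemma mpoly_ring_ind (n : nat) (A : comNzRingType) (P : {mpoly A[n]} -> Prop) :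
  (forall c, P c%:MP) -> (forall i, P 'X_i) ->
  (forall p q, P p -> P q -> P (p + q)) ->
  (forall p q, P p -> P q -> P (p * q)) -> forall p, P p.
Proof.
move=> PC PX PD PM p; elim/mpolyind: p => [|c m p _ _ Pp]; first by rewrite -mpolyC0.
apply: (PD) => //; rewrite -mul_mpolyC; apply: (PM) => //.
rewrite mpolyXE_id; apply: (big_ind P) => [||i _]; [by rewrite -mpolyC1 | exact: PM |].
elim: (m i) => [|k IH]; first by rewrite expr0 -mpolyC1.
by rewrite exprS; apply: PM.
Qed.

(** A numeric field contains the natural numbers, more points than a nonzero
    polynomial has roots. *)
Lemma poly_nonroot (F : numFieldType) (p : {poly F}) :
  p != 0 -> exists x, p.[x] != 0.
Proof.
move=> p0; apply: contrapT => h.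
have rt (x : F) : root p x.
  by apply/negPn/negP => hx; apply: h; exists x.
have := @max_poly_roots _ p [seq i%:R | i <- iota 0 (size p)] p0.
rewrite size_map size_iota ltnn => H; suff: false by []; apply: H.
  by apply/allP => x _; apply: rt.
by rewrite map_inj_uniq ?iota_uniq // => i j /eqP; rewrite eqr_nat => /eqP.
Qed.

Lemma poly_eq0 (F : numFieldType) (p : {poly F}) :
  (forall x, p.[x] = 0) -> p = 0.
Proof.
move=> h; apply/eqP/negPn/negP => /poly_nonroot[x].
by rewrite h eqxx.
Qed.

Definition path_subst (F : fieldType) (n : nat) (L : 'I_n -> {poly F})
    (p : {mpoly F[n]}) : {poly F} := mmap (@polyC F) L p.

Lemma path_substM (F : fieldType) (n : nat) (L : 'I_n -> {poly F}) p q :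
  path_subst L (p * q) = path_subst L p * path_subst L q.
Proof. by rewrite /path_subst rmorphM. Qed.

Lemma path_substD (F : fieldType) (n : nat) (L : 'I_n -> {poly F}) p q :
  path_subst L (p + q) = path_subst L p + path_subst L q.
Proof. by rewrite /path_subst rmorphD. Qed.

Lemma path_substC (F : fieldType) (n : nat) (L : 'I_n -> {poly F}) c :
  path_subst L c%:MP = c%:P.
Proof. by rewrite /path_subst mmapC. Qed.

Lemma path_substX (F : fieldType) (n : nat) (L : 'I_n -> {poly F}) i :
  path_subst L 'X_i = L i.
Proof. by rewrite /path_subst mmapX mmap1U. Qed.

Lemma horner_path_subst (F : fieldType) (n : nat) (L : 'I_n -> {poly F}) p x :
  (path_subst L p).[x] = p.@[fun i => (L i).[x]].
Proof.
elim/mpoly_ring_ind: p => [c|i|p q hp hq|p q hp hq].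
- by rewrite path_substC hornerC mevalC.
- by rewrite path_substX mevalXU.
- by rewrite path_substD hornerD mevalD hp hq.
- by rewrite path_substM hornerM mevalM hp hq.
Qed.

(** Chain rule: it turns the equations of a variety into linear conditions on
    the velocity of a path drawn on it. *)
Lemma deriv_path_subst (F : fieldType) (n : nat) (L : 'I_n -> {poly F}) p :
  (path_subst L p)^`() = \sum_i path_subst L (mderiv i p) * (L i)^`().
Proof.
elim/mpoly_ring_ind: p => [c|i|p q hp hq|p q hp hq].
- rewrite path_substC derivC big1 // => i _.
  by rewrite mderivC -mpolyC0 path_substC mul0r.
- rewrite path_substX (bigD1 i) //= big1 ?addr0.
    rewrite mderivX mnm1E eqxx scale1r -[X in (X - _)%MM]add0m addmK mpolyX0.
    by rewrite -mpolyC1 path_substC mul1r.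
  move=> j /negPf ji.
  by rewrite mderivX mnm1E eq_sym ji scale0r -mpolyC0 path_substC mul0r.
- rewrite path_substD derivD hp hq -big_split /=; apply: eq_bigr => i _.
  by rewrite mderivD path_substD mulrDl.
- rewrite path_substM derivM hp hq mulr_sumr mulr_suml -big_split /=.
  apply: eq_bigr => i _; rewrite mderivM path_substD !path_substM; ring.
Qed.

Definition snoc (T : Type) (n : nat) (c : 'I_n -> T) (x : T) (i : 'I_n.+1) : T :=
  oapp c x (unlift ord_max i).

Definition last_var (F : fieldType) (n : nat) (p : {mpoly F[n.+1]}) :
    {poly {mpoly F[n]}} :=
  mmap (@polyC _ \o @mpolyC n F)
    (fun i => oapp (fun j => ('X_j)%:P) 'X (unlift ord_max i)) p.

Lemma last_varD (F : fieldType) (n : nat) :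
  {morph @last_var F n : p q / p + q}.
Proof. exact: rmorphD. Qed.

Lemma last_varM (F : fieldType) (n : nat) :
  {morph @last_var F n : p q / p * q}.
Proof. exact: rmorphM. Qed.

(** The isomorphism has an inverse, evaluation at the last variable. *)
Lemma last_var_neq0 (F : fieldType) (n : nat) (p : {mpoly F[n.+1]}) :
  p != 0 -> last_var p != 0.
Proof.
apply: contra_neq => h.
pose back (q : {poly {mpoly F[n]}}) : {mpoly F[n.+1]} :=
  (map_poly (mmap (@mpolyC n.+1 F) (fun j => 'X_(lift ord_max j))) q).['X_ord_max].
suff eqb : back (last_var p) = p by rewrite -eqb h /back rmorph0 horner0.
elim/mpoly_ring_ind: p {h} => [c|i|p q hp hq|p q hp hq].
- by rewrite /last_var mmapC /= /back map_polyC hornerC /= mmapC.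
- rewrite /last_var mmapX mmap1U /back; case: unliftP => [j ->|->] /=.
    by rewrite map_polyC hornerC /= mmapX mmap1U.
  by rewrite map_polyX hornerX.
- by rewrite last_varD /back rmorphD hornerD; congr (_ + _).
- by rewrite last_varM /back rmorphM hornerM; congr (_ * _).
Qed.

Lemma horner_last_var (F : fieldType) (n : nat) (p : {mpoly F[n.+1]}) c x :
  (map_poly (meval c) (last_var p)).[x] = p.@[snoc c x].
Proof.
elim/mpoly_ring_ind: p => [a|i|p q hp hq|p q hp hq].
- by rewrite /last_var mmapC /= map_polyC hornerC /= !mevalC.
- rewrite /last_var mmapX mmap1U mevalXU /snoc.
  case: unliftP => [j _|_] /=; first by rewrite map_polyC hornerC /= mevalXU.
  by rewrite map_polyX hornerX.
- by rewrite last_varD (rmorphD (map_poly (meval c))) hornerD mevalD; congr (_ + _).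
- by rewrite last_varM (rmorphM (map_poly (meval c))) hornerM mevalM; congr (_ * _).
Qed.

(** Where the leading coefficient in the last variable does not vanish, the
    other variables can be specialized without killing the polynomial or
    changing its degree. *)
Lemma specialize_last (F : fieldType) (n : nat) (p : {mpoly F[n.+1]}) :
  p != 0 -> exists g : {mpoly F[n]}, exists2 B : nat, g != 0 &
    forall c, g.@[c] != 0 -> exists q : {poly F},
      [/\ q != 0, (size q <= B)%N & forall x, p.@[snoc c x] = q.[x]].
Proof.
move=> /last_var_neq0 p0; exists (lead_coef (last_var p)), (size (last_var p)).
  by rewrite lead_coef_eq0.
move=> c gc; exists (map_poly (meval c) (last_var p)); split.
- by rewrite -lead_coef_eq0 lead_coef_map_eq.
- by rewrite size_map_poly_id0.
- by move=> x; rewrite horner_last_var.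
Qed.

Lemma mpoly_nonroot (F : numFieldType) (n : nat) (p : {mpoly F[n]}) :
  p != 0 -> exists c, p.@[c] != 0.
Proof.
elim: n p => [|n IH] p p0.
  exists (fun _ => 0); move: p0; rewrite (nvar0_mpolyC p) mevalC.
  by apply: contra_neq => ->; rewrite mpolyC0.
have [g [B g0 gP]] := specialize_last p0.
have [c /gP[q [q0 _ qP]]] := IH _ g0.
by have [x qx] := poly_nonroot q0; exists (snoc c x); rewrite qP.
Qed.

(** The cofactor of X - r can only vanish at r, which simplicity of r forbids;
    over a closed field it is therefore constant. *)
Lemma size_unique_simple_root (F : closedFieldType) (p : {poly F}) r :
  root p r -> (forall y, root p y -> y = r) -> p^`().[r] != 0 -> size p = 2%N.
Proof.
move=> /factor_theorem[q ->] uniq_r dr.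
have dE : (q * ('X - r%:P))^`().[r] = q.[r].
  by rewrite derivM derivXsubC hornerD !hornerM hornerXsubC subrr mulr0 add0r hornerC mulr1.
rewrite dE in dr; have q0 : q != 0 by apply: contraNneq dr => ->; rewrite horner0.
have : size q = 1%N.
  apply/eqP/negPn/negP => /closed_rootP[y qy].
  have /uniq_r yr : root (q * ('X - r%:P)) y by rewrite rootM qy.
  by move: dr; rewrite -yr (rootP qy) eqxx.
by rewrite size_mul ?polyXsubC_eq0 // size_XsubC => ->.
Qed.

(** * Algebraic dependence of rational functions *)

Lemma msizeM_leq (F : fieldType) (n : nat) (p q : {mpoly F[n]}) d e :
  (msize p <= d.+1)%N -> (msize q <= e.+1)%N -> (msize (p * q) <= (d + e).+1)%N.
Proof.
move=> hp hq; have [->|p0] := eqVneq p 0; first by rewrite mul0r msize0.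
have [->|q0] := eqVneq q 0; first by rewrite mulr0 msize0.
rewrite msizeM // -subn1 leq_subLR add1n -addSn; apply: leq_trans (leq_add hp hq) _.
by rewrite addSn addnS.
Qed.

Lemma msizeX_leq (F : fieldType) (n : nat) (p : {mpoly F[n]}) d k :
  (msize p <= d.+1)%N -> (msize (p ^+ k) <= (k * d).+1)%N.
Proof.
move=> hp; elim: k => [|k IH]; first by rewrite expr0 msize1.
by rewrite exprS mulSn msizeM_leq.
Qed.

Lemma msize_prod_leq (F : fieldType) (n : nat) (I : finType)
    (p : I -> {mpoly F[n]}) d :
  (forall i, msize (p i) <= d.+1)%N -> (msize (\prod_i p i) <= (#|I| * d).+1)%N.
Proof.
move=> hp; rewrite cardE -big_enum /=.
elim: (enum I) => [|i s IH] /=; first by rewrite big_nil msize1.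
by rewrite big_cons mulSn msizeM_leq.
Qed.

(** The monomial of exponents k in the fractions N j / D j, multiplied by the
    power K of all the denominators. *)
Definition clear_den (A : comNzRingType) (b K : nat) (N D : 'I_b -> A)
    (k : 'I_b -> nat) : A :=
  \prod_j (N j ^+ k j * D j ^+ (K - k j)).

Lemma box_card (a b d : nat) : (a < b)%N ->
  exists K, ((b * (K * d)).+1 ^ a < K ^ b)%N.
Proof.
move=> ab.
(* K exceeds (b d + 1)^a, while the left-hand side is at most ((b d + 1) K)^a. *)
exists (((b * d).+1 ^ a).+1)%N; set K := (((b * d).+1 ^ a).+1)%N.
apply: (@leq_trans (K ^ a.+1)%N); last by rewrite leq_pexp2l.
rewrite expnS; apply: (@leq_ltn_trans ((b * d).+1 ^ a * K ^ a)%N).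
  rewrite -expnMn; have [->|a0] := posnP a; first by rewrite !expn0.
  by rewrite leq_exp2r // (mulnC K) mulnA mulSn -add1n leq_add.
by rewrite ltn_pmul2r // expn_gt0.
Qed.

(** More than a rational functions of a variables are algebraically dependent.
    Multiplied by a common denominator, the K ^ b monomials of exponents less
    than K become polynomials in a variables whose degree is linear in K.  The
    space of these has dimension O(K ^ a), so that for K large some nontrivial
    combination of the monomials vanishes. *)
Lemma dependence (F : fieldType) (a b : nat) (N D : 'I_b -> {mpoly F[a]}) :
  (a < b)%N -> exists2 H : {mpoly F[b]}, H != 0 &
    forall x, (forall j, (D j).@[x] != 0) ->
      H.@[fun j => (N j).@[x] / (D j).@[x]] = 0.
Proof.
move=> ab.
pose d := \max_j maxn (msize (N j)) (msize (D j)).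
have [K hK] := box_card (d + d) ab; pose B := (b * (K * (d + d))).+1.
have dle j : (maxn (msize (N j)) (msize (D j)) <= d)%N by exact: leq_bigmax.
pose rows := {ffun 'I_b -> 'I_K}; pose cols := {ffun 'I_a -> 'I_B}.
pose t (r : rows) : {mpoly F[a]} := clear_den K N D (fun j => r j : nat).
pose box (c : cols) := [multinom (c k : nat) | k < a].
pose A : 'M[F]_(#|rows|, #|cols|) :=
  \matrix_(i, j) (t (enum_val i))@_(box (enum_val j)).
have : kermx A != 0.
  rewrite kermx_eq0 /row_free neq_ltn; apply/orP; left.
  apply: leq_ltn_trans (rank_leq_col _) _.
  by rewrite !card_ffun !card_ord.
case/rowV0Pn => u /sub_kermxP uA u0.
pose mon (r : rows) := [multinom (r j : nat) | j < b].
have mon_inj : injective mon.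
  move=> r s /mnmP e; apply/ffunP => j; apply: val_inj.
  by have := e j; rewrite !mnmE.
exists (\sum_i u 0 i *: 'X_[mon (enum_val i)]).
  apply: contra u0 => /eqP/mpolyP h; apply/eqP/rowP => i; rewrite mxE.
  have := h (mon (enum_val i)); rewrite mcoeff0 raddf_sum (bigD1 i) //= big1.
    by rewrite mcoeffZ mcoeffX eqxx mulr1 addr0.
  move=> j ji; rewrite mcoeffZ mcoeffX (inj_eq mon_inj) (inj_eq enum_val_inj).
  by rewrite (negPf ji) mulr0.
(* Monomials outside the box cannot occur, for degree reasons. *)
have T0 : \sum_i u 0 i *: t (enum_val i) = 0.
  apply/mpolyP => m; rewrite mcoeff0 raddf_sum /=.
  have [mB|mB] := ltnP (mdeg m) B.
    have mk k : (m k < B)%N.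
      by apply: leq_ltn_trans mB; rewrite mdegE (bigD1 k) //= leq_addr.
    pose c : cols := [ffun k => Ordinal (mk k)].
    move/rowP/(_ (enum_rank c)): uA; rewrite !mxE => {2}<-.
    apply: eq_bigr => i _; rewrite mcoeffZ !mxE enum_rankK; congr (_ * _@__).
    by apply/mnmP => k; rewrite mnmE ffunE.
  rewrite big1 // => i _; rewrite mcoeffZ memN_msupp_eq0 ?mulr0 //.
  apply: msize_mdeg_ge; apply: leq_trans mB; rewrite /t /clear_den.
  rewrite -[X in (_ <= (X * _).+1)%N](card_ord b); apply: msize_prod_leq => j.
  rewrite mulnDr; apply: msizeM_leq.
    apply: leq_trans (msizeX_leq _ (leqW (leq_trans (leq_maxl _ _) (dle j)))) _.
    by rewrite ltnS leq_mul2r ltnW ?orbT.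
  apply: leq_trans (msizeX_leq _ (leqW (leq_trans (leq_maxr _ _) (dle j)))) _.
  by rewrite ltnS leq_mul2r leq_subr orbT.
move=> x Dx; rewrite raddf_sum /=.
have P0 : \prod_j (D j).@[x] ^+ K != 0.
  by apply/prodf_neq0 => j _; rewrite expf_neq0.
apply: (mulIf P0); rewrite mul0r mulr_suml -[RHS](meval0 x) -T0 raddf_sum /=.
apply: eq_bigr => i _; rewrite !mevalZ -mulrA; congr (_ * _).
rewrite mevalX rmorph_prod -big_split /=; apply: eq_bigr => j _.
rewrite mevalM !rmorphXn /= mnmE expr_div_n -mulrA; congr (_ * _).
have kK := ltnW (ltn_ord (enum_val i j)).
by apply: (canLR (mulKf _)); rewrite ?expf_neq0 // -exprD subnKC.
Qed.

(** * Definable sets over an algebraically closed field *)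

(** Valuations are functions on all natural numbers, but only those of finite
    support occur: they are presented by the sequences of values that terms
    and formulas are evaluated at. *)
Definition polyfun (F : fieldType) (t : (nat -> F) -> F) : Prop :=
  exists2 T : GRing.term F, GRing.rterm T &
    forall e : seq F, t (nth 0 e) = GRing.eval e T.

Definition definable (F : fieldType) (P : (nat -> F) -> Prop) : Prop :=
  exists2 f : GRing.formula F, GRing.rformula f &
    forall e : seq F, P (nth 0 e) <-> GRing.holds e f.

Section Polyfun.
Variable F : fieldType.
Implicit Types t u : (nat -> F) -> F.

Lemma polyfun_const c : polyfun (fun _ : nat -> F => c).
Proof. by exists (GRing.Const c). Qed.

Lemma polyfun_var i : polyfun (fun v : nat -> F => v i).
Proof. by exists (GRing.Var F i). Qed.

Lemma polyfun_add t u : polyfun t -> polyfun u -> polyfun (fun v => t v + u v).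
Proof.
case=> T rT hT [U rU hU]; exists (GRing.Add T U) => /=; first by rewrite rT.
by move=> e; rewrite hT hU.
Qed.

Lemma polyfun_opp t : polyfun t -> polyfun (fun v => - t v).
Proof. by case=> T rT hT; exists (GRing.Opp T) => //= e; rewrite hT. Qed.

Lemma polyfun_sub t u : polyfun t -> polyfun u -> polyfun (fun v => t v - u v).
Proof. by move=> ht hu; apply: polyfun_add => //; apply: polyfun_opp. Qed.

Lemma polyfun_mul t u : polyfun t -> polyfun u -> polyfun (fun v => t v * u v).
Proof.
case=> T rT hT [U rU hU]; exists (GRing.Mul T U) => /=; first by rewrite rT.
by move=> e; rewrite hT hU.
Qed.

Lemma polyfun_exp t k : polyfun t -> polyfun (fun v => t v ^+ k).
Proof. by case=> T rT hT; exists (GRing.Exp T k) => //= e; rewrite hT. Qed.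

Lemma polyfun_sum (I : Type) (s : seq I) (t : I -> (nat -> F) -> F) :
  (forall i, polyfun (t i)) -> polyfun (fun v => \sum_(i <- s) t i v).
Proof.
move=> ht; elim: s => [|i s IH].
  by under [fun _ => _]funext => v do rewrite big_nil; apply: polyfun_const.
by under [fun _ => _]funext => v do rewrite big_cons; apply: polyfun_add.
Qed.

Lemma polyfun_prod (I : Type) (s : seq I) (t : I -> (nat -> F) -> F) :
  (forall i, polyfun (t i)) -> polyfun (fun v => \prod_(i <- s) t i v).
Proof.
move=> ht; elim: s => [|i s IH].
  by under [fun _ => _]funext => v do rewrite big_nil; apply: polyfun_const.
by under [fun _ => _]funext => v do rewrite big_cons; apply: polyfun_mul.
Qed.

Lemma polyfun_meval (n : nat) (p : {mpoly F[n]}) (t : 'I_n -> (nat -> F) -> F) :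
  (forall i, polyfun (t i)) -> polyfun (fun v => p.@[fun i => t i v]).
Proof.
move=> ht; under [fun _ => _]funext => v do rewrite mevalE.
apply: polyfun_sum => m; apply: polyfun_mul; first exact: polyfun_const.
by apply: polyfun_prod => i; apply: polyfun_exp.
Qed.

Lemma polyfun_horner (p : {poly F}) t : polyfun t -> polyfun (fun v => p.[t v]).
Proof.
move=> ht; under [fun _ => _]funext => v do rewrite horner_coef.
by apply: polyfun_sum => m; apply: polyfun_mul; [exact: polyfun_const | exact: polyfun_exp].
Qed.

Lemma polyfun_horner2 (p : {poly {poly F}}) t u :
  polyfun t -> polyfun u -> polyfun (fun v => p.[(u v)%:P].[t v]).
Proof.
move=> ht hu; under [fun _ => _]funext => v do
  rewrite (horner_coef p) horner_sum.
apply: polyfun_sum => m; under [fun _ => _]funext => v do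
  rewrite hornerM horner_exp hornerC.
by apply: polyfun_mul; [exact: polyfun_horner | exact: polyfun_exp].
Qed.

End Polyfun.

Section Definable.
Variable F : fieldType.
Implicit Types P Q : (nat -> F) -> Prop.

Lemma definable_eq t u : polyfun t -> polyfun u -> definable (fun v : nat -> F => t v = u v).
Proof.
case=> T rT hT [U rU hU]; exists (GRing.Equal T U) => /=; first by rewrite rT.
by move=> e; rewrite hT hU.
Qed.

Lemma definable_iff P Q : (forall v, P v <-> Q v) -> definable P -> definable Q.
Proof.
move=> PQ [f rf hf]; exists f => // e; rewrite -hf; split; by move/PQ.
Qed.

Lemma definable_const (p : Prop) : definable (fun _ : nat -> F => p).
Proof.
exists (GRing.Bool (`[< p >])) => //= e.
by split => [/asboolP|/asboolP].
Qed.

Lemma definable_not P : definable P -> definable (fun v => ~ P v).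
Proof.
by case=> f rf hf; exists (GRing.Not f) => //= e; have := hf e; tauto.
Qed.

Lemma definable_and P Q : definable P -> definable Q -> definable (fun v => P v /\ Q v).
Proof.
case=> f rf hf [g rg hg]; exists (GRing.And f g) => /=; first by rewrite rf.
by move=> e; have := hf e; have := hg e; tauto.
Qed.

Lemma definable_imp P Q : definable P -> definable Q -> definable (fun v => P v -> Q v).
Proof.
case=> f rf hf [g rg hg]; exists (GRing.Implies f g) => /=; first by rewrite rf.
by move=> e; have := hf e; have := hg e; tauto.
Qed.

Lemma definable_all (I : finType) (P : I -> (nat -> F) -> Prop) :
  (forall i, definable (P i)) -> definable (fun v => forall i, P i v).
Proof.
move=> hP; suff h (s : seq I) : definable (fun v => forall i, i \in s -> P i v).
  apply: definable_iff (h (enum I)) => v.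
  by split=> H i; [apply: H; rewrite mem_enum | move=> _; apply: H].
elim: s => [|i s IH]; first by apply: definable_iff (definable_const True).
apply: definable_iff (definable_and (hP i) IH) => v; split=> [[Pi Ps] j|H].
  by rewrite inE => /orP[/eqP->|/Ps].
by split=> [|j js]; apply: H; rewrite inE ?eqxx // js orbT.
Qed.

Lemma definable_ex (I : finType) (P : I -> (nat -> F) -> Prop) :
  (forall i, definable (P i)) -> definable (fun v => exists i, P i v).
Proof.
move=> hP; apply: (@definable_iff (fun v => ~ forall i, ~ P i v)).
  by move=> v; split=> [/existsNP[i /contrapT]|[i Pi] /(_ i)//]; exists i.
by apply: definable_not; apply: definable_all => i; apply: definable_not.
Qed.

Lemma definable_exists1 i P : definable P ->
  definable (fun v => exists x, P (fun j => if j == i then x else v j)).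
Proof.
case=> f rf hf; exists (GRing.Exists i f) => //= e.
have E x : (fun j => if j == i then x else nth 0 e j) = nth 0 (set_nth 0 e i x).
  by apply: funext => j; rewrite nth_set_nth.
by split=> -[x]; [rewrite E hf | rewrite -hf -E]; exists x.
Qed.

(** Quantification over all the variables listed in s at once: v' is v with
    new values for these variables. *)
Lemma definable_exists (s : seq nat) P : definable P ->
  definable (fun v => exists v', (forall i, i \notin s -> v' i = v i) /\ P v').
Proof.
move=> dP; elim: s => [|i s IH].
  apply: definable_iff dP => v; split=> [Pv|[v' [h Pv']]]; first by exists v.
  by have <- : v' = v by apply: funext => i; apply: h.
apply: definable_iff (definable_exists1 i IH) => v; split=> [[x [v' [h Pv']]]|[v' [h Pv']]].
  exists v'; split=> // j; rewrite inE negb_or => /andP[/negPf ji /h ->].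
  by rewrite ji.
exists (v' i), v'; split=> // j js.
by case: eqVneq => [->//|ji]; apply: h; rewrite inE negb_or ji.
Qed.

(** The polynomials whose vanishing a quantifier-free formula tests. *)
Fixpoint atoms (f : GRing.formula F) : seq (GRing.term F) :=
  match f with
  | GRing.Equal t1 t2 => [:: GRing.Add t1 (GRing.Opp t2)]
  | GRing.And f g | GRing.Or f g | GRing.Implies f g => atoms f ++ atoms g
  | GRing.Not f => atoms f
  | _ => [::]
  end.

Definition same_zeros (s : seq (GRing.term F)) (e e' : seq F) : bool :=
  all (fun t => (GRing.eval e t == 0) == (GRing.eval e' t == 0)) s.

Lemma qf_eval_atoms (f : GRing.formula F) e e' :
  GRing.qf_form f -> GRing.rformula f -> same_zeros (atoms f) e e' ->
  GRing.qf_eval e f = GRing.qf_eval e' f.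
Proof.
rewrite /same_zeros; elim: f => //=.
- by move=> t1 t2 _ _; rewrite andbT !subr_eq0 => /eqP.
- move=> f IHf g IHg /andP[qf qg] /andP[rf rg]; rewrite all_cat => /andP[hf hg].
  by rewrite IHf // IHg.
- move=> f IHf g IHg /andP[qf qg] /andP[rf rg]; rewrite all_cat => /andP[hf hg].
  by rewrite IHf // IHg.
- move=> f IHf g IHg /andP[qf qg] /andP[rf rg]; rewrite all_cat => /andP[hf hg].
  by rewrite IHf // IHg.
- by move=> f IHf qf rf hf; rewrite IHf.
Qed.

Lemma atoms_rterm (f : GRing.formula F) :
  GRing.rformula f -> all (@GRing.rterm F) (atoms f).
Proof.
elim: f => //=.
- by move=> t1 t2 ->.
- by move=> f IHf g IHg /andP[rf rg]; rewrite all_cat IHf // IHg.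
- by move=> f IHf g IHg /andP[rf rg]; rewrite all_cat IHf // IHg.
- by move=> f IHf g IHg /andP[rf rg]; rewrite all_cat IHf // IHg.
Qed.

End Definable.

(** Quantifier elimination over algebraically closed fields: membership in a
    definable set only depends on which of finitely many polynomials
    vanish. *)
Lemma definable_constructible (F : closedFieldType) (P : (nat -> F) -> Prop) :
  definable P -> exists2 s : seq (GRing.term F), all (@GRing.rterm F) s &
    forall e e', same_zeros s e e' -> P (nth 0 e) -> P (nth 0 e').
Proof.
case=> f rf hf.
pose ok := ClosedFieldQE.holds_ex_elim (@GRing.solve_monicpoly F).
have wf := @ClosedFieldQE.wf_ex_elim F.
pose g := GRing.quantifier_elim (@ClosedFieldQE.ex_elim F) f.
have /andP[qg rg] : GRing.qf_form g && GRing.rformula g.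
  exact: GRing.quantifier_elim_wf.
have gP e : reflect (GRing.holds e f) (GRing.qf_eval e g).
  exact: GRing.quantifier_elim_rformP.
exists (atoms g) => [|e e' h]; first exact: atoms_rterm.
by move/hf/gP => He; apply/hf/gP; rewrite -(qf_eval_atoms qg rg h).
Qed.

Section TermValue.
Variables (F : fieldType) (A : comNzRingType) (iota : F -> A) (v : nat -> A).

(** With a polynomial ring for A, the polynomial that a term denotes. *)
Fixpoint term_value (t : GRing.term F) : A :=
  match t with
  | GRing.Var i => v i
  | GRing.Const c => iota c
  | GRing.NatConst n => n%:R
  | GRing.Add t u => term_value t + term_value u
  | GRing.Opp t => - term_value t
  | GRing.NatMul t n => term_value t *+ n
  | GRing.Mul t u => term_value t * term_value u
  | GRing.Inv t => 0
  | GRing.Exp t n => term_value t ^+ n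
  end.

Lemma term_value_morph (phi : {rmorphism A -> F}) (e : seq F) (t : GRing.term F) :
  (forall c, phi (iota c) = c) -> (forall i, phi (v i) = nth 0 e i) ->
  GRing.rterm t -> phi (term_value t) = GRing.eval e t.
Proof.
move=> hc hv; elim: t => //=.
- by move=> n _; rewrite rmorph_nat.
- by move=> t IHt u IHu /andP[rt ru]; rewrite rmorphD IHt // IHu.
- by move=> t IHt rt; rewrite rmorphN IHt.
- by move=> t IHt n rt; rewrite rmorphMn IHt.
- by move=> t IHt u IHu /andP[rt ru]; rewrite rmorphM IHt // IHu.
- by move=> t IHt n rt; rewrite rmorphXn IHt.
Qed.

End TermValue.

(** The vanishing pattern of finitely many polynomials is constant where none of
    the nonzero ones vanishes, so that a definable condition is constant
    there.  The family phi stands for evaluation at the points of X, so as to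
    cover polynomials in any number of variables. *)
Lemma definable_dichotomy (F : closedFieldType) (A : idomainType) (X : Type)
    (iota : F -> A) (v : nat -> A) (phi : X -> {rmorphism A -> F})
    (e : X -> seq F) (P : (nat -> F) -> Prop) :
  (forall x c, phi x (iota c) = c) ->
  (forall x i, phi x (v i) = nth 0 (e x) i) ->
  (forall g, g != 0 -> exists x, phi x g != 0) ->
  definable P -> exists2 g : A, g != 0 &
    (forall x, phi x g != 0 -> P (nth 0 (e x))) \/
    (forall x, phi x g != 0 -> ~ P (nth 0 (e x))).
Proof.
move=> hc hv nz /definable_constructible[s rs hs].
pose h (i : 'I_(size s)) : A := term_value iota v (nth (GRing.Const 0) s i).
pose g : A := \prod_(i | h i != 0) h i.
have g0 : g != 0 by apply/prodf_neq0.
have same x y : phi x g != 0 -> phi y g != 0 -> same_zeros s (e x) (e y).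
  rewrite /g !rmorph_prod => /prodf_neq0 gx /prodf_neq0 gy.
  apply/(all_nthP (GRing.Const 0)) => i ltis; pose k := Ordinal ltis.
  have rt := all_nthP (GRing.Const 0) rs i ltis.
  rewrite -!(term_value_morph (hc _) (hv _)) // -[term_value _ _ _]/(h k).
  have [->|t0] := eqVneq (h k) 0; first by rewrite !rmorph0.
  by rewrite (negPf (gx _ t0)) (negPf (gy _ t0)).
exists g => //; have [x gx] := nz g g0.
have [Px|nPx] := EM (P (nth 0 (e x))); [left|right] => y gy.
  exact: hs _ _ (same _ _ gx gy) Px.
by move=> Py; apply: nPx; apply: hs _ _ (same _ _ gy gx) Py.
Qed.

Definition zero_ext (F : fieldType) (m : nat) (c : 'I_m -> F) : nat -> F :=
  nth 0 [seq c i | i <- enum 'I_m].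

Lemma zero_ext_ord (F : fieldType) (m : nat) (c : 'I_m -> F) (i : 'I_m) :
  zero_ext c i = c i.
Proof. by rewrite /zero_ext (nth_map i) ?size_enum_ord // nth_ord_enum. Qed.

(** Nonempty Zariski open sets of affine space contain the complement of a
    hypersurface, and these complements are closed under intersection. *)
Definition generic (F : fieldType) (m : nat) (Q : ('I_m -> F) -> Prop) : Prop :=
  exists2 g : {mpoly F[m]}, g != 0 & forall c, g.@[c] != 0 -> Q c.

(** The one-variable case of [generic]: all but finitely many points. *)
Definition cofin (F : fieldType) (Q : F -> Prop) : Prop :=
  exists2 g : {poly F}, g != 0 & forall a, g.[a] != 0 -> Q a.

Lemma definable_generic (F : numClosedFieldType) (m : nat) P :
  definable P -> generic (fun c : 'I_m -> F => P (zero_ext c)) \/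
                 generic (fun c : 'I_m -> F => ~ P (zero_ext c)).
Proof.
pose v (i : nat) : {mpoly F[m]} := if insub i is Some j then 'X_j else 0.
case/(@definable_dichotomy F {mpoly F[m]} ('I_m -> F) (@mpolyC m F) v
  (fun c => meval c) (fun c => [seq c i | i <- enum 'I_m])).
- by move=> c a; exact: mevalC.
- move=> c i; rewrite /v; case: insubP => [j _ <-|im].
    by rewrite [LHS]mevalXU (nth_map j) ?size_enum_ord //= nth_ord_enum.
  by rewrite [LHS]meval0 nth_default // size_map size_enum_ord leqNgt.
- exact: mpoly_nonroot.
by move=> g g0 [] h; [left|right]; exists g.
Qed.

Lemma definable_cofin (F : numClosedFieldType) P :
  definable P -> cofin (fun a : F => P (nth 0 [:: a])) \/
                 cofin (fun a : F => ~ P (nth 0 [:: a])).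
Proof.
case/(@definable_dichotomy F {poly F} F (@polyC F) (nth 0 [:: 'X])
  (fun a => horner_eval a) (fun a => [:: a])).
- by move=> a c; exact: hornerC.
- by move=> a [|[|i]]; [exact: hornerX | exact: horner0 | exact: horner0].
- exact: poly_nonroot.
by move=> g g0 [] h; [left|right]; exists g.
Qed.

(** * Generic points, and definable functions of one variable *)

Section Generic.
Variables (F : numFieldType) (m : nat).
Implicit Types P Q : ('I_m -> F) -> Prop.

Lemma generic_sub P Q : (forall c, P c -> Q c) -> generic P -> generic Q.
Proof. by move=> PQ [g g0 gP]; exists g => // c /gP/PQ. Qed.

Lemma generic_and P Q : generic P -> generic Q -> generic (fun c => P c /\ Q c).
Proof.
move=> [g g0 gP] [h h0 hQ]; exists (g * h); first by rewrite mulf_neq0.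
by move=> c; rewrite mevalM mulf_eq0 negb_or => /andP[/gP ? /hQ].
Qed.

Lemma generic_true P : (forall c, P c) -> generic P.
Proof. by move=> hP; exists 1 => //; exact: oner_neq0. Qed.

Lemma generic_all (I : finType) (P : I -> ('I_m -> F) -> Prop) :
  (forall i, generic (P i)) -> generic (fun c => forall i, P i c).
Proof.
move=> h; have {}h i : exists g : {mpoly F[m]}, g != 0 /\ forall c, g.@[c] != 0 -> P i c.
  by have [g] := h i; exists g.
have [g gP] := choice h; exists (\prod_i g i).
  by apply/prodf_neq0 => i _; case: (gP i).
move=> c; rewrite rmorph_prod => /prodf_neq0 gc i.
by case: (gP i) => _; apply; exact: gc.
Qed.

Lemma generic_inh P : generic P -> exists c, P c.
Proof. by case=> g /mpoly_nonroot[c gc] gP; exists c; apply: gP. Qed.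

End Generic.

Section Cofin.
Variable F : numFieldType.
Implicit Types P Q : F -> Prop.

Lemma cofin_sub P Q : (forall c, P c -> Q c) -> cofin P -> cofin Q.
Proof. by move=> PQ [g g0 gP]; exists g => // c /gP/PQ. Qed.

Lemma cofin_and P Q : cofin P -> cofin Q -> cofin (fun c => P c /\ Q c).
Proof.
move=> [g g0 gP] [h h0 hQ]; exists (g * h); first by rewrite mulf_neq0.
by move=> c; rewrite hornerM mulf_eq0 negb_or => /andP[/gP ? /hQ].
Qed.

Lemma cofin_true P : (forall c, P c) -> cofin P.
Proof. by move=> hP; exists 1 => //; exact: oner_neq0. Qed.

Lemma cofin_all (I : finType) (P : I -> F -> Prop) :
  (forall i, cofin (P i)) -> cofin (fun c => forall i, P i c).
Proof.
move=> h; have {}h i : exists g : {poly F}, g != 0 /\ forall c, g.[c] != 0 -> P i c.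
  by have [g] := h i; exists g.
have [g gP] := choice h; exists (\prod_i g i).
  by apply/prodf_neq0 => i _; case: (gP i).
move=> c; rewrite horner_prod => /prodf_neq0 gc i.
by case: (gP i) => _; apply; exact: gc.
Qed.

Lemma cofin_inh P : cofin P -> exists c, P c.
Proof. by case=> g /poly_nonroot[c gc] gP; exists c; apply: gP. Qed.

Lemma cofin_nonroot (g : {poly F}) : g != 0 -> cofin (fun a => g.[a] != 0).
Proof. by exists g. Qed.

Lemma cofin_neq (b : F) : cofin (fun a => a != b).
Proof.
exists ('X - b%:P) => [|a]; first by rewrite polyXsubC_eq0.
by rewrite hornerXsubC subr_eq0.
Qed.

(** Infinitely many points are enough to test that a polynomial vanishes. *)
Lemma cofin_eq0 (g : {poly F}) : cofin (fun a => g.[a] = 0) -> g = 0.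
Proof.
move=> h; apply/eqP/negPn/negP => /cofin_nonroot/(cofin_and h)/cofin_inh[a].
by case=> -> /eqP.
Qed.

End Cofin.

Section Rational.
Variable F : numClosedFieldType.
Variable P : F -> F -> Prop.
Hypothesis dP : definable (fun v => P (v 0%N) (v 1%N)).
Variable f : F -> F.
Hypothesis fP : cofin (fun a => P a (f a) /\ forall y, P a y -> y = f a).

Local Notation ev a y h := ((h : {poly {poly F}}).[y%:P].[a]).
Local Notation onG h := (cofin (fun a => ev a (f a) h = 0)).
Local Notation offG h := (cofin (fun a => ev a (f a) h != 0)).

Lemma evM a y (g h : {poly {poly F}}) : ev a y (g * h) = ev a y g * ev a y h.
Proof. by rewrite !hornerM. Qed.

Lemma evZ a y c (h : {poly {poly F}}) : ev a y (c *: h) = c.[a] * ev a y h.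
Proof. by rewrite hornerZ hornerM. Qed.

Lemma evD a y (g h : {poly {poly F}}) : ev a y (g + h) = ev a y g + ev a y h.
Proof. by rewrite !hornerD. Qed.

(** Vanishing at (a, f a) is a definable condition on a.  Hence the polynomials
    that vanish on the graph of f, up to finitely many points, form a prime
    ideal. *)
Lemma graph_dichotomy h : onG h \/ offG h.
Proof.
have d1 : definable (fun v : nat -> F => P (v 0%N) (v 1%N) /\ ev (v 0%N) (v 1%N) h = 0).
  apply: definable_and => //; apply: definable_eq; last exact: polyfun_const.
  by apply: polyfun_horner2; apply: polyfun_var.
case: (definable_cofin (definable_exists1 1 d1)) => /(cofin_and fP) H; [left|right].
  apply: cofin_sub H => a [[Pa uPa] [y /= [/uPa -> ]]] //.
apply: cofin_sub H => a [[Pa uPa] nex]; apply/eqP => h0.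
by apply: nex; exists (f a).
Qed.

Lemma not_on_off h : onG h -> offG h -> False.
Proof. by move=> h1 h2; have [a [->]] := cofin_inh (cofin_and h1 h2); rewrite eqxx. Qed.

Lemma cofin_lead (h : {poly {poly F}}) : h != 0 -> cofin (fun a => (lead_coef h).[a] != 0).
Proof. by rewrite -lead_coef_eq0; exact: cofin_nonroot. Qed.

Definition fibre_poly (a : F) (h : {poly {poly F}}) : {poly F} := map_poly (horner_eval a) h.

Lemma horner_fibre_poly a y h : (fibre_poly a h).[y] = ev a y h.
Proof.
rewrite /fibre_poly -[y in LHS](hornerC y a) -[(y%:P).[a]]/(horner_eval a y%:P).
by rewrite horner_map.
Qed.

Let graph_atoms : exists s : seq (GRing.term F), all (@GRing.rterm F) s /\
  forall a y z, same_zeros s [:: a; y] [:: a; z] -> P a y -> P a z.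
Proof.
have [s rs hs] := definable_constructible dP; exists s; split=> // a y z.
exact: (hs [:: a; y] [:: a; z]).
Qed.

(** The bivariate polynomial of a term in the variables 0, the base a, and 1,
    the value y. *)
Definition bivariate_term (t : GRing.term F) : {poly {poly F}} :=
  term_value (fun c => (c%:P)%:P) (nth 0 [:: 'X%:P; 'X]) t.

Lemma ev_bivariate_term a y t : GRing.rterm t -> ev a y (bivariate_term t) = GRing.eval [:: a; y] t.
Proof.
move=> rt.
rewrite -[LHS]/((horner_eval a \o horner_eval y%:P) (bivariate_term t)).
apply: term_value_morph rt => [c|i]; first by rewrite /= /horner_eval !hornerC.
case: i => [|[|i]]; rewrite /= /horner_eval ?hornerC ?hornerX ?hornerC //.
by rewrite nth_nil !horner0 nth_nil.
Qed.

(** If no nonzero polynomial vanished on the graph, then none of the nonzero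
    polynomials defining P would vanish at (a, f a) for general a, and P would
    hold at (a, y) for all but finitely many y, not just for y = f a. *)
Lemma graph_equation : exists2 h : {poly {poly F}}, h != 0 & onG h.
Proof.
apply: contrapT => none.
have off h : h != 0 -> offG h.
  by move=> h0; case: (graph_dichotomy h) => // hon; case: none; exists h.
have [s [rs hs]] := graph_atoms.
pose h (i : 'I_(size s)) := bivariate_term (nth (GRing.Const 0) s i).
pose g := \prod_(i | h i != 0) h i.
have g0 : g != 0 by apply/prodf_neq0.
have [a [[Pa uPa] ga]] := cofin_inh (cofin_and fP (off _ g0)).
(* y avoids f a and the roots of g above a, so P a y holds as well. *)
have fg0 : fibre_poly a g * ('X - (f a)%:P) != 0.
  rewrite mulf_neq0 ?polyXsubC_eq0 //; apply: contraNneq ga => e.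
  by rewrite -horner_fibre_poly e horner0.
have [y] := poly_nonroot fg0; rewrite hornerM mulf_eq0 negb_or hornerXsubC.
rewrite subr_eq0 horner_fibre_poly => /andP[gy /eqP]; apply; apply: uPa.
apply: hs Pa; apply/(all_nthP (GRing.Const 0)) => i ltis.
have rt := all_nthP (GRing.Const 0) rs i ltis.
rewrite -!ev_bivariate_term // -[bivariate_term _]/(h (Ordinal ltis)).
have [->|t0] := eqVneq (h (Ordinal ltis)) 0; first by rewrite !horner0.
have h0 z : ev a z g != 0 -> ev a z (h (Ordinal ltis)) != 0.
  by rewrite /g (bigD1 (Ordinal ltis)) //= evM mulf_eq0 negb_or => /andP[].
by rewrite (negPf (h0 _ ga)) (negPf (h0 _ gy)).
Qed.

Lemma min_graph_equation : exists g : {poly {poly F}},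
  [/\ g != 0, onG g & forall h, h != 0 -> onG h -> (size g <= size h)%N].
Proof.
have [h0 h0n h0G] := graph_equation.
have ex : exists n, `[< exists h : {poly {poly F}}, [/\ h != 0, onG h & size h = n] >].
  by exists (size h0); apply/asboolP; exists h0.
case: (ex_minnP ex) => n /asboolP[g [g0 gG <-]] gmin; exists g; split=> // h hn hG.
by apply: gmin; apply/asboolP; exists h.
Qed.

Variable g : {poly {poly F}}.
Hypotheses (g0 : g != 0) (gG : onG g)
  (gmin : forall h, h != 0 -> onG h -> (size g <= size h)%N).

(** Pseudo-division by g: the remainder vanishes on the graph and has smaller
    degree than g, so it is zero. *)
Lemma on_graph_div h : onG h -> cofin (fun a => forall y, ev a y g = 0 -> ev a y h = 0).
Proof.
move=> hG; have e := Pdiv.Idomain.divp_eq h g.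
set c := _ ^+ _ in e; have c0 : c != 0 by rewrite expf_neq0 // lead_coef_eq0.
have r0 : h %% g = 0.
  apply/eqP/negPn/negP => r0; have := ltn_modpN0 h g0; rewrite ltnNge gmin //.
  apply: cofin_sub (cofin_and hG gG) => a [ha ga].
  have := congr1 (fun h => ev a (f a) h) e.
  by rewrite /= evZ evD evM ha ga !mulr0 add0r.
apply: cofin_sub (cofin_nonroot c0) => a ca y gy.
have := congr1 (fun h => ev a y h) e.
rewrite /= r0 addr0 evZ evM gy mulr0 => /eqP.
by rewrite mulf_eq0 (negPf ca) => /eqP.
Qed.

(** The gcd of h and g is constant: otherwise the cofactor of the gcd in g would
    be an equation of the graph of smaller degree.  A Bezout relation between h
    and g then forbids common roots above almost every point. *)
Lemma off_graph_coprime h : offG h ->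
  cofin (fun a => forall y, ev a y g = 0 -> ev a y h != 0).
Proof.
move=> hG; have h0 : h != 0.
  by apply/eqP => e; apply: not_on_off hG; apply: cofin_true => a; rewrite e !horner0.
pose d := gcdp h g.
have [[c q] /= c0 cg] := Pdiv.Idomain.dvdpP _ _ (dvdp_gcdr h g).
have [[c' q'] /= c'0 ch] := Pdiv.Idomain.dvdpP _ _ (dvdp_gcdl h g).
have doff : offG d.
  case: (graph_dichotomy d) => // dG; case: (@not_on_off h) => //.
  apply: cofin_sub (cofin_and dG (cofin_nonroot c'0)) => a [da ca].
  have := congr1 (fun h => ev a (f a) h) ch.
  by rewrite /= evZ evM da mulr0 => /eqP; rewrite mulf_eq0 (negPf ca) => /eqP.
have qG : onG q.
  apply: cofin_sub (cofin_and doff gG) => a [da ga].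
  have := congr1 (fun h => ev a (f a) h) cg.
  by rewrite /= evZ evM ga mulr0 => /esym/eqP; rewrite mulf_eq0 (negPf da) orbF => /eqP.
have q0 : q != 0.
  apply: contraNneq g0 => q0; move: cg; rewrite q0 mul0r => /eqP.
  by rewrite -mul_polyC mulf_eq0 polyC_eq0 (negPf c0).
have d0 : d != 0 by rewrite gcdp_eq0 negb_and h0.
have d1 : size d = 1%N.
  have := gmin q0 qG; rewrite -(size_scale g c0) cg size_mul //.
  have := size_poly_eq0 d; rewrite (negPf d0); case: (size d) => [|[|k]] // _.
  by rewrite !addnS /= ltnNge leq_addr.
have /Bezout_coprimepP[[u v]] : coprimep h g by rewrite coprimep_def d1.
rewrite /= => /eqpP[[c1 c2]] /= /andP[c10 c20] e.
apply: cofin_sub (cofin_nonroot c20) => a ca y gy; apply: contra_neq ca => hy.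
have := congr1 (fun h => ev a y h) e.
by rewrite /= !evZ evD !evM hy gy !mulr0 addr0 mulr0 !hornerC mulr1 => <-.
Qed.

Lemma graph_size_gt1 : (1 < size g)%N.
Proof.
rewrite ltnNge; apply/negP => /size1_polyC e.
apply: (not_on_off gG); apply: cofin_sub (cofin_lead g0) => a.
by rewrite e hornerC lead_coefC.
Qed.

(** In characteristic 0 the derivative of g is nonzero and of smaller degree, so
    it does not vanish on the graph. *)
Lemma graph_separable : cofin (fun a => forall y, ev a y g = 0 -> ev a y g^`() != 0).
Proof.
apply: off_graph_coprime; case: (graph_dichotomy g^`()) => // dG.
have d0 : g^`() != 0.
  have : lead_coef g != 0 by rewrite lead_coef_eq0.
  rewrite lead_coefE; have := graph_size_gt1; case: (size g) => [|[|k]] // _ /= gk.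
  apply: contraNneq gk => /(congr1 (fun q : {poly {poly F}} => q`_k)).
  rewrite coef_deriv coef0 -mulr_natr => /eqP; rewrite mulf_eq0 => /orP[//|].
  by rewrite -polyC_natr polyC_eq0 pnatr_eq0.
by have := gmin d0 dG; rewrite leqNgt lt_size_deriv.
Qed.

(** By [on_graph_div] and [off_graph_coprime], no polynomial distinguishes f a
    from the other roots of g above a general a.  So all these roots satisfy the
    formula defining P, whose only solution is f a. *)
Lemma graph_roots : cofin (fun a => forall y, ev a y g = 0 -> y = f a).
Proof.
have [s [rs hs]] := graph_atoms.
pose h (i : 'I_(size s)) := bivariate_term (nth (GRing.Const 0) s i).
have same i : cofin (fun a => forall y, ev a y g = 0 ->
    (ev a (f a) (h i) == 0) = (ev a y (h i) == 0)).
  case: (graph_dichotomy (h i)) => [on|off].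
    apply: cofin_sub (cofin_and on (on_graph_div on)) => a [ha H] y /H ->.
    by rewrite ha.
  apply: cofin_sub (cofin_and off (off_graph_coprime off)) => a [ha H] y /H.
  by rewrite (negPf ha) => /negPf ->.
apply: cofin_sub (cofin_and fP (cofin_all same)) => a [[Pa uPa] H] y gy.
apply: uPa; apply: hs Pa; apply/(all_nthP (GRing.Const 0)) => i ltis.
have rt := all_nthP (GRing.Const 0) rs i ltis.
by rewrite -!ev_bivariate_term // -[bivariate_term _]/(h (Ordinal ltis)) (H _ _ gy).
Qed.

(** Above a general point, g has a single root and this root is simple. *)
Lemma graph_size : size g = 2%N.
Proof.
have [a [[H1 H2] [H3 H4]]] := cofin_inh (cofin_and (cofin_and graph_separable graph_roots)
  (cofin_and (cofin_lead g0) gG)).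
have sz : size (fibre_poly a g) = size g by rewrite size_map_poly_id0.
rewrite -sz; apply: (@size_unique_simple_root _ _ (f a)).
- by rewrite rootE horner_fibre_poly H4.
- by move=> y; rewrite rootE horner_fibre_poly => /eqP/H2.
by rewrite /fibre_poly deriv_map -/(fibre_poly a _) horner_fibre_poly H1.
Qed.

Lemma graph_rational : cofin (fun a => (g`_1).[a] != 0 /\ f a = - (g`_0).[a] / (g`_1).[a]).
Proof.
have := cofin_lead g0; rewrite lead_coefE graph_size /= => /cofin_and/(_ gG).
apply: cofin_sub => a [g1a]; rewrite (horner_coef g) graph_size !big_ord_recl big_ord0.
rewrite /= expr0 mulr1 expr1 addr0 hornerD hornerM hornerC => e; split=> //.
by apply: (mulIf g1a); rewrite divfK //; apply/eqP; rewrite -addr_eq0 mulrC addrC e.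
Qed.

End Rational.

(** A definable function of one variable is generically rational in
    characteristic 0: its graph has an equation of degree 1 in the value. *)
Lemma definable_rational (F : numClosedFieldType) (P : F -> F -> Prop) (f : F -> F) :
  definable (fun v => P (v 0%N) (v 1%N)) ->
  cofin (fun a => P a (f a) /\ forall y, P a y -> y = f a) ->
  exists N D : {poly F}, cofin (fun a => D.[a] != 0 /\ f a = N.[a] / D.[a]).
Proof.
move=> dP fP; have [g [g0 gG gmin]] := min_graph_equation dP fP.
exists (- g`_0), g`_1; apply: cofin_sub (graph_rational dP fP g0 gG gmin) => a.
by rewrite hornerN.
Qed.

(** * Moebius transformations *)

Lemma ord2_ind (P : 'I_2 -> Prop) : P 0 -> P 1 -> forall i, P i.
Proof.
move=> P0 P1 [[|[]]] // lti; [move: P0 | move: P1].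
  by congr P; apply: val_inj.
by congr P; apply: val_inj.
Qed.

Lemma sum2 (V : nmodType) (f : 'I_2 -> V) : \sum_k f k = f 0 + f 1.
Proof.
rewrite !big_ord_recl big_ord0 addr0; congr (f _ + f _); exact: val_inj.
Qed.

Lemma prod2 (V : comPzSemiRingType) (f : 'I_2 -> V) : \prod_k f k = f 0 * f 1.
Proof.
rewrite !big_ord_recl big_ord0 mulr1; congr (f _ * f _); exact: val_inj.
Qed.

Lemma det2 (A : comNzRingType) (M : 'M[A]_2) :
  \det M = M 0 0 * M 1 1 - M 0 1 * M 1 0.
Proof.
rewrite (expand_det_row _ 0) sum2 /cofactor !det_mx11 !mxE /= expr0 expr1 mul1r.
by rewrite mulN1r mulrN; congr (_ * M _ _ - _ * M _ _); apply: val_inj.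
Qed.

Section Mobius.
Variable R : realType.
Local Notation F := R[i].
Implicit Types (p q : P1 R) (A B : 'M[F]_2).

Lemma mulmx2 A (v : 'cV[F]_2) i : (A *m v) i 0 = A i 0 * v 0 0 + A i 1 * v 1 0.
Proof. by rewrite mxE sum2. Qed.

Lemma cV2P (u v : 'cV[F]_2) : u 0 0 = v 0 0 -> u 1 0 = v 1 0 -> u = v.
Proof. by move=> h0 h1; apply/colP; elim/ord2_ind. Qed.

Lemma hcoord_None k : hcoord (None : P1 R) k 0 = if k == 0 then 1 else 0.
Proof. by rewrite mxE. Qed.

Lemma hcoord_Some (z : F) k : hcoord (Some z : P1 R) k 0 = if k == 0 then z else 1.
Proof. by rewrite mxE. Qed.

Definition hcE := (hcoord_None, hcoord_Some).

Lemma hcoord_neq0 p : hcoord p != 0.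
Proof.
case: p => [z|]; apply/eqP => /colP h.
  by have := h 1; rewrite hcE mxE => /eqP; rewrite oner_eq0.
by have := h 0; rewrite hcE mxE => /eqP; rewrite oner_eq0.
Qed.

Lemma hcoordK : cancel (@hcoord R) (@of_hcoord R).
Proof.
by case=> [z|]; rewrite /of_hcoord !hcE /= ?oner_eq0 ?eqxx ?divr1.
Qed.

Lemma of_hcoordZ k (v : 'cV[F]_2) : k != 0 -> of_hcoord (k *: v) = of_hcoord v.
Proof.
move=> k0; rewrite /of_hcoord !mxE mulf_eq0 (negPf k0) /=.
by case: ifP => // _; rewrite -mulf_div divff // mul1r.
Qed.

Lemma of_hcoordP (v : 'cV[F]_2) :
  v != 0 -> exists2 k, k != 0 & v = k *: hcoord (of_hcoord v).
Proof.
move=> v0; rewrite /of_hcoord; have [v1|v1] := eqVneq (v 1 0) 0.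
  exists (v 0 0); last by apply: cV2P; rewrite mxE hcE ?mulr1 // mulr0.
  by apply: contra v0 => /eqP v00; apply/eqP/cV2P; rewrite mxE.
exists (v 1 0) => //.
by apply: cV2P; rewrite mxE hcE /= ?mulr1 // mulrC divfK.
Qed.

Lemma bracket_eq0 p q : (bracket p q == 0) = (p == q).
Proof.
rewrite /bracket subr_eq0; case: p q => [z|] [w|]; rewrite !hcE /=.
- by rewrite mulr1 mul1r.
- by rewrite mulr0 mul1r eq_sym oner_eq0.
- by rewrite mulr1 mul0r oner_eq0.
- by rewrite mulr0 mul0r !eqxx.
Qed.

Lemma mobius_comp A B p : B \in unitmx -> mobius A (mobius B p) = mobius (A *m B) p.
Proof.
move=> uB; have [k k0 e] := hcoord_mobius p uB.
by rewrite [in RHS]/mobius -mulmxA e -scalemxAr of_hcoordZ.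
Qed.

Lemma mobius1 p : mobius 1%:M p = p.
Proof. by rewrite /mobius mul1mx hcoordK. Qed.

Lemma mobiusK A : A \in unitmx -> cancel (mobius A) (mobius (invmx A)).
Proof. by move=> uA p; rewrite mobius_comp // mulVmx // mobius1. Qed.

Lemma mobiusVK A : A \in unitmx -> cancel (mobius (invmx A)) (mobius A).
Proof. by move=> uA p; rewrite mobius_comp ?unitmx_inv // mulmxV // mobius1. Qed.

Lemma mobius_inj A : A \in unitmx -> injective (mobius A).
Proof. by move=> /mobiusK/can_inj. Qed.

Definition mx2 (a b c d : F) : 'M[F]_2 :=
  \matrix_(i, j) if i == 0 then (if j == 0 then a else b)
                 else (if j == 0 then c else d).

Lemma mx2E a b c d : (mx2 a b c d 0 0 = a) * (mx2 a b c d 0 1 = b)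
  * (mx2 a b c d 1 0 = c) * (mx2 a b c d 1 1 = d).
Proof. by rewrite !mxE. Qed.

Lemma unitmx2 A : (A \in unitmx) = (A 0 0 * A 1 1 - A 0 1 * A 1 0 != 0).
Proof. by rewrite unitmxE det2 unitfE. Qed.

(** The coordinates of A p are, up to scaling each of them, the brackets of p
    with p2 and with p1. *)
Lemma mobius_std p1 p2 p3 : p1 != p2 -> p1 != p3 -> p2 != p3 ->
  exists2 A : 'M[F]_2, A \in unitmx &
    [/\ mobius A p1 = None, mobius A p2 = Some 0 & mobius A p3 = Some 1].
Proof.
move=> n12 n13 n23.
have b12 : bracket p2 p1 != 0 by rewrite bracket_eq0 eq_sym.
have b13 : bracket p3 p1 != 0 by rewrite bracket_eq0 eq_sym.
have b23 : bracket p3 p2 != 0 by rewrite bracket_eq0 eq_sym.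
pose l := (bracket p3 p2)^-1; pose u := (bracket p3 p1)^-1.
pose A := mx2 (l * hcoord p2 1 0) (- l * hcoord p2 0 0)
              (u * hcoord p1 1 0) (- u * hcoord p1 0 0).
have A0 p : (A *m hcoord p) 0 0 = l * bracket p p2.
  by rewrite mulmx2 !mx2E /bracket; ring.
have A1 p : (A *m hcoord p) 1 0 = u * bracket p p1.
  by rewrite mulmx2 !mx2E /bracket; ring.
have bb p : bracket p p = 0 by apply/eqP; rewrite bracket_eq0.
have l0 : l != 0 by rewrite invr_eq0.
have u0 : u != 0 by rewrite invr_eq0.
exists A.
  rewrite unitmx2 !mx2E.
  have -> : l * hcoord p2 1 0 * (- u * hcoord p1 0 0) -
     - l * hcoord p2 0 0 * (u * hcoord p1 1 0) = l * u * bracket p2 p1.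
    by rewrite /bracket; ring.
  by rewrite !mulf_neq0.
rewrite /mobius /of_hcoord !A0 !A1 !bb !mulr0 eqxx.
by rewrite !mulf_eq0 (negPf u0) (negPf b12) (negPf b13) mul0r !mulVf // divr1.
Qed.

Lemma cross_ratio_std (z : F) : cross_ratio None (Some 0) (Some 1) (Some z : P1 R) = z.
Proof.
rewrite /cross_ratio /bracket !hcE /=.
by rewrite !(mul0r, mul1r, mulr0, mulr1, sub0r, subr0) mulN1r divrNN divr1.
Qed.

(** After moving the first three points to infinity, 0 and 1, the cross-ratio
    is the position of the fourth. *)
Lemma cross_ratio_inj4 p1 p2 p3 p q : p1 != p2 -> p1 != p3 -> p2 != p3 ->
  p1 != p -> p1 != q -> cross_ratio p1 p2 p3 p = cross_ratio p1 p2 p3 q -> p = q.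
Proof.
move=> n12 n13 n23 np nq; have [A uA [e1 e2 e3]] := mobius_std n12 n13 n23.
rewrite -(cross_ratio_mobius _ _ _ _ uA) -[RHS](cross_ratio_mobius _ _ _ _ uA).
have np' : mobius A p1 != mobius A p by rewrite (inj_eq (mobius_inj uA)).
have nq' : mobius A p1 != mobius A q by rewrite (inj_eq (mobius_inj uA)).
move: np' nq'; rewrite e1 e2 e3 => np' nq' e; apply: (mobius_inj uA).
case: (mobius A p) (mobius A q) np' nq' e => [z|] // [w|] // _ _.
by rewrite !cross_ratio_std => ->.
Qed.

Lemma mobius_eq3 A B p1 p2 p3 p : A \in unitmx -> B \in unitmx ->
  p1 != p2 -> p1 != p3 -> p2 != p3 ->
  mobius A p1 = mobius B p1 -> mobius A p2 = mobius B p2 ->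
  mobius A p3 = mobius B p3 -> mobius A p = mobius B p.
Proof.
move=> uA uB n12 n13 n23 e1 e2 e3; have [<-//|np] := eqVneq p1 p.
apply: (@cross_ratio_inj4 (mobius A p1) (mobius A p2) (mobius A p3)).
- by rewrite (inj_eq (mobius_inj uA)).
- by rewrite (inj_eq (mobius_inj uA)).
- by rewrite (inj_eq (mobius_inj uA)).
- by rewrite (inj_eq (mobius_inj uA)).
- by rewrite e1 (inj_eq (mobius_inj uB)).
by rewrite cross_ratio_mobius // e1 e2 e3 cross_ratio_mobius.
Qed.

(** The cross-ratio is the only invariant of four points. *)
Lemma mobius_quad p1 p2 p3 p4 q1 q2 q3 q4 :
  p1 != p2 -> p1 != p3 -> p2 != p3 -> p1 != p4 ->
  q1 != q2 -> q1 != q3 -> q2 != q3 -> q1 != q4 ->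
  cross_ratio p1 p2 p3 p4 = cross_ratio q1 q2 q3 q4 ->
  exists2 A : 'M[F]_2, A \in unitmx &
    [/\ mobius A p1 = q1, mobius A p2 = q2, mobius A p3 = q3 & mobius A p4 = q4].
Proof.
move=> n12 n13 n23 n14 m12 m13 m23 m14 e.
have [A uA [a1 a2 a3]] := mobius_std n12 n13 n23.
have [B uB [b1 b2 b3]] := mobius_std m12 m13 m23.
have uBA : invmx B *m A \in unitmx by rewrite unitmx_mul unitmx_inv uB.
have E p q : mobius A p = mobius B q -> mobius (invmx B *m A) p = q.
  by move=> h; rewrite -mobius_comp // h mobiusK.
exists (invmx B *m A) => //.
have h1 : mobius (invmx B *m A) p1 = q1 by apply: E; rewrite a1 b1.
have h2 : mobius (invmx B *m A) p2 = q2 by apply: E; rewrite a2 b2.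
have h3 : mobius (invmx B *m A) p3 = q3 by apply: E; rewrite a3 b3.
split=> //; apply: (@cross_ratio_inj4 q1 q2 q3) => //.
  by rewrite -h1 (inj_eq (mobius_inj uBA)).
by rewrite -e -{1}h1 -{1}h2 -{1}h3 cross_ratio_mobius.
Qed.

End Mobius.

Local Open Scope classical_set_scope.
Local Open Scope card_scope.
Local Open Scope ring_scope.

(** * Multihomogeneous polynomials and Zariski closed sets *)

Section Multihomogeneous.
Variables (R : realType) (J : finType).
Local Notation F := R[i].
Implicit Types (f g : hpoly R J) (d : J -> nat) (h : J -> 'cV[F]_2).

Lemma sum_hvar (V : nmodType) (G : 'I_#|{: J * 'I_2}| -> V) :
  \sum_i G i = \sum_j (G (hvar j 0) + G (hvar j 1)).
Proof.
rewrite (reindex (@enum_rank (J * 'I_2)%type)) /=; last first.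
  by apply: onW_bij; exact: enum_rank_bij.
rewrite (eq_bigr (fun x => G (hvar x.1 x.2))); last by case.
rewrite -(pair_big xpredT xpredT (fun j k => G (hvar j k))) /=.
by apply: eq_bigr => j _; rewrite sum2.
Qed.

Lemma prod_hvar (V : comPzSemiRingType) (G : 'I_#|{: J * 'I_2}| -> V) :
  \prod_i G i = \prod_j (G (hvar j 0) * G (hvar j 1)).
Proof.
rewrite (reindex (@enum_rank (J * 'I_2)%type)) /=; last first.
  by apply: onW_bij; exact: enum_rank_bij.
rewrite (eq_bigr (fun x => G (hvar x.1 x.2))); last by case.
rewrite -(pair_big xpredT xpredT (fun j k => G (hvar j k))) /=.
by apply: eq_bigr => j _; rewrite prod2.
Qed.

(** Evaluation on the cone, at arbitrary vectors instead of the chosen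
    representatives of points. *)
Definition hev h f : F := f.@[fun i => h (enum_val i).1 (enum_val i).2 0].

Lemma hevM h f g : hev h (f * g) = hev h f * hev h g.
Proof. exact: mevalM. Qed.
Lemma hevD h f g : hev h (f + g) = hev h f + hev h g.
Proof. exact: mevalD. Qed.
Lemma hevB h f g : hev h (f - g) = hev h f - hev h g.
Proof. exact: mevalB. Qed.
Lemma hevZ h c f : hev h (c *: f) = c * hev h f.
Proof. exact: mevalZ. Qed.
Lemma hevX h j k : hev h 'X_(hvar j k) = h j k 0.
Proof. by rewrite /hev mevalXU enum_rankK. Qed.

Lemma hevalE (p : J -> P1 R) f : heval p f = hev (fun j => hcoord (p j)) f.
Proof. by []. Qed.

(** The multidegree d is a parameter here, so that it can be followed through
    sums and products. *)
Definition mhom d f :=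
  forall m, m \in msupp f -> forall j, (m (hvar j 0%R) + m (hvar j 1%R) = d j)%N.

Lemma mhomP f d : mhom d f -> multihomogeneous f.
Proof. by exists d. Qed.

Lemma hev_scale d f (l : J -> F) h : mhom d f ->
  hev (fun j => l j *: h j) f = (\prod_j l j ^+ d j) * hev h f.
Proof.
move=> hf; rewrite /hev !mevalE mulr_sumr; apply: eq_big_seq => m mf.
rewrite mulrCA; congr (_ * _); rewrite !prod_hvar -big_split /=.
by apply: eq_bigr => j _; rewrite !enum_rankK /= !mxE !exprMn -(hf m mf j) exprD mulrACA.
Qed.

Lemma mhomC c : mhom (fun=> 0%N) c%:MP.
Proof.
move=> m; rewrite msuppC; case: ifP => // _; rewrite inE => /eqP -> j.
by rewrite !mnm0E.
Qed.

#[global] Arguments mhomC : clear implicits.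

Lemma mhomD d f g : mhom d f -> mhom d g -> mhom d (f + g).
Proof.
by move=> hf hg m /msuppD_le; rewrite mem_cat => /orP[/hf|/hg].
Qed.

Lemma mhomN d f : mhom d f -> mhom d (- f).
Proof. by move=> hf m; rewrite (perm_mem (msuppN f)); apply: hf. Qed.

Lemma mhomB d f g : mhom d f -> mhom d g -> mhom d (f - g).
Proof. by move=> hf hg; apply: mhomD => //; apply: mhomN. Qed.

Lemma mhomM d e f g : mhom d f -> mhom e g -> mhom (fun j => d j + e j)%N (f * g).
Proof.
move=> hf hg m /msuppM_le/allpairsP[[m1 m2] [/= /hf h1 /hg h2 ->]] j.
by rewrite !mnmDE addnACA h1 h2.
Qed.

Lemma mhomX j k : mhom (fun i => (i == j) : nat) 'X_(hvar j k).
Proof.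
move=> m; rewrite msuppX inE => /eqP -> i; rewrite !mnm1E /hvar.
rewrite !(inj_eq enum_rank_inj) !xpair_eqE [j == i]eq_sym.
by case: (i == j); elim/ord2_ind: k.
Qed.
#[global] Arguments mhomX : clear implicits.

Lemma mhom_eq d e f : mhom d f -> d =1 e -> mhom e f.
Proof. by move=> hf de m /hf h j; rewrite h de. Qed.

Lemma mhomXn d f k : mhom d f -> mhom (fun j => k * d j)%N (f ^+ k).
Proof.
move=> hf; elim: k => [|k IH].
  by rewrite expr0 -mpolyC1; apply: mhom_eq (mhomC _) _ => j; rewrite mul0n.
by rewrite exprS; apply: mhom_eq (mhomM hf IH) _ => j; rewrite mulSn.
Qed.

Lemma mhom_prod (I : Type) (s : seq I) (d : I -> J -> nat) (f : I -> hpoly R J) :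
  (forall i, mhom (d i) (f i)) ->
  mhom (fun j => \sum_(i <- s) d i j)%N (\prod_(i <- s) f i).
Proof.
move=> hf; elim: s => [|i s IH].
  by rewrite big_nil -mpolyC1; apply: mhom_eq (mhomC _) _ => j; rewrite big_nil.
by rewrite big_cons; apply: mhom_eq (mhomM (hf i) IH) _ => j; rewrite big_cons.
Qed.

Lemma mhom_sum (I : eqType) (s : seq I) d (f : I -> hpoly R J) :
  (forall i, i \in s -> mhom d (f i)) -> mhom d (\sum_(i <- s) f i).
Proof.
elim: s => [|i s IH] hf; first by rewrite big_nil => m; rewrite msupp0.
rewrite big_cons; apply: mhomD; first by apply: hf; rewrite inE eqxx.
by apply: IH => j js; apply: hf; rewrite inE js orbT.
Qed.

Lemma mhomZ d c f : mhom d f -> mhom d (c *: f).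
Proof.
by move=> hf; rewrite -mul_mpolyC; apply: mhom_eq (mhomM (mhomC c) hf) _.
Qed.

Definition lin (A : 'M[F]_2) j k : hpoly R J :=
  A k 0 *: 'X_(hvar j 0) + A k 1 *: 'X_(hvar j 1).

Lemma hev_lin h A j k : hev h (lin A j k) = (A *m h j) k 0.
Proof. by rewrite /lin hevD !hevZ !hevX mulmx2. Qed.

Lemma mhom_lin A j k : mhom (fun i => (i == j) : nat) (lin A j k).
Proof. by apply: mhomD; apply: mhomZ; apply: mhomX. Qed.
#[global] Arguments mhom_lin : clear implicits.

Definition vbracket (u v : 'cV[F]_2) : F := u 0 0 * v 1 0 - u 1 0 * v 0 0.

Lemma bracketE (p q : P1 R) : bracket p q = vbracket (hcoord p) (hcoord q).
Proof. by []. Qed.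

Lemma vbracketZ a b u v : vbracket (a *: u) (b *: v) = a * b * vbracket u v.
Proof. by rewrite /vbracket !mxE; ring. Qed.

Lemma vbracketDr u v w c : vbracket u (v + c *: w) = vbracket u v + c * vbracket u w.
Proof. by rewrite /vbracket !mxE; ring. Qed.

Lemma vbracket_mulmx (A : 'M[F]_2) u v : vbracket (A *m u) (A *m v) = \det A * vbracket u v.
Proof. by rewrite /vbracket !mulmx2 det2; ring. Qed.

(** Bilinear form expressing that A maps the point of index j to the image by B
    of the point of index k. *)
Definition bracket_form (A : 'M[F]_2) j (B : 'M[F]_2) k : hpoly R J :=
  lin A j 0 * lin B k 1 - lin A j 1 * lin B k 0.

Lemma hev_bracket_form h A j B k : hev h (bracket_form A j B k) = vbracket (A *m h j) (B *m h k).
Proof. by rewrite /bracket_form hevB !hevM !hev_lin. Qed.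

Lemma mhom_bracket_form A j B k : mhom (fun i => (i == j) + (i == k))%N (bracket_form A j B k).
Proof. by apply: mhomB; apply: mhomM; apply: mhom_lin. Qed.
#[global] Arguments mhom_bracket_form : clear implicits.

(** Linear form in the coordinates of index j that vanishes exactly at b. *)
Definition point_form j (b : P1 R) : hpoly R J :=
  hcoord b 1 0 *: 'X_(hvar j 0) - hcoord b 0 0 *: 'X_(hvar j 1).

Lemma hev_point_form h j b : hev h (point_form j b) = vbracket (h j) (hcoord b).
Proof. by rewrite /point_form hevB !hevZ !hevX /vbracket; ring. Qed.

Lemma mhom_point_form j b : mhom (fun i => (i == j) : nat) (point_form j b).
Proof. by apply: mhomB; apply: mhomZ; apply: mhomX. Qed.
#[global] Arguments mhom_point_form : clear implicits.

End Multihomogeneous.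

Section Zariski.
Variables (R : realType) (J : finType).
Local Notation F := R[i].
Implicit Types (A B : set (J -> P1 R)) (p : J -> P1 R).

Lemma zclosed_family (I : finType) (f : I -> hpoly R J) :
  (forall i, multihomogeneous (f i)) ->
  zclosed [set p | forall i, heval p (f i) = 0].
Proof.
move=> hf; exists [seq f i | i <- enum I].
  by move=> g /mapP[i _ ->].
rewrite predeqE => p; split=> [h g /mapP[i _ ->] //|h i].
by apply: h; apply: map_f; rewrite mem_enum.
Qed.

Lemma zclosed0 : zclosed (set0 : set (J -> P1 R)).
Proof.
exists [:: 1%:MP].
  by move=> f; rewrite inE => /eqP ->; apply: mhomP (mhomC _).
rewrite predeqE => p; split=> // /(_ _ (mem_head _ _)).
by rewrite /heval mevalC => /eqP; rewrite oner_eq0.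
Qed.

(** Unions are cut out by the pairwise products of the equations. *)
Lemma zclosedU A B : zclosed A -> zclosed B -> zclosed (A `|` B).
Proof.
move=> [s hs ->] [t ht ->]; exists [seq f * g | f <- s, g <- t].
  move=> _ /allpairsP[[f g] [/= /hs[d hd] /ht[e he] ->]].
  exact: mhomP (mhomM hd he).
rewrite predeqE => p; split.
  case=> h _ /allpairsP[[f g] [/= fs gt ->]]; rewrite /heval mevalM.
    by rewrite -/(heval p f) h ?mul0r.
  by rewrite -/(heval p g) h ?mulr0.
move=> h; apply: contrapT => /not_orP[/existsNP[f /not_implyP[fs f0]]].
move=> /existsNP[g /not_implyP[gt g0]].
have /eqP := h _ (allpairs_f (fun f g => f * g) fs gt).
by rewrite /heval mevalM mulf_eq0 => /orP[/eqP/f0|/eqP/g0].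
Qed.

Lemma zclosed_bigU (I : eqType) (s : seq I) (A : I -> set (J -> P1 R)) :
  (forall i, i \in s -> zclosed (A i)) ->
  zclosed [set p | exists2 i, i \in s & A i p].
Proof.
elim: s => [|i s IH] hA.
  have -> : [set p | exists2 i, i \in [::] & A i p] = set0; last exact: zclosed0.
  by rewrite predeqE => p; split=> // -[].
have -> : [set p | exists2 j, j \in i :: s & A j p]
    = A i `|` [set p | exists2 j, j \in s & A j p].
  rewrite predeqE => p; split=> [[j]|[Ai|[j js Aj]]].
  - by rewrite inE => /orP[/eqP->|js] Aj; [left|right; exists j].
  - by exists i; rewrite ?inE ?eqxx.
  by exists j; rewrite // inE js orbT.
apply: zclosedU; first by apply: hA; rewrite inE eqxx.
by apply: IH => j js; apply: hA; rewrite inE js orbT.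
Qed.

End Zariski.

(** * Parametrized rational curves *)

Section Param.
Variables (R : realType) (J : finType).
Local Notation F := R[i].
Implicit Types (f g : hpoly R J) (A B : set (J -> P1 R)) (p : J -> P1 R).
Implicit Types (rho : J -> P1 R + 'M[F]_2) (u v : 'cV[F]_2).

(** Such a family describes a map from the projective line to the product, each
    coordinate being a constant or a Moebius transformation. *)
Definition units rho := forall j M, rho j = inr M -> M \in unitmx.

Definition param rho (t : P1 R) : J -> P1 R :=
  fun j => match rho j with inl b => b | inr M => mobius M t end.

(** Lift of [param] to the cones, where it is linear in u up to constants. *)
Definition vparam rho u : J -> 'cV[F]_2 :=
  fun j => match rho j with inl b => hcoord b | inr M => M *m u end.

Lemma vparamP rho u : units rho -> u != 0 ->
  exists2 l : J -> F, forall j, l j != 0 &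
    forall j, vparam rho u j = l j *: hcoord (param rho (of_hcoord u) j).
Proof.
move=> urho u0; have h j : exists k : F, k != 0 /\
    vparam rho u j = k *: hcoord (param rho (of_hcoord u) j).
  rewrite /vparam /param; case e: (rho j) => [b|M].
    by exists 1; rewrite oner_neq0 scale1r.
  have uM := urho _ _ e; have [k k0 eu] := of_hcoordP u0.
  have [l l0 eM] := hcoord_mobius (of_hcoord u) uM.
  by exists (k * l); rewrite mulf_neq0 // {1}eu -scalemxAr eM scalerA.
by have [l lP] := choice h; exists l => j; case: (lP j).
Qed.

Lemma hev_vparam rho u f : units rho -> u != 0 -> multihomogeneous f ->
  (hev (vparam rho u) f == 0) = (heval (param rho (of_hcoord u)) f == 0).
Proof.
move=> urho u0 [d hd]; have [l l0 hl] := vparamP urho u0.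
rewrite (_ : vparam rho u = fun j => l j *: hcoord (param rho (of_hcoord u) j)).
  rewrite (hev_scale _ _ hd) hevalE mulf_eq0.
  suff /negPf -> : \prod_j l j ^+ d j != 0 by [].
  by apply/prodf_neq0 => j _; rewrite expf_neq0.
exact: funext.
Qed.

(** Restriction of a multihomogeneous polynomial to a polynomial path in the
    cone over the product of projective lines. *)
Definition path_eval (L : J -> 'I_2 -> {poly F}) f : {poly F} :=
  path_subst (fun i => L (enum_val i).1 (enum_val i).2) f.

Lemma horner_path_eval L f x : (path_eval L f).[x] = hev (fun j => \col_k (L j k).[x]) f.
Proof. by rewrite /path_eval horner_path_subst; apply: meval_eq => i; rewrite mxE. Qed.

(** Lift of the line through u and v. *)
Definition ppath rho u v (j : J) (k : 'I_2) : {poly F} :=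
  match rho j with
  | inl b => (hcoord b k 0)%:P
  | inr M => ((M *m u) k 0)%:P + ((M *m v) k 0)%:P * 'X
  end.

Lemma horner_ppath rho u v f x :
  (path_eval (ppath rho u v) f).[x] = hev (vparam rho (u + x *: v)) f.
Proof.
rewrite horner_path_eval; congr (hev _ f); apply: funext => j; apply/colP => k.
rewrite mxE /ppath /vparam; case: (rho j) => [b|M]; first by rewrite hornerC.
rewrite hornerD hornerM !hornerC hornerX mulmxDr -scalemxAr !mxE; ring.
Qed.

Definition hinf : 'cV[F]_2 := hcoord None.
Definition hzero : 'cV[F]_2 := hcoord (Some 0).

Lemma hcoord_line (z : F) : hzero + z *: hinf = hcoord (Some z).
Proof. by apply: cV2P; rewrite !mxE /= ?mulr1 ?mulr0 ?add0r ?addr0. Qed.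

(** The pullback of f to the line is a polynomial with infinitely many roots.
    The parameter at infinity is reached by the other affine chart. *)
Lemma param_cofin rho f : units rho -> multihomogeneous f ->
  cofin (fun a => heval (param rho (Some a)) f = 0) ->
  forall t, heval (param rho t) f = 0.
Proof.
move=> urho hf h.
have E a : heval (param rho (Some a)) f = 0 <-> (path_eval (ppath rho hzero hinf) f).[a] = 0.
  rewrite horner_ppath hcoord_line -[X in param rho X](hcoordK (Some a)).
  by split=> /eqP H; apply/eqP; move: H; rewrite hev_vparam ?hcoord_neq0.
have z1 a : heval (param rho (Some a)) f = 0.
  apply/E; have /cofin_eq0 -> : cofin (fun a => (path_eval (ppath rho hzero hinf) f).[a] = 0).
    by apply: cofin_sub h => b /E.
  by rewrite horner0.
case=> [a|]; first exact: z1.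
(* In the chart at infinity, the parameter x stands for 1 / x. *)
have : path_eval (ppath rho hinf hzero) f = 0.
  apply: cofin_eq0; apply: cofin_sub (@cofin_neq _ 0) => x x0.
  rewrite horner_ppath; apply/eqP.
  have -> : hinf + x *: hzero = x *: hcoord (Some x^-1).
    by apply: cV2P; rewrite !mxE /= ?mulr1 ?mulr0 ?addr0 ?add0r // mulfV.
  rewrite hev_vparam ?scaler_eq0 ?negb_or ?x0 ?hcoord_neq0 //.
  by rewrite of_hcoordZ // hcoordK z1.
move/(congr1 (fun q : {poly F} => q.[0])); rewrite horner0 horner_ppath scale0r addr0.
by move/eqP; rewrite hev_vparam ?hcoord_neq0 // hcoordK => /eqP.
Qed.

(** The pullback of an equation of A is zero or has finitely many roots. *)
Lemma param_dichotomy rho A : units rho -> zclosed A ->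
  (forall t, A (param rho t)) \/ cofin (fun a => ~ A (param rho (Some a))).
Proof.
move=> urho [s hs ->].
have [h|/existsNP[f /not_implyP[fs nf]]] :=
    EM (forall f, f \in s -> forall t, heval (param rho t) f = 0).
  by left=> t f /h.
right; have [d hd] := hs f fs.
pose g := path_eval (ppath rho hzero hinf) f.
have E a : (heval (param rho (Some a)) f == 0) = (g.[a] == 0).
  rewrite horner_ppath hcoord_line hev_vparam ?hcoord_neq0 ?hcoordK //.
  exact: hs.
have g0 : g != 0.
  apply/eqP => g0; apply: nf; apply: param_cofin => //; first exact: hs.
  by apply: cofin_true => a; apply/eqP; rewrite E g0 horner0.
by exists g => // a; rewrite -E => /eqP na /(_ f fs).
Qed.

Lemma param_closure rho A : units rho -> zclosed A ->
  cofin (fun a => A (param rho (Some a))) -> forall t, A (param rho t).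
Proof.
move=> urho cA h; have [//|/(cofin_and h)/cofin_inh[a []] //] := param_dichotomy urho cA.
Qed.

Definition pcurve rho : set (J -> P1 R) := [set p | exists t, p = param rho t].

(** All nonconstant coordinates must come from the same parameter. *)
Definition pcurve_eq rho (i : J * J) : hpoly R J :=
  match rho i.1, rho i.2 with
  | inl b, _ => point_form i.1 b
  | inr M, inl b => point_form i.2 b
  | inr M, inr N => bracket_form (invmx M) i.1 (invmx N) i.2
  end.

Lemma mhom_pcurve_eq rho i : multihomogeneous (pcurve_eq rho i).
Proof.
rewrite /pcurve_eq; case: (rho i.1) => [b|M]; first exact: mhomP (mhom_point_form _ _).
case: (rho i.2) => [b|N]; first exact: mhomP (mhom_point_form _ _).
exact: mhomP (mhom_bracket_form _ _ _ _).
Qed.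

Lemma heval_point_form p j b : (heval p (point_form j b) == 0) = (p j == b).
Proof. by rewrite hevalE hev_point_form -bracketE bracket_eq0. Qed.

Lemma heval_bracket_form p j k (M N : 'M[F]_2) : M \in unitmx -> N \in unitmx ->
  (heval p (bracket_form M j N k) == 0) = (mobius M (p j) == mobius N (p k)).
Proof.
move=> uM uN; rewrite hevalE hev_bracket_form.
have [a a0 ->] := hcoord_mobius (p j) uM; have [b b0 ->] := hcoord_mobius (p k) uN.
by rewrite vbracketZ !mulf_eq0 (negPf a0) (negPf b0) -bracketE bracket_eq0.
Qed.

Lemma pcurveE rho : units rho ->
  pcurve rho = [set p | forall i, heval p (pcurve_eq rho i) = 0].
Proof.
move=> urho; rewrite predeqE => p; split=> [[t ->] i|h].
  rewrite /pcurve_eq; case e1: (rho i.1) => [b|M].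
    by apply/eqP; rewrite heval_point_form /param e1.
  case e2: (rho i.2) => [b|N]; first by apply/eqP; rewrite heval_point_form /param e2.
  have uM := urho _ _ e1; have uN := urho _ _ e2; apply/eqP.
  by rewrite heval_bracket_form ?unitmx_inv // /param e1 e2 !mobiusK.
have hc j b : rho j = inl b -> p j = b.
  move=> e; have /eqP := h (j, j); rewrite /pcurve_eq /= e heval_point_form.
  by move/eqP.
have [[j0 [M0 e0]]|none] := EM (exists j M, rho j = inr M).
  exists (mobius (invmx M0) (p j0)); apply: funext => j; rewrite /param.
  case e: (rho j) => [b|M]; first exact: hc.
  have uM := urho _ _ e; have uM0 := urho _ _ e0.
  have /eqP := h (j0, j); rewrite /pcurve_eq /= e0 e heval_bracket_form ?unitmx_inv //.
  by move=> /eqP ->; rewrite mobiusVK.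
exists None; apply: funext => j; rewrite /param.
case e: (rho j) => [b|M]; first exact: hc.
by case: none; exists j, M.
Qed.

Lemma zclosed_pcurve rho : units rho -> zclosed (pcurve rho).
Proof.
move=> urho; rewrite pcurveE //.
by apply: (@zclosed_family _ _ (J * J)%type) => i; apply: mhom_pcurve_eq.
Qed.

(** A point is a parametrized curve with constant coordinates. *)
Lemma zclosed_point p : zclosed [set p].
Proof.
have -> : [set p] = pcurve (fun j => inl (p j)).
  by rewrite predeqE => q; split=> [->|[t ->] //]; exists None; apply: funext.
by apply: zclosed_pcurve => j M.
Qed.

Lemma zclosed_seq (s : seq (J -> P1 R)) : zclosed [set p | p \in s].
Proof.
have -> : [set p | p \in s] = [set p | exists2 q, q \in s & [set q] p].
  by rewrite predeqE => p; split=> [ps|[q qs ->] //]; exists p.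
by apply: zclosed_bigU => q _; apply: zclosed_point.
Qed.

Lemma zirreducible_point p : zirreducible [set p].
Proof.
split; first by exists p.
move=> B D _ _ /(_ p erefl) [Bp|Dp]; [left|right] => q -> //.
Qed.

(** Two closed sets that do not contain the curve miss almost all of its points,
    hence have a common missed point. *)
Lemma zirreducible_pcurve rho : units rho -> zirreducible (pcurve rho).
Proof.
move=> urho; split; first by exists (param rho None), None.
move=> B D cB cD sub.
have [hB|nB] := param_dichotomy urho cB; first by left=> p [t ->].
have [hD|nD] := param_dichotomy urho cD; first by right=> p [t ->].
have [a [nBa nDa]] := cofin_inh (cofin_and nB nD).
by have [/nBa|/nDa] := sub _ (ex_intro _ (Some a) erefl).
Qed.

Lemma irreducible_seq A (s : seq (J -> P1 R)) :
  zirreducible A -> A `<=` [set p | p \in s] -> exists p, A `<=` [set p].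
Proof.
move=> irrA; elim: s => [|p s IH] sub.
  by case: irrA => [[p /sub]].
have [_ /(_ [set p] [set q | q \in s])[]//] := irrA.
- exact: zclosed_point.
- exact: zclosed_seq.
- by move=> q /sub /=; rewrite inE => /orP[/eqP->|]; [left|right].
by exists p.
Qed.

(** The proper closed subsets of a parametrized curve are finite. *)
Lemma pcurve_closed_subset rho A : units rho -> zclosed A -> A `<=` pcurve rho ->
  pcurve rho `<=` A \/ exists s : seq (J -> P1 R), A `<=` [set p | p \in s].
Proof.
move=> urho cA sub; have [h|[g g0 gP]] := param_dichotomy urho cA.
  by left=> p [t ->].
right; have [s hs] := closed_field_poly_normal g.
exists (param rho None :: [seq param rho (Some a) | a <- s]) => p Ap.
have [[a|] ep] := sub p Ap; last by rewrite /= inE ep eqxx.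
rewrite /= inE ep; apply/orP; right; apply: map_f.
apply: contrapT => nas; apply: (gP a); last by rewrite -ep.
rewrite hs hornerZ mulf_neq0 ?lead_coef_eq0 // -rootE root_prod_XsubC.
exact/negP.
Qed.

End Param.

(** * Tangent vectors, and smoothness of the parametrized curves *)

Section Tangent.
Variables (R : realType) (J : finType).
Local Notation F := R[i].
Implicit Types (f g : hpoly R J) (A B : set (J -> P1 R)) (p : J -> P1 R).
Implicit Types (rho : J -> P1 R + 'M[F]_2) (u v : 'cV[F]_2).

(** The homogeneous coordinate that is normalized to 1 at x. *)
Definition other (x : P1 R) : 'I_2 := if x is Some _ then 1 else 0.

Lemma hcoord_other (x : P1 R) : hcoord x (other x) 0 = 1.
Proof. by case: x => [z|]; rewrite mxE. Qed.

Lemma colZE (c : F) u k : (c *: u) k 0 = c * u k 0.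
Proof. by rewrite mxE. Qed.

Lemma colDE u v k : (u + v) k 0 = u k 0 + v k 0.
Proof. by rewrite mxE. Qed.

Lemma sum_chart (x : P1 R) (V : nmodType) (G : 'I_2 -> V) :
  G (other x) = 0 -> G 0 + G 1 = G (chart x).
Proof. by case: x => [z|] /= ->; rewrite ?addr0 ?add0r. Qed.

Lemma deriv_path_eval (L : J -> 'I_2 -> {poly F}) p f :
  (forall j k, (L j k).[0] = hcoord (p j) k 0) ->
  (path_eval L f)^`().[0] =
  \sum_j (heval p (mderiv (hvar j 0) f) * (L j 0)^`().[0] +
          heval p (mderiv (hvar j 1) f) * (L j 1)^`().[0]).
Proof.
move=> L0; rewrite /path_eval deriv_path_subst horner_sum sum_hvar; apply: eq_bigr => j _.
have H g : (path_subst (fun i => L (enum_val i).1 (enum_val i).2) g).[0] = heval p g.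
  by rewrite horner_path_subst; apply: meval_eq => i; exact: L0.
by congr (_ + _); rewrite hornerM; congr (_ * _); rewrite ?H //
  (enum_rankK (j, _)).
Qed.

(** A path in the cone over A whose normalized coordinates are stationary at
    time 0 has a velocity tangent to A, by the chain rule. *)
Lemma tangent_path A p (L : J -> 'I_2 -> {poly F}) :
  (forall j k, (L j k).[0] = hcoord (p j) k 0) ->
  (forall x, exists2 q, A q & exists l : J -> F,
     forall j k, (L j k).[x] = l j * hcoord (q j) k 0) ->
  (forall j, (L j (other (p j)))^`().[0] = 0) ->
  tangent_space A p [ffun j => (L j (chart (p j)))^`().[0]].
Proof.
move=> L0 LA Lo f [[d hd] fA].
have pev0 : path_eval L f = 0.
  apply: poly_eq0 => x; rewrite horner_path_eval; have [q Aq [l hl]] := LA x.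
  rewrite (_ : (fun j => _) = fun j => l j *: hcoord (q j)).
    by rewrite (hev_scale _ _ hd) -hevalE fA ?mulr0.
  by apply: funext => j; apply/colP => k; rewrite !mxE hl mxE.
have := deriv_path_eval f L0; rewrite pev0 derivC horner0 => /esym e.
rewrite -[RHS]e; apply: eq_bigr => j _; rewrite ffunE.
rewrite (@sum_chart (p j) _ (fun k => heval p (mderiv (hvar j k) f) * (L j k)^`().[0])) //.
by rewrite (Lo j) mulr0.
Qed.

Lemma vbracket_delta_chart (x : P1 R) : vbracket (hcoord x) (delta_mx (chart x) 0) != 0.
Proof.
case: x => [z|]; rewrite /vbracket !mxE /= ?mulr0 ?mulr1 ?sub0r ?subr0.
  by rewrite oppr_eq0 oner_eq0.
by rewrite oner_eq0.
Qed.

(** Passing to the affine chart at x costs a multiple of x, which the bracket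
    with x does not see. *)
Lemma vbracket_chart (x : P1 R) v :
  v (chart x) 0 - v (other x) 0 * hcoord x (chart x) 0 =
  (if x is Some _ then - 1 else 1) * vbracket (hcoord x) v.
Proof. by case: x => [z|]; rewrite /vbracket !mxE /=; ring. Qed.

(** Velocity of the parametrized curve: it moves exactly the nonconstant
    coordinates, as Moebius transformations have no critical points. *)
Lemma tangent_pcurve rho A (t : P1 R) : units rho -> (forall s, A (param rho s)) ->
  exists v : {ffun J -> F^o}, [/\ tangent_space A (param rho t) v,
    forall j b, rho j = inl b -> v j = 0 &
    forall j M, rho j = inr M -> v j != 0].
Proof.
move=> urho sub; set p := param rho t.
pose h0 := hcoord t; pose h1 : 'cV[F]_2 := if t is Some _ then hinf R else hzero R.
have b01 : vbracket h0 h1 != 0.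
  by rewrite /h0 /h1 /hinf /hzero; case: (t) => [z|]; rewrite -bracketE bracket_eq0.
have h0n x : h0 + x *: h1 != 0.
  apply: contraNneq b01 => e; have -> : h0 = - x *: h1.
    by apply/eqP; rewrite scaleNr -addr_eq0 e.
  by rewrite -[h1 in X in vbracket _ X]scale1r vbracketZ /vbracket; apply/eqP; ring.
have [l l0 hl] := vparamP urho (hcoord_neq0 t); rewrite -/h0 hcoordK -/p in hl.
pose w j : 'cV[F]_2 :=
  match rho j with inl b => 0 | inr M => (l j)^-1 *: (M *m h1) end.
(* The first factor makes the coordinate normalized to 1 stationary. *)
pose L j k : {poly F} :=
  (1 - (w j (other (p j)) 0)%:P * 'X) * ((hcoord (p j) k 0)%:P + (w j k 0)%:P * 'X).
have L0 j k : (L j k).[0] = hcoord (p j) k 0.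
  rewrite /L hornerM hornerD hornerN !hornerD !hornerM !hornerC hornerX.
  by rewrite !mulr0 subr0 addr0 mul1r.
have dL j k : (L j k)^`().[0] = w j k 0 - w j (other (p j)) 0 * hcoord (p j) k 0.
  rewrite /L derivM derivB !derivD !derivM !derivC !derivX.
  rewrite !(hornerD, hornerN, hornerM, hornerC, hornerX); ring.
exists [ffun j => (L j (chart (p j)))^`().[0]]; split.
- apply: tangent_path => // [x|j]; last by rewrite dL hcoord_other mulr1 subrr.
  exists (param rho (of_hcoord (h0 + x *: h1))); first exact: sub.
  have [m m0 hm] := vparamP urho (h0n x).
  exists (fun j => (1 - w j (other (p j)) 0 * x) * ((l j)^-1 * m j)) => j k.
  have {}hm : (l j)^-1 * m j * hcoord (param rho (of_hcoord (h0 + x *: h1)) j) k 0 =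
     (l j)^-1 * vparam rho (h0 + x *: h1) j k 0 by rewrite hm colZE mulrA.
  rewrite -mulrA hm /L hornerM !(hornerD, hornerN, hornerM, hornerC, hornerX).
  congr (_ * _).
  have := congr1 (fun u : 'cV[F]_2 => (l j)^-1 * u k 0) (hl j).
  rewrite /= colZE mulKf // => <-.
  rewrite /w /vparam; case: (rho j) => [b|M]; first by rewrite [X in _ + X * _]mxE mul0r addr0.
  by rewrite mulmxDr -scalemxAr colDE !colZE; ring.
- move=> j b e; have w0 i : w j i 0 = 0 by rewrite /w e mxE.
  by rewrite ffunE dL !w0 mul0r subr0.
move=> j M e; rewrite ffunE dL vbracket_chart mulf_neq0 //.
  by case: (p j) => [z|]; rewrite ?oppr_eq0 oner_eq0.
have := hl j; rewrite /vparam /w e => hM.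
have -> : hcoord (p j) = (l j)^-1 *: (M *m h0) by rewrite hM scalerA mulVf // scale1r.
rewrite vbracketZ vbracket_mulmx !mulf_neq0 ?invr_eq0 //.
by rewrite -unitfE -unitmxE (urho _ _ e).
Qed.

End Tangent.

Section RationalCurves.
Variables (R : realType) (E : finType).
Local Notation F := R[i].
Implicit Types (M : E -> 'M[F]_2).

Definition mcurve M : set (E -> P1 R) := pcurve (fun e => inr (M e)).

Variable M : E -> 'M[F]_2.
Hypothesis uM : forall e, M e \in unitmx.
Variable e0 : E.

Let rho (e : E) : P1 R + 'M[F]_2 := inr (M e).
Let urho : units rho.
Proof. by move=> e N [<-]. Qed.

(** A chain of length 2 would have a proper closed subset of the curve in the
    middle, which is a point since it is finite and irreducible. *)
Lemma krull_mcurve : krull_dim (mcurve M) 1.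
Proof.
split.
  exists (fun i => if i is 0%N then [set param rho None] else mcurve M); split.
    move=> [|i] _.
      split; [exact: zclosed_point | exact: zirreducible_point |].
      by move=> p ->; exists None.
    by split; [exact: zclosed_pcurve | exact: zirreducible_pcurve |].
  move=> [|i] // _; split; first by move=> p ->; exists None.
  move=> H; have : param rho (Some 0) = param rho None by apply: H; exists (Some 0).
  by move=> /(congr1 (@^~ e0))/(mobius_inj (uM e0)).
move=> [G [hG sG]].
have [c1 i1 s1] := hG 1%N isT; have [c0 i0 s0] := hG 0%N isT; have [c2 i2 s2] := hG 2%N isT.
have [s01 n10] := sG 0%N isT; have [s12 n21] := sG 1%N isT.
have [h|[s hs]] := pcurve_closed_subset urho c1 s1.
  by apply: n21 => p /s2/h.
have [p hp] := irreducible_seq i1 hs; apply: n10 => q qG1.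
have [[r rG0] _] := i0.
by rewrite (hp q qG1) -(hp r (s01 _ rG0)).
Qed.

Lemma zconnected_mcurve : zconnected (mcurve M).
Proof.
have [ne irr] := zirreducible_pcurve urho; split=> // B D cB cD e BD.
have [s|s] : mcurve M `<=` B \/ mcurve M `<=` D by apply: irr => //; rewrite -e.
  right; rewrite predeqE => p; split=> // Dp.
  by rewrite -BD; split=> //; apply: s; rewrite e; right.
left; rewrite predeqE => p; split=> // Bp.
by rewrite -BD; split=> //; apply: s; rewrite e; left.
Qed.

(** The bilinear equation relating the coordinates e0 and k of the curve: its
    differential is a linear relation between the corresponding coordinates of
    v in which the coefficient of v k does not vanish. *)
Lemma tangent_mcurve_det (t : P1 R) (v : {ffun E -> F^o}) k :
  tangent_space (mcurve M) (param rho t) v -> v e0 = 0 -> v k = 0.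
Proof.
move=> hv v0; have [->//|ke] := eqVneq k e0.
set p := param rho t in hv.
pose N := invmx (M k); pose f := bracket_form (invmx (M e0)) e0 N k : hpoly R E.
have uN : N \in unitmx by rewrite unitmx_inv.
have uM0 : invmx (M e0) \in unitmx by rewrite unitmx_inv.
(* f is restricted to the line through p with direction v. *)
pose d j : 'cV[F]_2 := v j *: delta_mx (chart (p j)) 0.
pose L j i : {poly F} := (hcoord (p j) i 0)%:P + (d j i 0)%:P * 'X.
have L0 j i : (L j i).[0] = hcoord (p j) i 0.
  by rewrite /L hornerD hornerM !hornerC hornerX mulr0 addr0.
have fA : vanishing (mcurve M) f.
  split=> [|_ [s ->]]; first exact: mhomP (mhom_bracket_form _ _ _ _).
  apply/eqP; rewrite (heval_bracket_form _ _ _ uM0 uN); apply/eqP.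
  by rewrite /param /= (mobiusK (uM e0)) (mobiusK (uM k)).
have := deriv_path_eval f L0.
rewrite (eq_bigr (fun j => heval p (mderiv (hvar j (chart (p j))) f) * v j)); last first.
  move=> j _.
  have dL i : (L j i)^`().[0] = v j * (i == chart (p j))%:R.
    rewrite /L derivD derivM !derivC derivX mul0r !add0r mulr1 hornerC /d !mxE.
    by rewrite andbT.
  rewrite (@sum_chart _ (p j) _ (fun k => heval p (mderiv (hvar j k) f) * (L j k)^`().[0])).
    by rewrite dL eqxx mulr1.
  by rewrite dL; case: (p j) => [z|]; rewrite !mulr0.
rewrite (hv _ fA) => df0.
pose b := vbracket (invmx (M e0) *m hcoord (p e0)) (N *m delta_mx (chart (p k)) 0).
have eL : path_eval L f = (v k * b) *: 'X.
  apply/eqP; rewrite -subr_eq0; apply/eqP/poly_eq0 => x.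
  rewrite hornerD hornerN hornerZ hornerX horner_path_eval.
  have -> : (fun j => \col_i (L j i).[x]) =
      (fun j => hcoord (p j) + (x * v j) *: delta_mx (chart (p j)) 0).
    apply: funext => j; apply/colP => i; rewrite /L /d !mxE /=.
    by rewrite hornerD hornerM !hornerC hornerX mulrC -mulrA mulrA.
  rewrite /f hev_bracket_form v0 mulr0 scale0r addr0 mulmxDr -scalemxAr.
  have : vbracket (invmx (M e0) *m hcoord (p e0)) (N *m hcoord (p k)) = 0.
    by have := fA.2 p (ex_intro _ t erefl); rewrite hevalE hev_bracket_form.
  rewrite /b; set a := invmx _ *m _; set c := N *m _; set c' := N *m _.
  by rewrite vbracketDr => ->; ring.
move: df0; rewrite eL derivZ derivX hornerZ hornerC mulr1 => /eqP.
rewrite mulf_eq0 => /orP[/eqP //|]; apply: contraTeq => _; rewrite /b.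
have [c c0 ->] := hcoord_mobius (p e0) uM0; have [c' c'0 ec'] := hcoord_mobius (p k) uN.
have -> : mobius (invmx (M e0)) (p e0) = mobius N (p k).
  by rewrite /p /param /N /= (mobiusK (uM e0)) (mobiusK (uM k)).
have -> : hcoord (mobius N (p k)) = c'^-1 *: (N *m hcoord (p k)).
  by rewrite ec' scalerA mulVf // scale1r.
rewrite scalerA -[N *m delta_mx _ _]scale1r vbracketZ vbracket_mulmx; apply: mulf_neq0.
  by rewrite mulr1 mulf_neq0 // invr_eq0.
by rewrite mulf_neq0 ?vbracket_delta_chart //; move: uN; rewrite unitmxE unitfE.
Qed.

(** The tangent space contains the velocity of the parametrization, and a
    tangent vector is determined by its coordinate e0. *)
Lemma smooth_mcurve : smooth_of_dim (mcurve M) 1.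
Proof.
move=> _ [t ->].
have sub s : mcurve M (param rho s) by exists s.
have [u [hu _ uinr]] := tangent_pcurve t urho sub.
have u0 : u e0 != 0 by exact: uinr.
exists <[u]>%VS; last first.
  by rewrite dim_vline; apply/eqP; rewrite eqb1; apply: contra u0 => /eqP ->; rewrite ffunE.
rewrite predeqE => v; split=> [hv|/vlineP[c ->] f fA]; last first.
  have := hu f fA; move/(congr1 (fun z => c * z)); rewrite mulr0 mulr_sumr; apply: etrans.
  by apply: eq_bigr => j _; rewrite ffunE /= mulrCA.
apply/vlineP; exists (v e0 / u e0); apply/ffunP => k; rewrite !ffunE /=.
apply/eqP; rewrite -subr_eq0.
pose w : {ffun E -> F^o} := [ffun j => v j - (v e0 / u e0) * u j].
have ew j : w j = v j - v e0 / u e0 * u j by rewrite ffunE.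
have w0 : w e0 = 0 by rewrite ew divfK // subrr.
suff hw : tangent_space (mcurve M) (param rho t) w.
  by have := tangent_mcurve_det k hw w0; rewrite ew => /eqP.
move=> f fA; have := hu f fA; move/(congr1 (fun z => (v e0 / u e0) * z)).
rewrite mulr0 mulr_sumr => hu'; apply: (@etrans _ _ (0 - 0)); last exact: subr0.
rewrite -[in X in _ = X - _](hv f fA) -[in X in _ = _ - X]hu' -sumrB.
by apply: eq_bigr => j _; rewrite ew mulrBr; congr (_ - _); rewrite mulrCA.
Qed.

Lemma degree_mcurve e : projection_degree (mcurve M) e 1.
Proof.
exists setT; split=> [||a _].
- by rewrite /zopen setCT; exact: zclosed0.
- by exists (fun=> None).
have -> : [set p | mcurve M p /\ p e = a tt] = [set param rho (mobius (invmx (M e)) (a tt))].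
  rewrite predeqE => p; split=> [[[t ->] /= <-]|->]; first by rewrite /param /= mobiusK.
  by split; [eexists | rewrite /param /= mobiusVK].
exact: card_set1.
Qed.

Lemma curves_mcurve : curves (mcurve M).
Proof.
split; [exact: zclosed_pcurve | exact: zconnected_mcurve | exact: krull_mcurve |
  exact: smooth_mcurve | exact: degree_mcurve].
Qed.

End RationalCurves.

(** * Injective rational functions have degree one *)

Section Degree.
Variable F : numClosedFieldType.
Implicit Types N D : {poly F}.

(** Numerator of the derivative of the fraction N / D. *)
Definition wronskian N D := N^`() * D - N * D^`().

Lemma deriv_eq0 (p : {poly F}) : p^`() = 0 -> (size p <= 1)%N.
Proof.
move=> dp; rewrite leqNgt; apply/negP => sp.
have : lead_coef p != 0 by rewrite lead_coef_eq0 -size_poly_gt0 (ltn_trans _ sp).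
rewrite lead_coefE; case: (size p) sp => [|[|k]] // _ /= /negP; apply.
have := congr1 (fun q : {poly F} => q`_k) dp.
by rewrite coef_deriv coef0 => /eqP; rewrite mulrn_eq0.
Qed.

(** By coprimality N divides its derivative, and so does D. *)
Lemma wronskian_eq0 N D : coprimep N D -> wronskian N D = 0 ->
  (size N <= 1)%N /\ (size D <= 1)%N.
Proof.
move=> cND /eqP; rewrite subr_eq0 => /eqP W0.
have dv (p : {poly F}) : p %| p^`() -> (size p <= 1)%N.
  have [->|p0] := eqVneq p 0; first by rewrite size_poly0.
  move=> pd; apply: deriv_eq0; apply/eqP; apply: contraT => d0.
  by have := dvdp_leq d0 pd; rewrite leqNgt lt_size_deriv.
split; apply: dv.
  by rewrite -(Gauss_dvdpl _ cND) W0 dvdp_mulr.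
by rewrite coprimep_sym in cND; rewrite -(Gauss_dvdpr _ cND) -W0 dvdp_mull.
Qed.

(** For general b the polynomial N - b D has the degree of the fraction, only
    roots at which injectivity applies, hence one root, and this root is simple
    because the derivative of the fraction does not vanish there.  So the degree
    is 1, unless the derivative vanishes identically. *)
Lemma coprime_injective_degree N D (A B : F -> Prop) :
  coprimep N D -> cofin A -> cofin B ->
  (forall b, B b -> forall a a', A a -> A a' ->
     N.[a] = b * D.[a] -> N.[a'] = b * D.[a'] -> a = a') ->
  (size N <= 1)%N /\ (size D <= 1)%N \/
  [/\ (size N <= 2)%N, (size D <= 2)%N & N`_1 * D`_0 - N`_0 * D`_1 != 0].
Proof.
move=> cND [gA gA0 hA] cB inj.
have [/(wronskian_eq0 cND)|W0] := eqVneq (wronskian N D) 0; first by left.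
right; pose k := maxn (size N) (size D).
have lin0 (u v : F) : v != 0 \/ u != 0 -> cofin (fun b => u != b * v).
  move=> uv; exists (u%:P - v *: 'X) => [|b].
    have [v0|v0] := eqVneq v 0.
      by rewrite v0 scale0r subr0 polyC_eq0; case: uv => //; rewrite v0 eqxx.
    apply: contraNneq v0 => /(congr1 (fun q : {poly F} => q`_1)).
    by rewrite coefB coefC coefZ coefX coef0 mulr1 sub0r => /eqP; rewrite oppr_eq0.
  by rewrite hornerD hornerN hornerZ hornerC hornerX mulrC subr_eq0.
(* N and D have no common root, so each a is a root of N - b D for at most one b. *)
have cross a : cofin (fun b => N.[a] != b * D.[a]).
  apply: lin0; have [Na|Na] := eqVneq N.[a] 0; last by right.
  by left; apply: coprimep_root cND _; apply/rootP.
have lead : cofin (fun b => N`_k.-1 != b * D`_k.-1).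
  apply: lin0; have [sz|sz] := leqP (size N) (size D).
    left; rewrite /k (maxn_idPr sz) -lead_coefE lead_coef_eq0.
    apply: contraNneq W0 => D0; move: sz; rewrite D0 size_poly0 leqn0 size_poly_eq0.
    by move=> /eqP ->; rewrite /wronskian mulr0 mul0r subrr.
  right; rewrite /k (maxn_idPl (ltnW sz)) -lead_coefE lead_coef_eq0.
  by apply: contraTneq sz => ->; rewrite size_poly0.
have [s hs] := closed_field_poly_normal (gA * wronskian N D).
have [b [[Bb lb] hb]] := cofin_inh (cofin_and (cofin_and cB lead)
  (cofin_all (fun i : 'I_(size s) => cross s`_i))).
(* b is not a value of the fraction at an exceptional or critical point. *)
have good a : N.[a] = b * D.[a] -> gA.[a] != 0 /\ (wronskian N D).[a] != 0.
  move=> e; apply/andP; rewrite -negb_or -mulf_eq0 -hornerM hs hornerZ mulf_eq0 negb_or.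
  rewrite lead_coef_eq0 mulf_neq0 //= -rootE root_prod_XsubC.
  apply/negP => /(nthP 0)[i si ia]; have := hb (Ordinal si).
  by rewrite /= ia e eqxx.
pose Q := N - b *: D.
have QE a : root Q a = (N.[a] == b * D.[a]).
  by rewrite rootE /Q hornerD hornerN hornerZ subr_eq0.
have k2 : (1 < k)%N.
  rewrite ltnNge geq_max; apply: contra W0 => /andP[/size1_polyC -> /size1_polyC ->].
  by rewrite /wronskian !derivC mul0r mulr0 subrr.
have sQ : size Q = k.
  apply/eqP; rewrite eqn_leq; apply/andP; split.
    rewrite (leq_trans (size_polyD _ _)) // size_polyN geq_max leq_maxl /=.
    by rewrite (leq_trans (size_scale_leq _ _)) // leq_maxr.
  rewrite -[k in (k <= _)%N](prednK (ltnW k2)) ltnNge; apply/negP => sQ.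
  by have := nth_default 0 sQ; move/eqP; rewrite coefB coefZ subr_eq0 (negPf lb).
have [r rQ] : exists r, root Q r by apply/closed_rootP; rewrite sQ gtn_eqF.
have Nr : N.[r] = b * D.[r] by apply/eqP; rewrite -QE.
have [gr Wr] := good r Nr.
have sQ2 : size Q = 2%N.
  apply: (size_unique_simple_root rQ) => [y|].
    rewrite QE => /eqP Ny; have [gy _] := good y Ny.
    by apply: (inj b) => //; apply: hA.
  apply: contra Wr; rewrite derivB derivZ hornerD hornerN hornerZ subr_eq0 => /eqP e.
  by rewrite /wronskian hornerD hornerN !hornerM e Nr; apply/eqP; ring.
rewrite sQ in sQ2; have sN : (size N <= 2)%N by rewrite -sQ2 leq_maxl.
have sD : (size D <= 2)%N by rewrite -sQ2 leq_maxr.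
have lin2 (p : {poly F}) : (size p <= 2)%N -> p = p`_1 *: 'X + (p`_0)%:P.
  move=> sp; apply/polyP => -[|[|i]]; rewrite coefD coefZ coefX coefC /=.
  - by rewrite mulr0 add0r.
  - by rewrite mulr1 addr0.
  by rewrite mulr0 addr0 nth_default // (leq_trans sp).
have W2 n1 n0 d1 d0 :
    (wronskian (n1 *: 'X + n0%:P) (d1 *: 'X + d0%:P)).[r] = n1 * d0 - n0 * d1.
  rewrite /wronskian !derivD !derivZ derivX !derivC !addr0.
  by rewrite !(hornerD, hornerN, hornerM, hornerZ, hornerX, hornerC); ring.
split=> //; apply: contra Wr => /eqP e.
by rewrite (lin2 N sN) (lin2 D sD) W2 e.
Qed.

End Degree.

(** * Curves of multidegree one are parametrized *)

Section DefinableClosed.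
Variables (R : realType) (E : finType).
Local Notation F := R[i].
Implicit Types (C : set (E -> P1 R)).

(** Points with prescribed infinite coordinates, parametrized by the finite
    ones: definable sets live in affine space. *)
Definition pattern (W : {set E}) (x : E -> F) : E -> P1 R :=
  fun e => if e \in W then None else Some (x e).

Lemma polyfun_hcoord_pattern W (x : (nat -> F) -> E -> F) e k :
  (forall e, polyfun (fun v => x v e)) ->
  polyfun (fun v => hcoord (pattern W (x v) e) k 0).
Proof.
move=> px; rewrite /pattern; case: (e \in W).
  exact: polyfun_const.
under [fun _ => _]funext => v do rewrite hcoord_Some.
by case: (k == 0); [exact: px | exact: polyfun_const].
Qed.

Lemma definable_closed C W (x : (nat -> F) -> E -> F) : zclosed C ->
  (forall e, polyfun (fun v => x v e)) ->
  definable (fun v => C (pattern W (x v))).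
Proof.
move=> [s _ ->] px.
apply: (@definable_iff _ (fun v => forall i : 'I_(size s),
    heval (pattern W (x v)) s`_i = 0)).
  move=> v; split=> h; last by move=> i; apply: h; exact: mem_nth.
  by move=> f /(nthP 0)[i si <-]; exact: (h (Ordinal si)).
apply: definable_all => i; apply: definable_eq; last exact: polyfun_const.
by apply: polyfun_meval => j; exact: polyfun_hcoord_pattern.
Qed.

Let coord (v : nat -> F) (e : E) : F := v (enum_rank e).+2.

(** The coordinates of the quantified point are stored in the variables that
    follow the two free ones; its infinite coordinates are guessed by a finite
    disjunction. *)
Lemma definable_exists_point C (c : (E -> P1 R) -> F -> F -> Prop) : zclosed C ->
  (forall W, definable (fun v => c (pattern W (coord v)) (v 0%N) (v 1%N))) ->
  definable (fun v => exists p, C p /\ c p (v 0%N) (v 1%N)).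
Proof.
move=> cC dc.
have d W : definable (fun v => C (pattern W (coord v)) /\
    c (pattern W (coord v)) (v 0%N) (v 1%N)).
  by apply: definable_and => //; apply: definable_closed => // e; exact: polyfun_var.
apply: definable_iff (definable_exists (iota 2 #|E|) (definable_ex d)) => v; split.
  move=> [v' [hv' [W [CW cW]]]]; exists (pattern W (coord v')); split=> //.
  by move: cW; rewrite !hv' // mem_iota.
move=> [p [Cp cp]].
pose x e := odflt 0 (p e); pose W := [set e | p e == None]%SET.
exists (fun i => if (1 < i)%N then
  (if insub (i - 2)%N is Some k then x (enum_val (k : 'I_#|E|)) else v i) else v i).
split=> [i|].
  rewrite mem_iota; case: ltnP => //= i1 hi; case: insubP => // k hk _.
  by move: hi; rewrite -leqNgt -leq_subRL // leqNgt hk.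
exists W => /=; set q := pattern _ _.
suff -> : q = p by [].
apply: funext => e; rewrite /q /pattern /coord /= inE subn2 /= valK /=.
by rewrite enum_rankK /x; case: (p e).
Qed.

Lemma definable_coord_Some C s e : zclosed C ->
  definable (fun v => exists p, C p /\ (p s = Some (v 0%N) /\ p e = Some (v 1%N))).
Proof.
move=> cC; apply: (definable_exists_point (c := fun p a y => p s = Some a /\ p e = Some y)) => // W.
have dS u i : definable (fun v => pattern W (coord v) u = Some (v i)).
  rewrite /pattern; case: (u \in W); first by apply: definable_iff (definable_const _ False).
  have d := definable_eq (polyfun_var F (enum_rank u).+2) (polyfun_var F i).
  by apply: definable_iff d => v; split=> [/= <-|[]].
by apply: definable_and.
Qed.

Lemma definable_coord_None C s e : zclosed C ->
  definable (fun v => exists p, C p /\ (p s = Some (v 0%N) /\ p e = None)).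
Proof.
move=> cC; apply: (definable_exists_point (c := fun p a _ => p s = Some a /\ p e = None)) => // W.
apply: definable_and.
  rewrite /pattern; case: (s \in W); first by apply: definable_iff (definable_const _ False).
  have d := definable_eq (polyfun_var F (enum_rank s).+2) (polyfun_var F 0).
  by apply: definable_iff d => v; split=> [/= <-|[]].
rewrite /pattern; case: (e \in W); first by apply: definable_iff (definable_const _ True).
by apply: definable_iff (definable_const _ False).
Qed.

End DefinableClosed.

Lemma functions_into (V : finType) (T : eqType) (x0 : T) (L : seq T) :
  exists2 l : seq (V -> T), size l = (size L ^ #|V|)%N &
    forall p : V -> T, (forall v, p v \in L) -> p \in l.
Proof.
exists [seq (fun v => nth x0 L (k v)) | k : {ffun V -> 'I_(size L)}].
  by rewrite size_map -cardE card_ffun card_ord.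
move=> p pL; have iL v : (index (p v) L < size L)%N by rewrite index_mem.
apply/mapP; exists [ffun v => Ordinal (iL v)]; first by rewrite mem_enum.
by apply: funext => v; rewrite ffunE /= nth_index.
Qed.

Lemma card_eq1P (T : Type) (A : set T) : A #= `I_1 -> exists x, A = [set x].
Proof.
move=> /card_set_bijP[f [fun_f inj_f surj_f]].
have [x Ax fx] := surj_f 0%N isT; exists x; rewrite predeqE => y; split=> [Ay|->//].
apply: inj_f; rewrite ?inE // fx; move: (fun_f y Ay) => /=.
by case: (f y).
Qed.

Section Converse.
Variables (R : realType) (E : finType).
Local Notation F := R[i].
Variable C : set (E -> P1 R).
Hypothesis cC : zclosed C.

Lemma degree1_cofin s : projection_degree C s 1 ->
  cofin (fun a => exists p, [/\ C p, p s = Some a &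
    forall q, C q -> q s = Some a -> q = p]).
Proof.
move=> [U [oU [p0 Up0] UP]].
pose rho (_ : unit) : P1 R + 'M[F]_2 := inr 1%:M.
have urho : units rho by move=> j M [<-]; exact: unitmx1.
have rhoE t : param rho t = (fun=> t).
  by apply: funext => j; rewrite /param /= mobius1.
have [h|] := param_dichotomy urho oU.
  case: (h (p0 tt)); rewrite rhoE.
  by rewrite (_ : (fun=> _) = p0) //; apply: funext => -[].
apply: cofin_sub => a; rewrite rhoE => /contrapT/UP/card_eq1P[p ep].
have [Cp pa] : [set p | C p /\ p s = Some a] p by rewrite ep.
exists p; split=> // q Cq qa.
by have : [set p | C p /\ p s = Some a] q by []; rewrite ep.
Qed.

Hypothesis degC : forall s, projection_degree C s 1.

(** The point of C with coordinate a at s, when there is exactly one. *)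
Definition section_pt (s : E) (a : F) : E -> P1 R :=
  xget (fun=> None) [set p | C p /\ p s = Some a].

Lemma section_ptP s : cofin (fun a => [/\ C (section_pt s a), section_pt s a s = Some a &
  forall q, C q -> q s = Some a -> q = section_pt s a]).
Proof.
apply: cofin_sub (degree1_cofin (degC s)) => a [p [Cp pa up]].
have [Cs sa] : [set p | C p /\ p s = Some a] (section_pt s a).
  by apply: xgetPex; exists p.
by split=> // q Cq qa; rewrite (up q) // (up (section_pt s a)).
Qed.

(** Lying at infinity is a definable condition on the coordinate; otherwise the
    coordinate is a definable function with values in the affine line. *)
Lemma section_rational s e : cofin (fun a => section_pt s a e = None) \/
  exists N D : {poly F}, coprimep N D /\
    cofin (fun a => D.[a] != 0 /\ section_pt s a e = Some (N.[a] / D.[a])).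
Proof.
have dN := definable_coord_None s e cC; have dS := definable_coord_Some s e cC.
case: (definable_cofin dN) => [hN|hN]; [left|right].
  apply: cofin_sub (cofin_and (section_ptP s) hN) => a [[_ _ u] [p [Cp [/= pa pe]]]].
  by rewrite -(u p).
pose f a := odflt 0 (section_pt s a e).
have hf : cofin (fun a => section_pt s a e = Some (f a)).
  apply: cofin_sub (cofin_and (section_ptP s) hN) => a [[Cs sa _] nN].
  rewrite /f; case E1 : (section_pt s a e) => [y|] //=; case: nN; exists (section_pt s a).
  by split.
have hfP : cofin (fun a => (exists p, C p /\ (p s = Some a /\ p e = Some (f a))) /\
    forall y, (exists p, C p /\ (p s = Some a /\ p e = Some y)) -> y = f a).
  apply: cofin_sub (cofin_and (section_ptP s) hf) => a [[Cs sa u] ef]; split.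
    by exists (section_pt s a).
  by move=> y [p [Cp [pa pe]]]; rewrite /f -(u p) // pe.
have [N [D ND]] := definable_rational dS hfP.
have D0 : D != 0.
  have [a [Da _]] := cofin_inh ND.
  by apply: contraNneq Da => ->; rewrite horner0.
pose g := gcdp N D.
have g0 : g != 0 by rewrite gcdp_eq0 negb_and D0 orbT.
exists (N %/ g), (D %/ g); split.
  by apply: coprimep_div_gcd; rewrite D0 orbT.
apply: cofin_sub (cofin_and ND hf) => a [[Da fa] sa].
have eN : N.[a] = (N %/ g).[a] * g.[a] by rewrite -hornerM divpK // dvdp_gcdl.
have eD : D.[a] = (D %/ g).[a] * g.[a] by rewrite -hornerM divpK // dvdp_gcdr.
move: Da fa; rewrite eD mulf_eq0 negb_or => /andP[Da ga]; rewrite eN => fa.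
by split=> //; rewrite sa fa -mulf_div divff // mulr1.
Qed.

(** Two points of C with the same general coordinate at e are equal, so the
    rational function is injective or constant. *)
Lemma section_mobius s e : exists r : P1 R + 'M[F]_2,
  (forall M, r = inr M -> M \in unitmx) /\
  cofin (fun a => section_pt s a e = match r with inl b => b | inr M => mobius M (Some a) end).
Proof.
have [h|[N [D [cND ND]]]] := section_rational s e; first by exists (inl None).
pose A a := [/\ C (section_pt s a), section_pt s a s = Some a, D.[a] != 0 &
  section_pt s a e = Some (N.[a] / D.[a])].
have cA : cofin A.
  by apply: cofin_sub (cofin_and (section_ptP s) ND) => a [[? ? _] [? ?]].
have inj b : (exists p, [/\ C p, p e = Some b & forall q, C q -> q e = Some b -> q = p]) ->
    forall a a', A a -> A a' -> N.[a] = b * D.[a] -> N.[a'] = b * D.[a'] -> a = a'.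
  move=> [p [_ _ up]] a a' [Ca sa Da ea] [Ca' sa' Da' ea'] Na Na'.
  have ep : section_pt s a = p by apply: up => //; rewrite ea Na mulfK.
  have ep' : section_pt s a' = p by apply: up => //; rewrite ea' Na' mulfK.
  by move: sa' sa; rewrite ep ep' => -> [].
case: (coprime_injective_degree cND cA (degree1_cofin (degC e)) inj).
  move=> [/size1_polyC eN /size1_polyC eD]; exists (inl (Some (N`_0 / D`_0))); split=> //.
  by apply: cofin_sub cA => a [_ _ _ ->]; rewrite eN eD !hornerC !coefC.
move=> [sN sD det]; exists (inr (mx2 N`_1 N`_0 D`_1 D`_0)); split.
  by move=> M [<-]; rewrite unitmx2 !mx2E.
have lin2 (p : {poly F}) a : (size p <= 2)%N -> p.[a] = p`_1 * a + p`_0.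
  move=> sp; rewrite (horner_coef_wide a sp) !big_ord_recl big_ord0 /=.
  by rewrite expr0 mulr1 expr1 addr0 addrC.
apply: cofin_sub cA => a [_ _ Da ->].
rewrite /mobius /of_hcoord !mulmx2 !mx2E !hcoord_Some /= !mulr1.
by rewrite -!lin2 // (negPf Da).
Qed.

(** By closedness, C contains the whole rational curve that its generic points
    above the coordinate s trace. *)
Lemma sections_mobius : exists rho : E -> E -> P1 R + 'M[F]_2,
  forall s, [/\ units (rho s), exists M, rho s s = inr M,
    forall t, C (param (rho s) t) &
    cofin (fun a => forall p, C p -> p s = Some a -> p = param (rho s) (Some a))].
Proof.
have [rho rhoP] := choice (fun se : E * E => section_mobius se.1 se.2).
exists (fun s e => rho (s, e)) => s; set r := fun e => _.
have ur : units r by move=> e M; exact: (rhoP (s, e)).1.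
have er : cofin (fun a => section_pt s a = param r (Some a)).
  apply: cofin_sub (cofin_all (fun e => (rhoP (s, e)).2)) => a h.
  by apply: funext => e; exact: h.
split=> //.
- case e : (r s) => [b|M]; last by exists M.
  have [a [[[_ sa _] ra] ab]] := cofin_inh (cofin_and (cofin_and (section_ptP s) er)
    (@cofin_neq _ (odflt 0 b))).
  by move: sa; rewrite ra /param e => eb; rewrite eb eqxx in ab.
- apply: param_closure => //.
  by apply: cofin_sub (cofin_and (section_ptP s) er) => a [[Cs _ _] <-].
apply: cofin_sub (cofin_and (section_ptP s) er) => a [[_ _ u] <-] p Cp pa; exact: u.
Qed.

(** A point all of whose coordinates avoid the generic locus has its
    coordinates in a finite set. *)
Lemma finite_exceptions (Q : E -> F -> Prop) : (forall s, cofin (Q s)) ->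
  exists l : seq (E -> P1 R), forall p : E -> P1 R,
    (forall s a, p s = Some a -> ~ Q s a) -> p \in l.
Proof.
move=> cQ; have [g g0 gP] := cofin_all cQ.
have [rs hrs] := closed_field_poly_normal g.
pose L : seq (P1 R) := None :: [seq Some a | a <- rs].
have [l _ lP] := functions_into E None L; exists l => p bad; apply: lP => e.
rewrite inE; case pe : (p e) => [a|] //=; apply/map_f; apply: contrapT => ars.
apply: (bad e a pe); apply: gP; rewrite hrs hornerZ mulf_neq0 ?lead_coef_eq0 //.
by rewrite -rootE root_prod_XsubC; apply/negP.
Qed.

Hypothesis connC : zconnected C.
Hypothesis smoothC : smooth_of_dim C 1.

(** At a common point, the velocity of the second curve moves the coordinate s,
    which the first one keeps constant.  Since the velocity of the first is not
    zero, the two are independent. *)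
Lemma no_crossing (rho1 rho2 : E -> P1 R + 'M[F]_2) s b t1 t2 :
  units rho1 -> units rho2 ->
  (forall t, C (param rho1 t)) -> (forall t, C (param rho2 t)) ->
  (exists s0 M0, rho1 s0 = inr M0) -> rho1 s = inl b -> (exists M, rho2 s = inr M) ->
  param rho1 t1 != param rho2 t2.
Proof.
move=> u1 u2 s1 s2 [s0 [M0 e0]] e1 [M e2]; apply/eqP => e.
have [v [tv vc vi]] := tangent_pcurve t1 u1 s1.
have [w [tw wc wi]] := tangent_pcurve t2 u2 s2; rewrite -e in tw.
have [V eV dV] := smoothC (s1 t1).
have vV : v \in V by have : tangent_space C (param rho1 t1) v := tv; rewrite eV.
have wV : w \in V by have : tangent_space C (param rho1 t1) w := tw; rewrite eV.
have v0 : v != 0 by apply: contraNneq (vi _ _ e0) => ->; rewrite ffunE.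
have : (<[v]> == V)%VS by rewrite eqEdim -memvE vV dV dim_vline v0.
move=> /eqP eVv; move: wV; rewrite -eVv => /vlineP[c ec].
by have := wi _ _ e2; rewrite ec ffunE (vc _ _ e1) scaler0 eqxx.
Qed.

(** C is the union of the rational curve G s0 traced over s0, the other curves
    G s with s constant on G s0, and finitely many points.  By [no_crossing],
    G s0 is disjoint from the rest, so that it is all of C. *)
Lemma curve_is_mcurve (s0 : E) : exists2 M : E -> 'M[F]_2,
  forall e, M e \in unitmx & C = mcurve M.
Proof.
have [rho rhoP] := sections_mobius.
have ur s : units (rho s) by case: (rhoP s).
have subC s t : C (param (rho s) t) by case: (rhoP s).
have nc s : exists M, rho s s = inr M by case: (rhoP s).
have gen s : cofin (fun a => forall p, C p -> p s = Some a -> p = param (rho s) (Some a)).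
  by case: (rhoP s).
pose G s := pcurve (rho s).
(* The general point of C above s lies on G s0, which has all values at s. *)
have same s M : rho s0 s = inr M -> G s `<=` G s0.
  move=> es _ [t ->]; move: t; apply: param_closure => //.
    exact: zclosed_pcurve.
  apply: cofin_sub (gen s) => a h.
  exists (mobius (invmx M) (Some a)); apply: esym; apply: h => //.
  by rewrite /param es mobiusVK // (ur _ _ _ es).
have [l hl] := finite_exceptions gen.
pose I := [seq s <- enum E | if rho s0 s is inl _ then true else false].
pose l' := [seq p <- l | `[< C p /\ ~ G s0 p >]].
pose D := [set p | exists2 s, s \in I & G s p] `|` [set p | p \in l'].
have cG s : zclosed (G s) by exact: zclosed_pcurve.
have cD : zclosed D.
  apply: zclosedU; last exact: zclosed_seq.
  by apply: zclosed_bigU => s _.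
have eC : C = G s0 `|` D.
  rewrite predeqE => p; split; last first.
    case=> [[t ->] //|[[s _ [t ->]] //|]].
    by rewrite /= mem_filter => /andP[/asboolP[]].
  move=> Cp; have [pG|npG] := EM (G s0 p); first by left.
  have [pl|npl] := boolP (p \in l).
    by right; right; rewrite /= mem_filter pl andbT; apply/asboolP.
  have [s [a [pa qa]]] : exists s a, p s = Some a /\
      (forall p, C p -> p s = Some a -> p = param (rho s) (Some a)).
    apply: contrapT => h; move/negP: npl; apply; apply: hl => s a pa qa.
    by apply: h; exists s, a.
  right; left; exists s; last by exists (Some a); exact: qa.
  rewrite mem_filter mem_enum andbT; case es : (rho s0 s) => [//|M].
  by case: npG; apply: (same s M es); exists (Some a); exact: qa.
have dis : G s0 `&` D = set0.
  rewrite predeqE => p; split=> // -[[t pt] [[s sI [t' pt']]|]]; last first.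
    by rewrite /= mem_filter => /andP[/asboolP[_ []]]; exists t.
  move: sI; rewrite mem_filter => /andP[+ _]; case es : (rho s0 s) => [b|//] _.
  have /eqP := no_crossing t t' (ur s0) (ur s) (subC s0) (subC s)
    (ex_intro _ s0 (nc s0)) es (nc s).
  by rewrite -pt -pt'.
case: connC => _ /(_ _ _ (cG s0) cD eC dis)[G0|D0].
  have : G s0 (param (rho s0) None) by exists None.
  by rewrite G0.
have all_inr s : exists M, rho s0 s = inr M.
  case es : (rho s0 s) => [b|M]; last by exists M.
  have : D (param (rho s) None).
    by left; exists s; [rewrite mem_filter es mem_enum | exists None].
  by rewrite D0.
have [M hM] := choice all_inr.
have eM : rho s0 = fun e => inr (M e) by exact: funext.
exists M; first by move=> e; exact: ur (hM e).
by rewrite eC D0 setU0 /G eM.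
Qed.

End Converse.

Lemma curvesP (R : realType) (E : finType) (e0 : E) (C : set (E -> P1 R)) :
  curves C <-> exists2 M : E -> 'M[R[i]]_2, forall e, M e \in unitmx & C = mcurve M.
Proof.
split=> [[cC connC _ smC degC]|[M uM ->]]; last exact: curves_mcurve.
exact: curve_is_mcurve.
Qed.

(** * Normalized configurations of points *)

Section NormalizedPoints.
Variables (R : realType) (V : finType) (a : nat).
Local Notation F := R[i].

(** Normalized points: infinity, 0 and 1, followed by free parameters.  Any map
    from V to indices gives a family of configurations on V, degenerate ones
    included. *)
Definition npoint (x : 'I_a -> F) (j : 'I_(a + 3)) : P1 R :=
  nth None [:: None, Some 0, Some 1 & [seq Some (x i) | i <- enum 'I_a]] j.

Definition ncoord (j : 'I_(a + 3)) (k : 'I_2) : {mpoly F[a]} :=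
  nth 0 [:: (if k == 0 then 1 else 0), (if k == 0 then 0 else 1), 1 &
    [seq if k == 0 then 'X_i else 1 | i <- enum 'I_a]] j.

Lemma meval_ncoord x j k : (ncoord j k).@[x] = hcoord (npoint x j) k 0.
Proof.
rewrite /ncoord /npoint; case: j => -[|[|[|j]]] /= hj.
- by rewrite hcoord_None; case: ifP; rewrite ?meval1 ?meval0.
- by rewrite hcoord_Some; case: ifP; rewrite ?meval1 ?meval0.
- by rewrite hcoord_Some meval1; case: ifP.
have ja : (j < a)%N by move: hj; rewrite addn3.
rewrite (nth_map (Ordinal ja)) ?size_enum_ord // [in RHS](nth_map (Ordinal ja)) ?size_enum_ord //.
rewrite hcoord_Some; by case: ifP; rewrite ?meval1 ?mevalXU.
Qed.

Definition nbracket (i j : 'I_(a + 3)) : {mpoly F[a]} :=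
  ncoord i 0 * ncoord j 1 - ncoord i 1 * ncoord j 0.

Lemma meval_nbracket x i j :
  (nbracket i j).@[x] = bracket (npoint x i) (npoint x j).
Proof. by rewrite /nbracket mevalB !mevalM !meval_ncoord. Qed.

(** Index the distinct values of z, starting with infinity, 0 and 1. *)
Lemma npointP (z : V -> P1 R) :
  None \in codom z -> Some 0 \in codom z -> Some 1 \in codom z ->
  (size (undup (codom z)) <= a + 3)%N ->
  exists (tau : {ffun V -> 'I_(a + 3)}) (x : 'I_a -> F), forall v, z v = npoint x (tau v).
Proof.
move=> zN z0 z1 sz; pose b : seq (P1 R) := [:: None; Some 0; Some 1].
pose s := [seq y <- undup (codom z) | y \notin b].
have ub : uniq (b ++ s).
  rewrite cat_uniq filter_uniq ?undup_uniq // andbT; apply/andP; split.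
    by rewrite /= !inE /= -[Some 0 == _]/(0 == 1 :> F) eq_sym oner_eq0.
  by apply/hasPn => y; rewrite mem_filter => /andP[].
have sb : (size (b ++ s) <= a + 3)%N.
  apply: leq_trans sz; apply: uniq_leq_size => // y; rewrite mem_cat mem_undup.
  case/orP; first by rewrite !inE => /or3P[]/eqP->.
  by rewrite mem_filter mem_undup => /andP[].
have sa : (size s <= a)%N by move: sb; rewrite size_cat addnC leq_add2r.
have zb v : z v \in b ++ s.
  rewrite mem_cat mem_filter mem_undup codom_f andbT.
  by case: (z v \in b).
have is_ v : (index (z v) (b ++ s) < size (b ++ s))%N by rewrite index_mem.
have ib v := leq_trans (is_ v) sb.
exists [ffun v => Ordinal (ib v)], (fun i => odflt 0 (nth None s i)) => v.
rewrite ffunE /npoint -[LHS](nth_index None (zb v)).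
rewrite -[nat_of_ord (Ordinal _)]/(index (z v) (b ++ s)).
have sN y : y \in s -> y != None by rewrite mem_filter !inE !negb_or => /andP[/and3P[]].
move: (index (z v) (b ++ s)) (ib v) (is_ v) => k hka hks.
case: k hka hks => [|[|[|k]]] //= hka hks.
have ka : (k < a)%N by move: hka; rewrite addn3.
rewrite (nth_map (Ordinal ka)) ?size_enum_ord // nth_enum_ord //.
have /sN : nth None s k \in s by exact: mem_nth.
by case: (nth None s k).
Qed.

End NormalizedPoints.

(** * Cross-ratios of a generic configuration *)

Section CrossRatios.
Variables (R : realType) (V E : finType) (T : hypergraph4 V E) (o : E -> 4.-tuple V).
Hypothesis ho : edge_ordering T o.
Local Notation F := R[i].
Implicit Types (z : V -> P1 R) (c : E -> F).

(** Vertices are numbered by natural numbers rather than ordinals, so that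
    positions can be compared by computation. *)
Definition vtx e (k : nat) : V := tnth (o e) (inord k).

Lemma mem_edge e v : (v \in T e) = (v \in o e).
Proof. by rewrite -ho inE. Qed.

Lemma uniq_edge e : uniq (o e).
Proof.
apply/card_uniqP; rewrite size_tuple -[RHS](card_hedge T e) -ho cardsE.
by [].
Qed.

Lemma vtx_edge e k : vtx e k \in T e.
Proof. by rewrite mem_edge mem_tnth. Qed.

Lemma edgeP e v : v \in T e -> exists2 k, (k < 4)%N & v = vtx e k.
Proof.
rewrite mem_edge => /tnthP[i ->]; exists (i : nat) => //.
by rewrite /vtx inord_val.
Qed.

Lemma vtx_eq e j k : (j < 4)%N -> (k < 4)%N -> (vtx e j == vtx e k) = (j == k).
Proof.
move=> j4 k4; rewrite (inj_eq (tuple_uniqP _ (uniq_edge e))).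
by rewrite -val_eqE /= !inordK.
Qed.

Definition edge_injective z := forall e, {in T e &, injective z}.

Lemma edge_injective_neq z e j k : edge_injective z -> (j < 4)%N -> (k < 4)%N ->
  j != k -> z (vtx e j) != z (vtx e k).
Proof.
move=> inj j4 k4; apply: contra => /eqP h; apply/eqP.
by have /eqP := inj e _ _ (vtx_edge e j) (vtx_edge e k) h; rewrite vtx_eq // => /eqP.
Qed.

Definition cr_num z e :=
  bracket (z (vtx e 2)) (z (vtx e 0)) * bracket (z (vtx e 3)) (z (vtx e 1)).

Definition cr_den z e :=
  bracket (z (vtx e 2)) (z (vtx e 1)) * bracket (z (vtx e 3)) (z (vtx e 0)).

Lemma CR_mapE z e : CR_map o z e = cr_num z e / cr_den z e.
Proof. by []. Qed.

Lemma cr_den_neq0 z e : edge_injective z -> cr_den z e != 0.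
Proof.
move=> inj; rewrite /cr_den mulf_neq0 // bracket_eq0; exact: edge_injective_neq.
Qed.

Lemma CR_map_mobius (A : 'M[F]_2) z : A \in unitmx ->
  CR_map o (mobius A \o z) = CR_map o z.
Proof. by move=> uA; apply: funext => e; rewrite /CR_map /= cross_ratio_mobius. Qed.

(** With fewer parameters than edges, the cross-ratios are algebraically
    dependent. *)
Lemma npoint_dependence a (tau : V -> 'I_(a + 3)) : (a < #|E|)%N ->
  generic (fun c : 'I_#|E| -> F => forall x, edge_injective (npoint x \o tau) ->
    (forall e, CR_map o (npoint x \o tau) e = c (enum_rank e)) -> False).
Proof.
move=> aE.
pose N (i : 'I_#|E|) : {mpoly F[a]} := let e := enum_val i in
  nbracket R (tau (vtx e 2)) (tau (vtx e 0)) * nbracket R (tau (vtx e 3)) (tau (vtx e 1)).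
pose D (i : 'I_#|E|) : {mpoly F[a]} := let e := enum_val i in
  nbracket R (tau (vtx e 2)) (tau (vtx e 1)) * nbracket R (tau (vtx e 3)) (tau (vtx e 0)).
have NE x i : (N i).@[x] = cr_num (npoint x \o tau) (enum_val i).
  by rewrite /N /= mevalM !meval_nbracket.
have DE x i : (D i).@[x] = cr_den (npoint x \o tau) (enum_val i).
  by rewrite /D /= mevalM !meval_nbracket.
have [H H0 HP] := dependence N D aE; exists H => // c Hc x inj e.
move/eqP: Hc; apply; rewrite -[RHS](HP x); last by move=> i; rewrite DE cr_den_neq0.
by apply: meval_eq => i; rewrite NE DE -[RHS]/(CR_map o _ _) e enum_valK.
Qed.

(** With as many parameters as edges, the cross-ratios together with one more
    coordinate are dependent: the coordinate is algebraic over the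
    cross-ratios. *)
Lemma coordinate_dependence a (tau : V -> 'I_(a + 3)) (j : 'I_a) : (a <= #|E|)%N ->
  exists B, generic (fun c : 'I_#|E| -> F => exists q : {poly F},
    [/\ q != 0, (size q <= B)%N &
      forall x, edge_injective (npoint x \o tau) ->
        (forall e, CR_map o (npoint x \o tau) e = c (enum_rank e)) -> root q (x j)]).
Proof.
move=> aE.
pose N : 'I_#|E|.+1 -> {mpoly F[a]} := snoc (fun i => let e := enum_val i in
  nbracket R (tau (vtx e 2)) (tau (vtx e 0)) * nbracket R (tau (vtx e 3)) (tau (vtx e 1)))
  'X_j.
pose D : 'I_#|E|.+1 -> {mpoly F[a]} := snoc (fun i => let e := enum_val i in
  nbracket R (tau (vtx e 2)) (tau (vtx e 1)) * nbracket R (tau (vtx e 3)) (tau (vtx e 0)))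
  1.
have NE x i : (N i).@[x] = snoc (fun i => cr_num (npoint x \o tau) (enum_val i)) (x j) i.
  rewrite /N /snoc; case: unliftP => [k _|_] /=; last by rewrite mevalXU.
  by rewrite mevalM !meval_nbracket.
have DE x i : (D i).@[x] = snoc (fun i => cr_den (npoint x \o tau) (enum_val i)) 1 i.
  rewrite /D /snoc; case: unliftP => [k _|_] /=; last by rewrite meval1.
  by rewrite mevalM !meval_nbracket.
have [H H0 HP] := dependence N D aE.
have [g [B g0 gP]] := specialize_last H0.
exists B, g => // c /gP[q [q0 sq hq]]; exists q; split=> // x inj e.
rewrite rootE -hq -[X in _ == X](HP x).
  apply/eqP/meval_eq => i; rewrite NE DE /snoc; case: unliftP => [k _|_] /=.
    by rewrite -[RHS]/(CR_map o _ _) e enum_valK.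
  by rewrite divr1.
by move=> i; rewrite DE /snoc; case: unliftP => [k _|_] /=; rewrite ?oner_eq0 ?cr_den_neq0.
Qed.

Hypothesis cardVE : #|V| = (#|E| + 3)%N.
Variable e0 : E.

Definition no_degenerate c :=
  forall z, edge_injective z -> CR_map o z = c -> injective z.

Lemma edge_injective_mobius (A : 'M[F]_2) z : A \in unitmx ->
  edge_injective z -> edge_injective (mobius A \o z).
Proof. by move=> uA inj e u v ue ve /(mobius_inj uA); exact: (inj e). Qed.

(** A configuration with a coincidence has at most |V| - 1 = |E| + 2 distinct
    points, three of which can be normalized: |E| - 1 parameters are left for
    the |E| cross-ratios. *)
Lemma generic_no_degenerate :
  generic (fun c : 'I_#|E| -> F => no_degenerate (fun e => c (enum_rank e))).
Proof.
pose a := #|E|.-1; have E0 : (0 < #|E|)%N by apply/card_gt0P; exists e0.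
have aE : (a < #|E|)%N by rewrite prednK.
apply: generic_sub (generic_all (fun tau : {ffun V -> 'I_(a + 3)} =>
  npoint_dependence tau aE)) => c h z inj ez.
apply: contrapT => /injectiveP ninj.
have [A uA [A0 A1 A2]] := mobius_std
  (edge_injective_neq e0 inj (isT : (0 < 4)%N) (isT : (1 < 4)%N) isT)
  (edge_injective_neq e0 inj (isT : (0 < 4)%N) (isT : (2 < 4)%N) isT)
  (edge_injective_neq e0 inj (isT : (1 < 4)%N) (isT : (2 < 4)%N) isT).
pose w := mobius A \o z.
have wc v : w v \in codom w by exact: codom_f.
have [||||tau [x hx]] := @npointP R V a w.
- by rewrite -A0; exact: (wc (vtx e0 0)).
- by rewrite -A1; exact: (wc (vtx e0 1)).
- by rewrite -A2; exact: (wc (vtx e0 2)).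
- have : (size (undup (codom w)) < size (codom w))%N.
    rewrite ltn_size_undup; apply: contra ninj => /injectiveP iw.
    by apply/injectiveP => u v e; apply: iw; rewrite /w /= e.
  by rewrite size_codom cardVE -(prednK E0) addSn ltnS.
have ew : w = npoint x \o tau by apply: funext => v; exact: hx.
apply: (h tau x); rewrite -ew; first exact: edge_injective_mobius.
by move=> e; rewrite CR_map_mobius // ez.
Qed.

(** Representatives of the fibre of the cross-ratio map over c, with three
    points of the edge e0 at infinity, 0 and 1. *)
Definition nfiber c : set (V -> P1 R) :=
  [set z : V -> P1 R | [/\ injective z, z (vtx e0 0) = None, z (vtx e0 1) = Some 0,
               z (vtx e0 2) = Some 1 & CR_map o z = c]].

Lemma injective_edge_injective z : injective z -> edge_injective z.
Proof. by move=> inj e u v _ _; apply: inj. Qed.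

(** Every point of a configuration in the fibre is infinity, 0, 1 or a root of
    one of finitely many polynomials of bounded degree. *)
Lemma nfiber_bounded : exists K, generic (fun c : 'I_#|E| -> F =>
  forall s : seq (V -> P1 R), uniq s ->
    (forall z, z \in s -> nfiber (fun e => c (enum_rank e)) z) -> (size s <= K)%N).
Proof.
pose m := #|E|.
have [B hB] := choice (fun tj : {ffun V -> 'I_(m + 3)} * 'I_m =>
  coordinate_dependence tj.1 tj.2 (leqnn m)).
exists ((3 + \sum_tj B tj) ^ #|V|)%N.
apply: generic_sub (generic_all hB) => c /choice[q qP] s us sN.
have rts tj : exists r : seq F, (size r <= B tj)%N /\ forall y, root (q tj) y -> y \in r.
  have [r hr] := closed_field_poly_normal (q tj); have [q0 sq _] := qP tj.
  exists r; split.
    by apply: leq_trans sq; rewrite hr size_scale ?lead_coef_eq0 // size_prod_XsubC.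
  by move=> y; rewrite hr rootZ ?lead_coef_eq0 // root_prod_XsubC.
have [r rP] := choice rts.
pose L : seq (P1 R) := [:: None, Some 0, Some 1 &
  flatten [seq [seq Some y | y <- r tj] | tj <- enum {: {ffun V -> 'I_(m + 3)} * 'I_m}]].
have [l sl lP] := functions_into V None L.
apply: (@leq_trans (size l)).
  apply: uniq_leq_size => // z /sN[injz zN z0 z1 ez]; apply: lP => v.
  have wc u : z u \in codom z by exact: codom_f.
  have [||||tau [x hx]] := @npointP R V m z.
  - by rewrite -zN.
  - by rewrite -z0.
  - by rewrite -z1.
  - by apply: leq_trans (size_undup _) _; rewrite size_codom cardVE.
  have ew : z = npoint x \o tau by apply: funext => u; exact: hx.
  rewrite hx /npoint /L; case: (tau v) => -[|[|[|j]]] /= hj; rewrite !inE ?eqxx ?orbT //=.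
  have jm : (j < m)%N by move: hj; rewrite addn3.
  rewrite (nth_map (Ordinal jm)) ?size_enum_ord //; apply/orP; right; apply/orP; right.
  apply/orP; right; set i := nth _ _ _.
  apply/flattenP; exists [seq Some y | y <- r (tau, i)].
    by apply: map_f; rewrite mem_enum.
  apply: map_f; apply: (rP _).2; have [_ _ h] := qP (tau, i); apply: h => /=.
    by rewrite -ew; exact: injective_edge_injective.
  by rewrite -ew ez.
rewrite sl leq_exp2r; last by rewrite cardVE addn3.
rewrite /L /= !addSn !ltnS add0n size_allpairs_dep sumnE big_map big_enum /=.
by apply: leq_sum => tj _; case: (rP tj).
Qed.

End CrossRatios.

(** * The number of points in a general fibre *)

Section Degree.
Variables (R : realType) (V E : finType) (T : hypergraph4 V E) (o : E -> 4.-tuple V).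
Hypothesis ho : edge_ordering T o.
Local Notation F := R[i].
Implicit Types (z : V -> P1 R) (c : E -> F).
Variable e0 : E.
Local Notation nfib := (@nfiber R V E o e0).

Lemma mobius_class_comp (A : 'M[F]_2) z : A \in unitmx ->
  mobius_class (mobius A \o z) = mobius_class z.
Proof.
move=> uA; rewrite predeqE => w; split=> -[B uB ->].
  exists (B *m A); first by rewrite unitmx_mul uB.
  by apply: funext => v /=; rewrite mobius_comp.
exists (B *m invmx A); first by rewrite unitmx_mul uB unitmx_inv.
by apply: funext => v /=; rewrite mobius_comp // mulmxKV.
Qed.

Lemma mobius_class_refl z : mobius_class z z.
Proof.
by exists 1%:M; rewrite ?unitmx1 //; apply: funext => v; rewrite /= mobius1.
Qed.

Lemma vtx_neq (z : V -> P1 R) j k : injective z -> (j < 4)%N -> (k < 4)%N -> j != k ->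
  z (vtx o e0 j) != z (vtx o e0 k).
Proof.
move=> /(injective_edge_injective (T := T)) h; exact: (edge_injective_neq ho).
Qed.

Lemma normalize_points z : z (vtx o e0 0) != z (vtx o e0 1) ->
  z (vtx o e0 0) != z (vtx o e0 2) -> z (vtx o e0 1) != z (vtx o e0 2) ->
  injective z -> exists2 A : 'M[F]_2, A \in unitmx & nfib (CR_map o z) (mobius A \o z).
Proof.
move=> n01 n02 n12 inj; have [A uA [A0 A1 A2]] := mobius_std n01 n02 n12.
exists A => //; split=> //; last exact: CR_map_mobius.
by move=> u v /(mobius_inj uA)/inj.
Qed.

Lemma CR_fiberE c : CR_fiber o c = (@mobius_class R V) @` nfib c.
Proof.
rewrite predeqE => x; split.
  move=> [[z0 inj0 <-] [z [B uB ez] ec]].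
  have inj : injective z by rewrite ez => u v /(mobius_inj uB)/inj0.
  have [A uA nA] := normalize_points (vtx_neq inj (isT : (0 < 4)%N) (isT : (1 < 4)%N) isT)
    (vtx_neq inj (isT : (0 < 4)%N) (isT : (2 < 4)%N) isT)
    (vtx_neq inj (isT : (1 < 4)%N) (isT : (2 < 4)%N) isT) inj.
  exists (mobius A \o z); first by rewrite -ec.
  by rewrite (mobius_class_comp z uA) ez; exact: mobius_class_comp.
move=> [z nz <-]; have [inj _ _ _ ec] := nz; split; first by exists z.
by exists z => //; exact: mobius_class_refl.
Qed.

Lemma mobius_class_nfiber_inj c z w : nfib c z -> nfib c w ->
  mobius_class z = mobius_class w -> z = w.
Proof.
move=> [_ z0 z1 z2 _] [_ w0 w1 w2 _] ezw.
have : mobius_class z w by rewrite ezw; exact: mobius_class_refl.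
move=> [A uA ew]; apply: funext => v; rewrite ew /= -[LHS]mobius1.
have h u : w u = mobius A (z u) by rewrite ew.
apply: esym; apply: (@mobius_eq3 _ _ _ None (Some 0) (Some 1)).
- exact: uA.
- exact: unitmx1.
- by [].
- by [].
- by rewrite -[Some 0 == _]/(0 == 1 :> F) eq_sym oner_eq0.
- by rewrite mobius1 -{1}z0 -h.
- by rewrite mobius1 -{1}z1 -h.
by rewrite mobius1 -{1}z2 -h.
Qed.

(** Each Moebius class contains exactly one normalized configuration. *)
Lemma card_CR_fiber c : CR_fiber o c #= nfib c.
Proof.
rewrite CR_fiberE; apply: inj_card_eq => z w; rewrite !inE; exact: mobius_class_nfiber_inj.
Qed.

(** The conditions on the right are polynomial, hence definable. *)
Lemma nfiberP c z : z (vtx o e0 0) = None -> nfib c z <->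
  [/\ forall u v, u != v -> bracket (z u) (z v) <> 0,
      bracket (z (vtx o e0 1)) (Some 0) = 0, bracket (z (vtx o e0 2)) (Some 1) = 0 &
      forall e, cr_num o z e = c e * cr_den o z e].
Proof.
have den w e : injective w -> cr_den o w e != 0.
  by move=> /(injective_edge_injective (T := T)); exact: (cr_den_neq0 ho).
move=> z0; split=> [[inj _ z1 z2 ec]|[inj /eqP z1 /eqP z2 ec]].
  split.
  - by move=> u v uv /eqP; rewrite bracket_eq0 => /eqP/inj e; rewrite e eqxx in uv.
  - by apply/eqP; rewrite bracket_eq0 z1.
  - by apply/eqP; rewrite bracket_eq0 z2.
  by move=> e; rewrite -ec CR_mapE divfK // den.
rewrite !bracket_eq0 in z1 z2; move/eqP: z1 => z1; move/eqP: z2 => z2.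
have injz : injective z.
  move=> u v e; apply: contrapT => /eqP /inj; apply; apply/eqP.
  by rewrite bracket_eq0 e.
by split=> //; apply: funext => e; rewrite CR_mapE ec mulfK // den.
Qed.

Section Count.
Variable k : nat.

Let idx (j : 'I_k) (u : V) : nat := (#|E| + enum_rank (j, u))%N.
Let pts (v : nat -> F) (j : 'I_k) (u : V) : P1 R :=
  if u == vtx o e0 0 then None else Some (v (idx j u)).

Lemma polyfun_hcoord_pts j u i : polyfun (fun v => hcoord (pts v j u) i 0).
Proof.
rewrite /pts; case: (u == _); first exact: polyfun_const.
under [fun _ => _]funext => v do rewrite hcoord_Some.
by case: (i == 0); [exact: polyfun_var | exact: polyfun_const].
Qed.

Lemma polyfun_bracket (x y : (nat -> F) -> P1 R) :
  (forall i, polyfun (fun v => hcoord (x v) i 0)) ->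
  (forall i, polyfun (fun v => hcoord (y v) i 0)) ->
  polyfun (fun v => bracket (x v) (y v)).
Proof. by move=> hx hy; apply: polyfun_sub; apply: polyfun_mul. Qed.

Lemma definable_nfiber j : definable (fun v => nfib (fun e => v (enum_rank e : nat)) (pts v j)).
Proof.
have pb u w : polyfun (fun v => bracket (pts v j u) (pts v j w)).
  by apply: polyfun_bracket => i; exact: polyfun_hcoord_pts.
have pc u (x : F) : polyfun (fun v => bracket (pts v j u) (Some x)).
  by apply: polyfun_bracket => i; [exact: polyfun_hcoord_pts | exact: polyfun_const].
apply: (@definable_iff _ (fun v =>
  (forall u w, u != w -> bracket (pts v j u) (pts v j w) <> 0) /\
  (bracket (pts v j (vtx o e0 1)) (Some 0) = 0 /\
   (bracket (pts v j (vtx o e0 2)) (Some 1) = 0 /\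
    forall e, cr_num o (pts v j) e = v (enum_rank e : nat) * cr_den o (pts v j) e)))).
  move=> v; rewrite nfiberP; last by rewrite /pts eqxx.
  by split=> [[? [? []]]|[]].
apply: definable_and.
  apply: definable_all => u; apply: definable_all => w.
  apply: definable_imp; first exact: definable_const.
  by apply: definable_not; apply: definable_eq => //; exact: polyfun_const.
apply: definable_and; first by apply: definable_eq => //; exact: polyfun_const.
apply: definable_and; first by apply: definable_eq => //; exact: polyfun_const.
apply: definable_all => e; apply: definable_eq; first by apply: polyfun_mul.
by apply: polyfun_mul; [exact: polyfun_var | apply: polyfun_mul].
Qed.

Definition has_points c := exists s : seq (V -> P1 R),
  [/\ uniq s, size s = k & forall z, z \in s -> nfib c z].

(** The base point occupies the first variables and the k configurations the
    following ones. *)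
Lemma definable_has_points : exists2 P : (nat -> F) -> Prop, definable P &
  forall c : 'I_#|E| -> F, P (zero_ext c) <-> has_points (fun e => c (enum_rank e)).
Proof.
pose Q v := (forall j, nfib (fun e => v (enum_rank e : nat)) (pts v j)) /\
  (forall i j : 'I_k, i != j -> exists u, bracket (pts v i u) (pts v j u) <> 0).
have dQ : definable Q.
  apply: definable_and; first by apply: definable_all => j; exact: definable_nfiber.
  apply: definable_all => i; apply: definable_all => j.
  apply: definable_imp; first exact: definable_const.
  apply: definable_ex => u; apply: definable_not; apply: definable_eq; last exact: polyfun_const.
  by apply: polyfun_bracket => l; exact: polyfun_hcoord_pts.
exists (fun v => exists v', (forall i, i \notin iota #|E| #|{: 'I_k * V}| -> v' i = v i) /\ Q v').
  exact: definable_exists.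
move=> c; split=> [[v [hv [Q1 Q2]]]|[s [us ks sN]]].
  exists [seq pts v j | j <- enum 'I_k]; split.
  - rewrite map_inj_uniq ?enum_uniq // => i j e; apply: contrapT => /eqP /Q2[u]; apply.
    by apply/eqP; rewrite bracket_eq0 e.
  - by rewrite size_map size_enum_ord.
  move=> _ /mapP[j _ ->]; have := Q1 j; congr (nfib _ _); apply: funext => e.
  rewrite hv ?zero_ext_ord // mem_iota negb_and -ltnNge.
  by apply/orP; left; exact: ltn_ord.
pose z j := nth (fun=> None) s j.
exists (fun i => if insub (i - #|E|)%N is Some l then
   (if (#|E| <= i)%N then
     let: (j, u) := enum_val (l : 'I_#|{: 'I_k * V}|) in odflt 0 (z j u) else zero_ext c i)
  else zero_ext c i).
split=> [i|].
  rewrite /= mem_iota; have [hi|hi] := leqP #|E| i; last by case: insubP.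
  move=> hk; case: insubP => // l hl _.
  by move: hk; rewrite -leqNgt -leq_subRL // leqNgt hl.
set v := fun i => _.
have ez j : pts v j = z j.
  apply: funext => u; have zjs : z j \in s by apply: mem_nth; rewrite ks.
  have [inj zN _ _ _] := sN _ zjs; rewrite /pts; case: eqVneq => [->//|un].
  rewrite /v /idx addKn valK leq_addr enum_rankK.
  case eu : (z j u) => [y|] //=; move: un; rewrite -(inj_eq inj) zN eu eqxx.
  by [].
have ev e : v (enum_rank e : nat) = c (enum_rank e).
  rewrite /v leqNgt ltn_ord /= zero_ext_ord.
  by case: insubP.
split=> [j|i j ij].
  rewrite ez (_ : (fun e => _) = fun e => c (enum_rank e)); last exact: funext.
  by apply: sN; apply: mem_nth; rewrite ks.
apply: contrapT => h; move/negP: ij; apply.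
have : z i = z j.
  apply: funext => u; apply/eqP; rewrite -bracket_eq0 -!ez; apply/eqP.
  by apply: contrapT => hb; apply: h; exists u.
by move/eqP; rewrite nth_uniq ?ks.
Qed.

End Count.

Hypothesis cardVE : #|V| = (#|E| + 3)%N.

Lemma card_uniq_seq (S : choiceType) (s : seq S) : uniq s -> [set x | x \in s] #= `I_(size s).
Proof.
move=> us; apply/card_set_bijP; exists (index^~ s); split.
- by move=> x /= xs; rewrite /mkset index_mem.
- by move=> x y; rewrite !inE /= => xs ys; exact: index_inj.
move=> i /= si; case: s us si => // x0 s us si.
by exists (nth x0 (x0 :: s) i); [exact: mem_nth | exact: index_uniq].
Qed.

(** The fibre has at least k points generically or generically not, and the
    second case occurs by [nfiber_bounded].  The general fibre has d points for
    the largest d of the first kind. *)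
Lemma generic_card_nfiber : exists d,
  generic (fun c : 'I_#|E| -> F => nfib (fun e => c (enum_rank e)) #= `I_d).
Proof.
pose G k := generic (fun c : 'I_#|E| -> F => has_points k (fun e => c (enum_rank e))).
have dich k : G k \/ generic (fun c : 'I_#|E| -> F => ~ has_points k (fun e => c (enum_rank e))).
  have [P dP hP] := definable_has_points k.
  case: (definable_generic #|E| dP) => h; [left|right]; apply: generic_sub h => c; first by move/hP.
  by move=> nP /hP.
have [K hK] := nfiber_bounded R ho cardVE e0.
have G0 : G 0%N.
  by apply: generic_true => c; exists [::].
have [d Gd nGd] : exists2 d, G d & ~ G d.+1.
  apply: contrapT => h.
  have GK : forall k, G k.
    elim=> // k Gk; apply: contrapT => nG; apply: h; by exists k.
  have [c [hc [s [us sk sN]]]] := generic_inh (generic_and hK (GK K.+1)).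
  by have := hc s us sN; rewrite sk ltnn.
exists d; case: (dich d.+1) => // nG.
apply: generic_sub (generic_and Gd nG) => c [[s [us <- sN]] nS].
have -> : nfib (fun e => c (enum_rank e)) = [set z | z \in s].
  rewrite predeqE => z; split=> [nz|/sN //]; apply: contrapT => zs; apply: nS.
  exists (z :: s); split => //=; first by rewrite us andbT; apply/negP.
  by move=> w; rewrite inE => /orP[/eqP->|/sN].
exact: card_uniq_seq.
Qed.

End Degree.

(** * Curves through given linear subvarieties *)

Section CurvesThrough.
Variables (R : realType) (V E : finType) (T : hypergraph4 V E) (o : E -> 4.-tuple V).
Hypothesis ho : edge_ordering T o.
Hypothesis cardV : (1 < #|V|)%N.
Local Notation F := R[i].
Variable e0 : E.
Variable Q : V -> E -> P1 R.
Hypothesis Qinj : forall e, {in T e &, injective (Q^~ e)}.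

Definition target_cr (e : E) : F := CR_map o (Q^~ e) e.

Hypothesis nodeg : no_degenerate T o target_cr.
Local Notation nfib := (nfiber o e0 target_cr).

Definition incident_curves : set (set (E -> P1 R)) :=
  [set C | curves C /\ forall v, exists2 p, C p & forall e, v \in T e -> p e = Q v e].

(** The curve of a configuration: the matrices A are those that carry z to Q
    along each edge.  Quantifying over them avoids choosing them. *)
Definition curve_of (z : V -> P1 R) : set (E -> P1 R) :=
  [set p | exists t, forall e, exists2 A : 'M[F]_2, A \in unitmx &
     (forall v, v \in T e -> mobius A (z v) = Q v e) /\ p e = mobius A t].

Lemma vtx_pair e j k : (j < 4)%N -> (k < 4)%N -> j != k -> vtx o e j != vtx o e k.
Proof. by move=> j4 k4 jk; rewrite (vtx_eq ho). Qed.

Lemma Q_neq e j k : (j < 4)%N -> (k < 4)%N -> j != k ->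
  Q (vtx o e j) e != Q (vtx o e k) e.
Proof.
move=> j4 k4 jk; apply: contra (vtx_pair e j4 k4 jk) => /eqP h; apply/eqP.
by apply: (Qinj (e := e)) h; exact: vtx_edge.
Qed.

Lemma same_edge_mobius z e (A B : 'M[F]_2) : edge_injective T z ->
  A \in unitmx -> B \in unitmx ->
  (forall v, v \in T e -> mobius A (z v) = mobius B (z v)) ->
  forall t, mobius A t = mobius B t.
Proof.
move=> zinj uA uB h t.
apply: (@mobius_eq3 _ _ _ (z (vtx o e 0)) (z (vtx o e 1)) (z (vtx o e 2))) => //;
  by [apply: (edge_injective_neq ho) | apply: h; exact: vtx_edge].
Qed.

Lemma curve_ofE z (M : E -> 'M[F]_2) : edge_injective T z ->
  (forall e, M e \in unitmx) ->
  (forall e v, v \in T e -> mobius (M e) (z v) = Q v e) -> curve_of z = mcurve M.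
Proof.
move=> zinj uM hM; rewrite predeqE => p; split=> [[t ht]|[t ->]]; exists t.
  apply: funext => e; have [A uA [hA ->]] := ht e; rewrite /param /=.
  by apply: (same_edge_mobius (e := e) zinj uA (uM e)) => v ve; rewrite (hA v ve) (hM e v ve).
by move=> e; exists (M e) => //; split=> //; exact: hM.
Qed.

(** Equality of cross-ratios along an edge gives a matrix for this edge. *)
Lemma matrices_of z : edge_injective T z -> CR_map o z = target_cr ->
  exists2 M : E -> 'M[F]_2, forall e, M e \in unitmx &
    forall e v, v \in T e -> mobius (M e) (z v) = Q v e.
Proof.
move=> zinj ez.
have h e : exists A : 'M[F]_2, A \in unitmx /\
    forall v, v \in T e -> mobius A (z v) = Q v e.
  have zn := edge_injective_neq ho e zinj; have Qn := @Q_neq e.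
  have [A uA [A0 A1 A2 A3]] := mobius_quad
    (zn 0%N 1%N isT isT isT) (zn 0%N 2%N isT isT isT) (zn 1%N 2%N isT isT isT)
    (zn 0%N 3%N isT isT isT)
    (Qn 0%N 1%N isT isT isT) (Qn 0%N 2%N isT isT isT) (Qn 1%N 2%N isT isT isT)
    (Qn 0%N 3%N isT isT isT) (congr1 (@^~ e) ez).
  exists A; split=> // v /(edgeP ho)[k k4 ->].
  by case: k k4 => [|[|[|[|]]]].
have [M hM] := choice h.
by exists M => e; [case: (hM e) | case: (hM e)].
Qed.

(** Otherwise an isolated vertex could be moved onto another one without changing
    cross-ratios, producing a degenerate configuration. *)
Lemma no_isolated z v : edge_injective T z -> CR_map o z = target_cr ->
  exists e, v \in T e.
Proof.
move=> zinj ez; apply: contrapT => iso.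
have niso e u : u \in T e -> u != v.
  by move=> ue; apply/eqP => uv; apply: iso; exists e; rewrite -uv.
have [u uv] : exists u, u != v.
  move: cardV; rewrite (cardD1 v) add1n ltnS => /card_gt0P[u].
  by rewrite inE => /andP[uv _]; exists u.
pose w x := if x == v then z u else z x.
have wE e x : x \in T e -> w x = z x by move=> /niso/negPf xv; rewrite /w xv.
have winj : edge_injective T w.
  by move=> e x y xe ye; rewrite (wE e x xe) (wE e y ye); exact: (zinj e).
have ew : CR_map o w = target_cr.
  by rewrite -ez; apply: funext => e; rewrite /CR_map !(wE e) //; exact: vtx_edge.
have /eqP := uv; apply; apply: (nodeg winj ew).
by rewrite /w eqxx (negPf uv).
Qed.

Lemma curve_of_mobius z (A : 'M[F]_2) : A \in unitmx ->
  curve_of (mobius A \o z) = curve_of z.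
Proof.
move=> uA; have uAV : invmx A \in unitmx by rewrite unitmx_inv.
rewrite predeqE => p; split=> -[t ht].
  exists (mobius (invmx A) t) => e; have [B uB [hB ->]] := ht e.
  exists (B *m A); first by rewrite unitmx_mul uB.
  split=> [v ve|]; rewrite -(mobius_comp _ _ uA); first exact: hB.
  by rewrite (mobiusVK uA).
exists (mobius A t) => e; have [B uB [hB ->]] := ht e.
exists (B *m invmx A); first by rewrite unitmx_mul uB.
split=> [v ve|]; rewrite -(mobius_comp _ _ uAV) /= (mobiusK uA) //.
exact: hB.
Qed.

(** From a curve, the parameters at which it meets the linear subvarieties form
    a configuration; it is not degenerate, and it can be normalized. *)
Lemma incident_curvesE : incident_curves = curve_of @` nfib.
Proof.
rewrite predeqE => C; split=> [[/(curvesP e0)[M uM ->] hC]|[z [zi _ _ _ ez] <-]].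
  have ht v : exists t, forall e, v \in T e -> mobius (M e) t = Q v e.
    by have [p [t ->] hp] := hC v; exists t => e /hp.
  have [z hz] := choice ht.
  have zinj : edge_injective T z.
    by move=> e u v ue ve zuv; apply: (Qinj ue ve); rewrite /= -(hz u e ue) -(hz v e ve) zuv.
  have ez : CR_map o z = target_cr.
    apply: funext => e; rewrite /target_cr /CR_map.
    by rewrite -!(hz _ e (vtx_edge ho e _)) cross_ratio_mobius.
  have zi := nodeg zinj ez.
  have zn j k : (j < 4)%N -> (k < 4)%N -> j != k -> z (vtx o e0 j) != z (vtx o e0 k).
    exact: edge_injective_neq ho _ _ _ _ zinj.
  have [A uA nA] := normalize_points (zn 0%N 1%N isT isT isT) (zn 0%N 2%N isT isT isT)
    (zn 1%N 2%N isT isT isT) zi.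
  exists (mobius A \o z); first by rewrite -ez.
  by rewrite curve_of_mobius //; apply: curve_ofE => // e v ve; exact: hz.
have zinj := injective_edge_injective (T := T) zi.
have [M uM hM] := matrices_of zinj ez.
rewrite (curve_ofE zinj uM hM); split; first by apply/(curvesP e0); exists M.
move=> v; exists (param (fun e => inr (M e)) (z v)); first by exists (z v).
by move=> e ve; exact: hM.
Qed.

(** Two parametrizations of the same curve differ by a Moebius transformation B,
    which maps one configuration to the other and fixes infinity, 0 and 1. *)
Lemma curve_of_inj z w : nfib z -> nfib w -> curve_of z = curve_of w -> z = w.
Proof.
move=> [zi z0 z1 z2 ez] [wi w0 w1 w2 ew] e.
have zinj := injective_edge_injective (T := T) zi.
have winj := injective_edge_injective (T := T) wi.
have [M uM hM] := matrices_of zinj ez; have [N uN hN] := matrices_of winj ew.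
rewrite (curve_ofE zinj uM hM) (curve_ofE winj uN hN) in e.
(* Both parametrizations must agree on the coordinate e0. *)
pose B := invmx (N e0) *m M e0.
have uB : B \in unitmx by rewrite unitmx_mul unitmx_inv uN uM.
have hB t k : mobius (M k) t = mobius (N k) (mobius B t).
  have [s hs] : mcurve N (param (fun e => inr (M e)) t) by rewrite -e; exists t.
  have h l : mobius (M l) t = mobius (N l) s := congr1 (@^~ l) hs.
  by rewrite /B -(mobius_comp _ _ (uM e0)) (h e0) (mobiusK (uN e0)) h.
have wB v : w v = mobius B (z v).
  have [k vk] := no_isolated v zinj ez.
  by apply: (mobius_inj (uN k)); rewrite (hN k v vk) -(hM k v vk) hB.
apply: funext => v; rewrite wB -[LHS]mobius1; apply: esym.
apply: (@mobius_eq3 _ _ _ None (Some 0) (Some 1)).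
- exact: uB.
- exact: unitmx1.
- by [].
- by [].
- by rewrite -[Some 0 == _]/(0 == 1 :> F) eq_sym oner_eq0.
- by rewrite mobius1 -{1}z0 -wB.
- by rewrite mobius1 -{1}z1 -wB.
by rewrite mobius1 -{1}z2 -wB.
Qed.

Lemma card_incident_curves : incident_curves #= nfib.
Proof.
rewrite incident_curvesE; apply: inj_card_eq => z w; rewrite !inE; exact: curve_of_inj.
Qed.


End CurvesThrough.

(** * General position and the count *)

Section CrDegree.
Variables (R : realType) (V E : finType) (T : hypergraph4 V E) (o : E -> 4.-tuple V).
Hypothesis ho : edge_ordering T o.
Hypothesis cardVE : #|V| = (#|E| + 3)%N.
Variable e0 : E.
Local Notation F := R[i].

(** The set of possible degrees is not empty by [generic_card_nfiber], so that
    the chosen value is one of them. *)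
Lemma generic_cr_degree : generic (fun c : 'I_#|E| -> F =>
  (forall e, c (enum_rank e) != 0 /\ c (enum_rank e) != 1) /\
  CR_fiber o (fun e => c (enum_rank e)) #= `I_(cr_degree R o)).
Proof.
have flatK (c : E -> F) : (fun e => c (enum_val (enum_rank e))) = c.
  by apply: funext => e; rewrite enum_rankK.
have [U [oU sU [c0 Uc0] hU]] : exists U : set (E -> F), [/\ affine_open U,
    U `<=` [set c | forall e, c e != 0 /\ c e != 1], U !=set0 &
    forall c, U c -> CR_fiber o c #= `I_(cr_degree R o)].
  rewrite /cr_degree; set S := (X in xget _ X).
  suff : exists d, S d by move=> Sd; exact: (xgetPex 0%N Sd).
  have [d [g g0 gP]] := generic_card_nfiber R ho e0 cardVE.
  (* This factor keeps the open set inside the locus of admissible cross-ratios. *)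
  pose k : {mpoly F[#|E|]} := \prod_i ('X_i * ('X_i - 1)).
  have kE c : k.@[c] = \prod_i (c i * (c i - 1)).
    by rewrite rmorph_prod; apply: eq_bigr => i _; rewrite /= mevalM mevalB mevalXU meval1.
  have k0 : k != 0.
    apply/prodf_neq0 => i _; apply/eqP => /(congr1 (meval (fun=> 2%:R))).
    rewrite mevalM mevalB mevalXU meval1 meval0 => /eqP.
    by rewrite mulf_eq0 subr_eq0 -[1]/(1%:R) eqr_nat pnatr_eq0.
  exists d, [set c | (g * k).@[fun i => c (enum_val i)] != 0]; split.
  - exists [:: g * k]; rewrite predeqE => c /=; split=> [h f|h].
      by rewrite inE => /eqP ->; apply/eqP/negPn/negP.
    by apply/negP/negPn/eqP; apply: h; rewrite inE eqxx.
  - move=> c /=; rewrite mevalM mulf_eq0 negb_or kE => /andP[_ /prodf_neq0 h] e.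
    have := h (enum_rank e) isT; rewrite enum_rankK mulf_eq0 negb_or subr_eq0.
    by move/andP.
  - have [c hc] := mpoly_nonroot (mulf_neq0 g0 k0); exists (fun e => c (enum_rank e)) => /=.
    by rewrite (_ : (fun i => _) = c) //; apply: funext => i; rewrite enum_valK.
  move=> c /=; rewrite mevalM mulf_eq0 negb_or => /andP[/gP + _].
  rewrite flatK => h; exact: card_eq_trans (card_CR_fiber ho e0 c) h.
have [s hs] := oU.
have [f fs fc0] : exists2 f, f \in s & f.@[fun i => c0 (enum_val i)] != 0.
  apply: contrapT => h; have : (~` U) c0; last by [].
  rewrite hs => f fs; apply: contrapT => /eqP f0; apply: h; by exists f.
exists f; first by apply: contraNneq fc0 => ->; rewrite meval0.
move=> c fc; have Uc : U (fun e => c (enum_rank e)).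
  apply: contrapT => nU; have : (~` U) (fun e => c (enum_rank e)) by [].
  rewrite hs => /(_ f fs) /eqP; rewrite (_ : (fun i => _) = c) ?(negPf fc) //.
  by apply: funext => i; rewrite enum_valK.
by split; [exact: sU | exact: hU].
Qed.

End CrDegree.

Section GenericTarget.
Variables (R : realType) (V E : finType) (T : hypergraph4 V E) (o : E -> 4.-tuple V).
Hypothesis ho : edge_ordering T o.
Local Notation F := R[i].

Lemma vtx_incidence e k : e \in edges_at T (vtx o e k).
Proof. by rewrite inE vtx_edge. Qed.

Definition incidence_at e k : incidences T :=
  existT (fun v => {e : E | e \in edges_at T v}) (vtx o e k) (exist _ e (vtx_incidence e k)).

(** The points P_v as a total function of vertices and edges; the default value
    concerns edges that are not incident to the vertex. *)
Definition target (P : incidences T -> P1 R) (v : V) (e : E) : P1 R :=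
  if insub e is Some s then P (existT (fun v => {e : E | e \in edges_at T v}) v s) else None.

Lemma target_incidence P v (s : {e : E | e \in edges_at T v}) :
  target P v (val s) = P (existT _ v s).
Proof. by rewrite /target valK. Qed.

Lemma target_vtx P e k : target P (vtx o e k) e = P (incidence_at e k).
Proof. exact: (target_incidence P (exist _ e (vtx_incidence e k))). Qed.

Definition incidence_bracket (j k : incidences T) : hpoly R (incidences T) :=
  bracket_form 1%:M j 1%:M k.

Lemma heval_incidence_bracket P j k : heval P (incidence_bracket j k) = bracket (P j) (P k).
Proof. by rewrite hevalE hev_bracket_form !mul1mx. Qed.

Lemma hevalM P (f g : hpoly R (incidences T)) :
  heval P (f * g) = heval P f * heval P g.
Proof. exact: mevalM. Qed.

Lemma hevalXn P (f : hpoly R (incidences T)) k : heval P (f ^+ k) = heval P f ^+ k.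
Proof. exact: rmorphXn. Qed.

Lemma hevalZ P (f : hpoly R (incidences T)) c : heval P (c *: f) = c * heval P f.
Proof. exact: mevalZ. Qed.

Lemma heval_prod P (I : Type) (s : seq I) (f : I -> hpoly R (incidences T)) :
  heval P (\prod_(i <- s) f i) = \prod_(i <- s) heval P (f i).
Proof. exact: rmorph_prod. Qed.

Lemma heval_sum P (I : Type) (s : seq I) (f : I -> hpoly R (incidences T)) :
  heval P (\sum_(i <- s) f i) = \sum_(i <- s) heval P (f i).
Proof. exact: raddf_sum. Qed.

Definition cr_num_form e :=
  incidence_bracket (incidence_at e 2) (incidence_at e 0) *
  incidence_bracket (incidence_at e 3) (incidence_at e 1).

Definition cr_den_form e :=
  incidence_bracket (incidence_at e 2) (incidence_at e 1) *
  incidence_bracket (incidence_at e 3) (incidence_at e 0).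

Lemma heval_cr_num_form P e : heval P (cr_num_form e) = cr_num o (target P ^~ e) e.
Proof.
rewrite /cr_num_form hevalM.
by congr (_ * _); rewrite heval_incidence_bracket !target_vtx.
Qed.

Lemma heval_cr_den_form P e : heval P (cr_den_form e) = cr_den o (target P ^~ e) e.
Proof.
rewrite /cr_den_form hevalM.
by congr (_ * _); rewrite heval_incidence_bracket !target_vtx.
Qed.

(** Each of the four points of an edge occurs once in the numerator and in the
    denominator of its cross-ratio. *)
Definition edge_degree e (j : incidences T) : nat :=
  ((j == incidence_at e 0) + (j == incidence_at e 1) +
   (j == incidence_at e 2) + (j == incidence_at e 3))%N.

Lemma mhom_cr_num_form e : mhom (edge_degree e) (cr_num_form e).
Proof.
apply: mhom_eq (mhomM (mhom_bracket_form _ _ _ _) (mhom_bracket_form _ _ _ _)) _ => j.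
by rewrite /edge_degree; do 4!case: (j == _).
Qed.

Lemma mhom_cr_den_form e : mhom (edge_degree e) (cr_den_form e).
Proof.
apply: mhom_eq (mhomM (mhom_bracket_form _ _ _ _) (mhom_bracket_form _ _ _ _)) _ => j.
by rewrite /edge_degree; do 4!case: (j == _).
Qed.

(** The polynomial h in the cross-ratios of P, cleared of denominators.  The
    first factor makes the points on each edge distinct where it does not
    vanish. *)
Definition pullback (h : {mpoly F[#|E|]}) : hpoly R (incidences T) :=
  (\prod_e cr_den_form e) * \sum_(m <- msupp h) h@_m *:
    \prod_(i < #|E|) (cr_num_form (enum_val i) ^+ m i * cr_den_form (enum_val i) ^+ (msize h - m i)).

Lemma mhom_pullback h : multihomogeneous (pullback h).
Proof.
apply: mhomP; apply: mhomM; first by apply: mhom_prod => e; exact: mhom_cr_den_form.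
apply: (@mhom_sum _ _ _ _ (fun j => \sum_(i < #|E|) msize h * edge_degree (enum_val i) j)%N) => m mh.
apply: mhomZ; apply: mhom_prod => i.
have hN := mhomXn (k := m i) (@mhom_cr_num_form (enum_val i)).
have hD := mhomXn (k := msize h - m i) (@mhom_cr_den_form (enum_val i)).
apply: (mhom_eq (mhomM hN hD)) => j /=.
rewrite -mulnDl subnKC //.
apply: leq_trans (ltnW (msize_mdeg_lt mh)).
by rewrite mdegE (bigD1 i) //= leq_addr.
Qed.

Lemma heval_pullback P h : (forall e, cr_den o (target P ^~ e) e != 0) ->
  heval P (pullback h) = (\prod_e cr_den o (target P ^~ e) e) *
    ((\prod_(i < #|E|) cr_den o (target P ^~ (enum_val i)) (enum_val i) ^+ msize h) *
     h.@[fun i => target_cr o (target P) (enum_val i)]).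
Proof.
move=> den0; rewrite /pullback hevalM heval_prod; congr (_ * _).
  by apply: eq_bigr => e _; exact: heval_cr_den_form.
rewrite mevalE heval_sum mulr_sumr; apply: eq_big_seq => m mh.
rewrite hevalZ mulrCA; congr (_ * _); rewrite heval_prod -big_split /=.
apply: eq_bigr => i _; rewrite hevalM.
move: (heval_cr_num_form P (enum_val i)) (heval_cr_den_form P (enum_val i)).
move: (cr_num_form _) (cr_den_form _) => N D eN eD; rewrite !hevalXn eN eD.
rewrite /target_cr CR_mapE expr_div_n.
have mi : (m i <= msize h)%N.
  apply: leq_trans (ltnW (msize_mdeg_lt mh)).
  by rewrite mdegE (bigD1 i) //= leq_addr.
rewrite mulrCA; congr (_ * _).
by apply: esym; apply: (canLR (mulfK _)); rewrite ?expf_neq0 // -exprD subnK.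
Qed.

Lemma pullback_neq0 P h : heval P (pullback h) != 0 <->
  (forall e, cr_den o (target P ^~ e) e != 0) /\
  h.@[fun i => target_cr o (target P) (enum_val i)] != 0.
Proof.
split=> [hP|[den0 h0]]; last first.
  rewrite heval_pullback // !mulf_neq0 //; apply/prodf_neq0 => e _ //.
  by rewrite expf_neq0.
have den0 e : cr_den o (target P ^~ e) e != 0.
  move: hP; rewrite /pullback hevalM mulf_eq0 negb_or => /andP[+ _].
  by rewrite heval_prod => /prodf_neq0/(_ e isT); rewrite -heval_cr_den_form.
split=> //; move: hP; rewrite heval_pullback // !mulf_eq0 !negb_or.
by move=> /and3P[].
Qed.

(** Coincidences between the four points make the denominator of the cross-ratio
    vanish, or its numerator, or make them equal. *)
Lemma target_injective P e : cr_den o (target P ^~ e) e != 0 ->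
  target_cr o (target P) e != 0 -> target_cr o (target P) e != 1 ->
  {in T e &, injective (target P ^~ e)}.
Proof.
rewrite /target_cr CR_mapE => d0; rewrite mulf_eq0 invr_eq0 (negPf d0) orbF => n0 n1.
have {}n1 : cr_num o (target P ^~ e) e != cr_den o (target P ^~ e) e.
  by apply: contra n1 => /eqP ->; rewrite divff.
move: d0 n0 n1; rewrite /cr_num /cr_den.
set q := fun k => target P (vtx o e k) e.
rewrite -[target P (vtx o e 0) e]/(q 0%N) -[target P (vtx o e 1) e]/(q 1%N).
rewrite -[target P (vtx o e 2) e]/(q 2%N) -[target P (vtx o e 3) e]/(q 3%N).
rewrite !mulf_eq0 !negb_or !bracket_eq0 => /andP[q21 q30] /andP[q20 q31] nn.
have q10 : q 1%N != q 0%N.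
  by apply: contra nn => /eqP ->; rewrite mulrC.
have q32 : q 3%N != q 2%N.
  by apply: contra nn => /eqP ->; rewrite mulrC.
have qn i j : (j < i < 4)%N -> q i != q j.
  by case: i j => [|[|[|[|i]]]] [|[|[|j]]]; rewrite ?andbF.
move=> u v /(edgeP ho)[i i4 ->] /(edgeP ho)[j j4 ->] /eqP.
case: (ltngtP i j) => [ij|ji|->] //.
  by rewrite eq_sym -[_ == _]/(q j == q i) (negPf (qn _ _ _)) // ij.
by rewrite -[_ == _]/(q i == q j) (negPf (qn _ _ _)) // ji.
Qed.

(** Arbitrary cross-ratios c are realized by the points infinity, 0, 1 and c e
    on each edge e, independently of the other edges. *)
Definition realize (c : E -> F) (j : incidences T) : P1 R :=
  let e := val (tagged j) in
  nth None [:: None; Some 0; Some 1; Some (c e)] (index (tag j) (o e)).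

Lemma realize_incidence c e k : (k < 4)%N ->
  realize c (incidence_at e k) = nth None [:: None; Some 0; Some 1; Some (c e)] k.
Proof.
move=> k4; rewrite /realize /=; congr nth.
rewrite /vtx (tnth_nth (vtx o e 0)) index_uniq ?inordK ?size_tuple //.
exact: uniq_edge ho _.
Qed.

Lemma target_cr_realize c : target_cr o (target (realize c)) = c.
Proof.
apply: funext => e; rewrite /target_cr /CR_map -!/(vtx _ _ _) !target_vtx !realize_incidence //=.
exact: cross_ratio_std.
Qed.

Lemma cr_den_realize c e : c e != 0 -> cr_den o (target (realize c) ^~ e) e != 0.
Proof.
move=> ce; rewrite /cr_den !target_vtx !realize_incidence //= mulf_neq0 // bracket_eq0 //.
by rewrite -[_ == _]/(1 == 0 :> F) oner_eq0.
Qed.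

End GenericTarget.

Theorem theorem2p1 (R : realType) (n : nat) (hn : (4 <= n)%N) (E : finType)
    (T : hypergraph4 'I_n E) (hE : #|E| = (n - 3)%N)
    (o : E -> 4.-tuple 'I_n) (ho : edge_ordering T o) :
  for_general (fun P : incidences T -> P1 R =>
    let P_ (v : 'I_n) (e : {e : E | e \in edges_at T v}) : P1 R :=
      P (existT _ v e) in
    let Y (v : 'I_n) : set (E -> P1 R) := linear_subvariety (P_ v) in
    let Z (v : 'I_n) : set (set (E -> P1 R)) := incidence (P_ v) in
    ([set C | curves C /\ forall v, C `&` Y v !=set0]
       #= `I_(cr_degree R o)) /\
    (\bigcap_v Z v #= `I_(cr_degree R o))).
Proof.
have cardVE : #|'I_n| = (#|E| + 3)%N by rewrite card_ord hE subnK // ltnW.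
have cardV : (1 < #|'I_n|)%N by rewrite card_ord (leq_trans _ hn).
have [e0 _] : exists e : E, e \in predT by apply/card_gt0P; rewrite hE subn_gt0.
have v0 : 'I_n by exact: vtx o e0 0.
have [h h0 hP] := generic_and (generic_cr_degree R ho cardVE e0)
  (generic_no_degenerate R ho cardVE e0).
have flatK (c : E -> R[i]) : (fun e => c (enum_val (enum_rank e))) = c.
  by apply: funext => e; rewrite enum_rankK.
exists [set P | heval P (pullback (R := R) ho h) != 0]; split.
- exists [:: pullback (R := R) ho h] => [f|]; first by rewrite inE => /eqP ->; exact: mhom_pullback.
  rewrite predeqE => P /=; split=> [nh f|nh].
    by rewrite inE => /eqP ->; apply/eqP/negPn/negP.
  by apply/negP/negPn/eqP; apply: nh; rewrite inE eqxx.
- have [c hc] := mpoly_nonroot h0; exists (realize o (fun e => c (enum_rank e))) => /=.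
  have [[c01 _] _] := hP c hc.
  apply/pullback_neq0; rewrite (target_cr_realize ho); split.
    by move=> e; apply: (cr_den_realize ho); case: (c01 e).
  by rewrite (_ : (fun i => _) = c) //; apply: funext => i; rewrite enum_valK.
move=> P /pullback_neq0[den0 hh] P_ Y Z.
have [[c01 cd] nd] := hP _ hh.
rewrite flatK in cd nd.
have c01' e : target_cr o (target P) e != 0 /\ target_cr o (target P) e != 1.
  by have := c01 e; rewrite enum_rankK.
have Qinj e : {in T e &, injective (target P ^~ e)}.
  by have [? ?] := c01' e; apply: (target_injective ho).
have YE v q : Y v q <-> forall e, v \in T e -> q e = target P v e.
  split=> [hq e ve|hq s].
    have ve' : e \in edges_at T v by rewrite inE.
    exact: etrans (hq (exist _ e ve')) (esym (target_incidence P (exist _ e ve'))).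
  rewrite (hq (val s)); first exact: target_incidence.
  by have := valP s; rewrite inE.
have CE : [set C | curves C /\ forall v, C `&` Y v !=set0] = incident_curves T (target P).
  rewrite predeqE => C; split=> -[cC hC]; split=> // v; have := hC v.
    by move=> [p [Cp /YE hp]]; exists p.
  by move=> [p Cp hp]; exists p; split=> //; apply/YE.
have ZE : \bigcap_v Z v = [set C | curves C /\ forall v, C `&` Y v !=set0].
  rewrite predeqE => C; split=> [hC|[cC hC] v _]; last by split; [exact: cC | exact: hC].
  by split=> [|v]; [case: (hC v0 I) | case: (hC v I)].
have key : incident_curves T (target P) #= `I_(cr_degree R o).
  apply: card_eq_trans (card_incident_curves ho cardV e0 Qinj nd) _.
  by apply: card_eq_trans cd; rewrite card_eq_sym; exact: card_CR_fiber.
by rewrite ZE CE.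
Qed.
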